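(* For every DCTP function $f:2^{[n]}\to\mathbb R$, the domains of affinity of its concave extension $\widehat f$ over the hypercube $[0,1]^n$ belong to $\mathcal{GPP}(n)$ (i.e. are generalized polypositroids). Moreover, the fan $\mathcal{MV}$ is exactly the secondary fan of the g-positroid subdivisions of the hypercube $[0,1]^n$.
   Context: Notation: $[n]=\{1,\dots,n\}$; $Xij$ means $X\cup\{i,j\}$, etc.; $x(S)=\sum_{i\in S}x_i$; $e_J=\sum_{i\in J}e_i$; $\mathcal I(n)$ is the set of intervals $[a,b]=\{a,a+1,\dots,b\}\subseteq[n]$. A function $f:2^{[n]}\to\mathbb R$ is a DCTP (discrete concave tropical Plücker) function if it is submodular and satisfies $f(Xik)+f(Xj)=\max\{f(Xij)+f(Xk),\,f(Xjk)+f(Xi)\}$ for all $i<j<k$ and $X\subseteq[n]\setminus\{i,j,k\}$. The concave extension of $f$ is $\widehat f(x)=\max\{\sum_J\lambda_Jf(J):\lambda_J\ge0,\sum_J\lambda_J=1,\sum_J\lambda_Je_J=x\}$, $x\in[0,1]^n$. Its domains of affinity are the projections to $[0,1]^n$ of the faces of its upper envelope; they form the (regular) subdivision of $[0,1]^n$ induced by $f$. A strong pair is a pair $f,g:2^{[n]}\to\mathbb R$ with $f(\emptyset)=g(\emptyset)=0$, $g\le f$, $f$ submodular, $g$ supermodular, and $f(B)-f(B\setminus A)\ge g(A)-g(A\setminus B)$ for all $A,B$. The generalized polymatroid of a strong pair is $Q(f,g)=\{x\in\mathbb R^n:g(A)\le x(A)\le f(A)\ \forall A\subseteq[n]\}$.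 It is a generalized polypositroid (g-polypositroid) if $Q(f,g)=\{x\in\mathbb R^n:g([a,b])\le x([a,b])\le f([a,b])\ \forall[a,b]\in\mathcal I(n)\}$; $\mathcal{GPP}(n)$ denotes the class of g-polypositroids in $\mathbb R^n$. A g-matroid is a generalized polymatroid with all vertices in $\{0,1\}^n$; a g-positroid is a g-polypositroid that is also a g-matroid. A g-positroid subdivision of $[0,1]^n$ is a polyhedral subdivision all of whose cells are g-positroids. The fan $\mathcal{MV}$: for each choice function $\epsilon$ assigning to every $(X,i<j<k)$, $X\subseteq[n]\setminus\{i,j,k\}$, one of the two terms $f(Xij)+f(Xk)$, $f(Xjk)+f(Xi)$, let $C_\epsilon$ be the polyhedral cone of real submodular functions $f$ on $2^{[n]}$ such that $f(Xik)+f(Xj)$ equals the chosen term and is $\ge$ the other, for all $(X,i,j,k)$. The cones $C_\epsilon$ and all their faces form a fan with support the set of DCTP functions, whose lineality space is $\{f(S)=c+\sum_{i\in S}z_i\}$; $\mathcal{MV}$ is its quotient by the lineality space. The secondary fan of the g-positroid subdivisions of $[0,1]^n$: the fan, in the space of functions $2^{[n]}\to\mathbb R$ modulo the functions $S\mapsto c+\sum_{i\in S}z_i$, whose cones are the closures of the sets of all $f$ that induce a given regular g-positroid subdivision of $[0,1]^n$. *)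

(* Defs.v *)
From HB Require Import structures.
From mathcomp Require Import all_boot all_order all_algebra.
From mathcomp Require Import all_classical all_reals all_analysis.

Set Implicit Arguments.
Unset Strict Implicit.
Unset Printing Implicit Defensive.

Import Order.TTheory GRing.Theory Num.Theory.
Import numFieldNormedType.Exports.

Local Open Scope classical_set_scope.
Local Open Scope ring_scope.

(* The ground set [n] = {1, ..., n} is 'I_n, with its order; R^n is 'rV[R]_n.
   Set functions carry the product (pointwise) topology, which is the usual
   topology of the finite-dimensional space R^(2^n). *)
Definition setfun (R : realType) (n : nat) : Type := {ptws {set 'I_n} -> R}.

HB.instance Definition _ (R : realType) (n : nat) :=
  Topological.on (setfun R n).
HB.instance Definition _ (R : realType) (n : nat) :=
  GRing.Lmodule.copy (setfun R n) ({set 'I_n} -> R).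

Section Polyhedra.
Variables (R : realType) (V : lmodType R).

(* Nonempty faces of a polyhedron P; P itself is one (take l = 0). *)
Definition face (P F : set V) : Prop :=
  F !=set0 /\
  exists l : {scalar V}, F = [set x | P x /\ forall y, P y -> l y <= l x].

Definition vertex (P : set V) (x : V) : Prop := face P [set x].

Definition polytope (P : set V) : Prop :=
  exists m (v : 'I_m -> V),
    P = [set x | exists w : 'I_m -> R,
           [/\ forall i, 0 <= w i, \sum_i w i = 1 & x = \sum_i w i *: v i]].

Definition polyhedral_subdivision (K : set V) (Sigma : set (set V)) : Prop :=
  [/\ finite_set Sigma,
      forall P, Sigma P -> polytope P /\ P !=set0,
      \bigcup_(P in Sigma) P = K,
      forall P F, Sigma P -> face P F -> Sigma F
    & forall P P', Sigma P -> Sigma P' -> P `&` P' !=set0 ->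
        face P (P `&` P') /\ face P' (P `&` P')].

End Polyhedra.

Section GPolypositroids.
Variables (R : realType) (n : nat).
Implicit Types (f g : setfun R n) (A B X : {set 'I_n}) (x : 'rV[R]_n).

Definition submodular f : Prop :=
  forall A B, f (A :|: B) + f (A :&: B) <= f A + f B.

Definition supermodular g : Prop :=
  forall A B, g A + g B <= g (A :|: B) + g (A :&: B).

Definition xsum x A : R := \sum_(i in A) x 0 i.

Definition strong_pair f g : Prop :=
  [/\ f finset.set0 = 0 /\ g finset.set0 = 0,
      forall A, g A <= f A,
      submodular f,
      supermodular g
    & forall A B, g A - g (A :\: B) <= f B - f (B :\: A)].

Definition Qpoly f g : set 'rV[R]_n :=
  [set x | forall A, g A <= xsum x A <= f A].

Definition itvset (a b : 'I_n) : {set 'I_n} := [set i : 'I_n | (a <= i <= b)%N]%SET.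

Definition Qinterval f g : set 'rV[R]_n :=
  [set x | forall a b : 'I_n, (a <= b)%N ->
     g (itvset a b) <= xsum x (itvset a b) <= f (itvset a b)].

Definition g_polymatroid (P : set 'rV[R]_n) : Prop :=
  exists f g, strong_pair f g /\ P = Qpoly f g.

Definition GPP (P : set 'rV[R]_n) : Prop :=
  exists f g, [/\ strong_pair f g, P = Qpoly f g & Qpoly f g = Qinterval f g].

Definition g_matroid (P : set 'rV[R]_n) : Prop :=
  g_polymatroid P /\ forall x, vertex P x -> forall i, x 0 i = 0 \/ x 0 i = 1.

Definition g_positroid (P : set 'rV[R]_n) : Prop := GPP P /\ g_matroid P.

End GPolypositroids.

Section ConcaveExtension.
Variables (R : realType) (n : nat).
Implicit Types (f : setfun R n) (x : 'rV[R]_n).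

Definition cube : set 'rV[R]_n := [set x | forall i, 0 <= x 0 i <= 1].

Definition eset (J : {set 'I_n}) : 'rV[R]_n := \row_i (i \in J)%:R.

(* For x in the cube the supremum is a maximum: the set of admissible weights
   is nonempty and compact. *)
Definition fhat f x : R :=
  sup [set t | exists w : {set 'I_n} -> R,
         [/\ forall J, 0 <= w J, \sum_J w J = 1, \sum_J w J *: eset J = x
           & t = \sum_J w J * f J]].

Definition upper_envelope f : set ('rV[R]_n * R^o) :=
  [set p | cube p.1 /\ p.2 = fhat f p.1].

Definition hypograph f : set ('rV[R]_n * R^o) :=
  [set p | cube p.1 /\ p.2 <= fhat f p.1].

(* The faces of the upper envelope are the faces of the polyhedron
   [hypograph f] that contain no vertical ray, i.e., lie on the graph. *)
Definition domain_of_affinity f (D : set 'rV[R]_n) : Prop :=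
  exists F, [/\ face (hypograph f) F, F `<=` upper_envelope f & D = fst @` F].

Definition induced_subdivision f : set (set 'rV[R]_n) :=
  [set D | domain_of_affinity f D].

Definition regular_subdivision (Sigma : set (set 'rV[R]_n)) : Prop :=
  exists f, Sigma = induced_subdivision f.

Definition g_positroid_subdivision (Sigma : set (set 'rV[R]_n)) : Prop :=
  polyhedral_subdivision cube Sigma /\ forall P, Sigma P -> g_positroid P.

End ConcaveExtension.

Section DCTP.
Variables (R : realType) (n : nat).
Implicit Types (f : setfun R n) (X : {set 'I_n}) (i j k : 'I_n).

Definition triple X i j k : Prop :=
  [/\ (i < j)%N, (j < k)%N & X \subset (~: [set i; j; k])%SET].

Definition term_ik_j f X i j k : R :=
  f (X :|: [set i; k])%SET + f (X :|: [set j])%SET.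
Definition term_ij_k f X i j k : R :=
  f (X :|: [set i; j])%SET + f (X :|: [set k])%SET.
Definition term_jk_i f X i j k : R :=
  f (X :|: [set j; k])%SET + f (X :|: [set i])%SET.

Definition DCTP f : Prop :=
  submodular f /\
  forall X i j k, triple X i j k ->
    term_ik_j f X i j k = Num.max (term_ij_k f X i j k) (term_jk_i f X i j k).

(* [true] selects f(Xij) + f(Xk) and [false] selects f(Xjk) + f(Xi); values
   at arguments that do not satisfy [triple] are irrelevant. *)
Definition choice_fun : Type := {set 'I_n} -> 'I_n -> 'I_n -> 'I_n -> bool.

Definition chosen_term (e : choice_fun) f X i j k : R :=
  if e X i j k then term_ij_k f X i j k else term_jk_i f X i j k.
Definition other_term (e : choice_fun) f X i j k : R :=
  if e X i j k then term_jk_i f X i j k else term_ij_k f X i j k.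

Definition Ccone (e : choice_fun) : set (setfun R n) :=
  [set f | submodular f /\
     forall X i j k, triple X i j k ->
       term_ik_j f X i j k = chosen_term e f X i j k /\
       other_term e f X i j k <= term_ik_j f X i j k].

End DCTP.

Local Open Scope quotient_scope.

Section Fans.
Variables (R : realType) (n : nat).

Definition lin_rel (f g : setfun R n) : bool :=
  `[< exists (c : R) (z : 'I_n -> R),
        forall S, f S - g S = c + \sum_(i in S) z i >].

Lemma lin_rel_refl : reflexive lin_rel.
Proof.
move=> f; apply/asboolP; exists 0, (fun=> 0) => S.
by rewrite subrr big1 // addr0.
Qed.

Lemma lin_rel_sym : symmetric lin_rel.
Proof.
have H f g : lin_rel f g -> lin_rel g f.
  move=> /asboolP [c [z h]]; apply/asboolP; exists (- c), (fun i => - z i) => S.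
  by rewrite -opprB h sumrN opprD.
by move=> f g; apply/idP/idP; apply: H.
Qed.

Lemma lin_rel_trans : transitive lin_rel.
Proof.
move=> g f h /asboolP [c [z Hfg]] /asboolP [d [y Hgh]].
apply/asboolP; exists (c + d), (fun i => z i + y i) => S.
by rewrite -(subrK (g S) (f S)) -addrA Hfg Hgh big_split /= addrACA.
Qed.

Canonical lin_equiv := EquivRel lin_rel lin_rel_refl lin_rel_sym lin_rel_trans.

(* The space of set functions modulo the functions S |-> c + z(S), with the
   quotient topology. *)
Definition setfun_mod : topologicalType :=
  quotient_topology {eq_quot lin_equiv}.

Definition proj_mod (f : setfun R n) : setfun_mod :=
  \pi_{eq_quot lin_equiv} f.

Definition MV : set (set setfun_mod) :=
  [set C | exists e F, face (@Ccone R n e) F /\ C = proj_mod @` F].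

Definition secondary_fan : set (set setfun_mod) :=
  [set C | exists Sigma : set (set 'rV[R]_n),
     [/\ regular_subdivision Sigma, g_positroid_subdivision Sigma
       & C = closure (proj_mod @` [set f | induced_subdivision f = Sigma])]].

End Fans.

Arguments MV : clear implicits.
Arguments secondary_fan : clear implicits.

(* Main.v *)
(* Encode [J] by its height function [k |-> #|J :&: [1, k]|], up to adding a
   constant. A DCTP function [f] is then supermodular for the pointwise maximum
   and minimum of height functions ("L-concave"), because every incomparable
   pair reduces to diamonds in which two coordinates move by 1, and these are
   instances of submodularity or of a three- or four-term Pluecker relation.
   Hence the cells argmax (f + z), whose convex hulls are the domains of
   affinity, are stable under max and min, so they are described by difference
   constraints on heights, which are interval inequalities; rounding the partial
   sums of a real point shows that its hull satisfies no others. The Pluecker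
   relations also give the valuated-matroid exchange property, and the rank
   functions of the resulting matroids form the strong pair.

   For the fans, the excess of [f] in the max-min inequality of any two heights
   is a sum of slacks of local constraints. So if [f] and [g] have the same tight
   constraints, [g] is modular on every cell of [f]; a maximal chain of that cell
   lies in a cell of [g], and modularity puts the whole cell there. Thus the
   induced subdivision is determined by the tight constraints, i.e. by the face
   of the cone containing [f] in its relative interior. Conversely, a violated
   relation produces a cell that is a segment of direction [e_i + e_j] or
   [e_i + e_j - e_k], or a square, none of which is a g-positroid, and a tight
   relation is recognized by a cell that contains all of its sets. *)

Require Import Defs.
From HB Require Import structures.
From mathcomp Require Import all_boot all_order all_algebra.
From mathcomp Require Import all_classical all_reals all_analysis.
From mathcomp Require Import zify ring lra.

Set Implicit Arguments.
Unset Strict Implicit.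
Unset Printing Implicit Defensive.

Import Order.TTheory GRing.Theory Num.Theory.
Import numFieldNormedType.Exports.

Local Open Scope ring_scope.

(** * Height functions *)

(** Heights are not normalised, so a pair of sets carries one inequality for each relative
    translation of its heights; this is how a single max-min inequality accounts for submodularity
    and the Pluecker relations at once. Raising a height at an interior position replaces an element
    by its predecessor; at [0] it deletes the first element and at [n] it adds the last one. The
    obstacle is the equality case: fans are compared through tight constraints only, and a four-term
    excess is not a sum but the smaller of two three-term slacks. So each inequality is carried
    together with the dependence of its equality case on the tight constraints ([slacklike]).
    Different functions are compared through a family of simplices that does not depend on them, the
    hulls of [clique]s: every point of the cube lies in such a hull, and every clique lies in a cell
    of each L-concave function. *)

Section Heights.
Variable n : nat.
Implicit Types (p q r : nat -> int) (J K : {set 'I_n}) (c : int).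

Definition height p := forall k, (k < n)%N -> p k <= p k.+1 <= p k + 1.

Definition steps p : {set 'I_n} := [set i : 'I_n | p i != p i.+1]%SET.

Definition ht J (k : nat) : int := \sum_(i in J | (i < k)%N) 1.

Definition hmax p q k := Num.max (p k) (q k).
Definition hmin p q k := Num.min (p k) (q k).
Definition shift c p k := p k + c.
Definition bump_at (a : nat) p k := p k + (k == a)%:Z.

Lemma in_steps p (i : 'I_n) : (i \in steps p) = (p i != p i.+1).
Proof. by rewrite inE. Qed.

Lemma height_step p (i : 'I_n) : height p -> p i.+1 = p i + (i \in steps p)%:Z.
Proof. by move=> /(_ i (ltn_ord i)); rewrite in_steps; case: eqVneq => /=; lia. Qed.

Lemma ht0 J : ht J 0 = 0.
Proof. by rewrite /ht big_pred0 // => i; rewrite ltn0 andbF. Qed.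

Lemma htS J (i : 'I_n) : ht J i.+1 = ht J i + (i \in J)%:Z.
Proof.
rewrite /ht; case: (boolP (i \in J)) => iJ.
  rewrite (bigD1 i) /=; last by rewrite iJ ltnSn.
  rewrite addrC; congr (_ + _); apply: eq_bigl => j.
  by rewrite -andbA; congr (_ && _); rewrite -val_eqE ltnS /=; lia.
rewrite addr0; apply: eq_bigl => j; rewrite ltnS.
by case: (eqVneq j i) iJ => [-> /negbTE -> //|]; rewrite -val_eqE /=; lia.
Qed.

Lemma ht_height J : height (ht J).
Proof. by move=> k kn; have := htS J (Ordinal kn) => /= ->; case: (_ \in _); lia. Qed.

Lemma steps_ht J : steps (ht J) = J.
Proof.
apply/setP => i; rewrite in_steps htS; case: (i \in J) => /=; last by rewrite addr0 eqxx.
by apply/eqP; lia.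
Qed.

Lemma height_eq p k : height p -> (k <= n)%N -> p k = p 0%N + ht (steps p) k.
Proof.
move=> hp; elim: k => [|k IH] kn; first by rewrite ht0 addr0.
have := height_step (Ordinal kn) hp; have := htS (steps p) (Ordinal kn) => /= -> ->.
by rewrite (IH (ltnW kn)) addrA.
Qed.

Lemma eq_steps p q : (forall k, (k <= n)%N -> p k = q k) -> steps p = steps q.
Proof. by move=> e; apply/setP => i; rewrite !in_steps !e // ltnW. Qed.

Lemma steps_shift c p : steps (shift c p) = steps p.
Proof. by apply/setP => i; rewrite !in_steps /shift; lia. Qed.

Lemma height_shift c p : height p -> height (shift c p).
Proof. by move=> hp k /hp; rewrite /shift; lia. Qed.

Lemma height_max p q : height p -> height q -> height (hmax p q).
Proof. by move=> hp hq k kn; move: (hp k kn) (hq k kn); rewrite /hmax; lia. Qed.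

Lemma height_min p q : height p -> height q -> height (hmin p q).
Proof. by move=> hp hq k kn; move: (hp k kn) (hq k kn); rewrite /hmin; lia. Qed.

Lemma steps_maxmin p q (i : 'I_n) : height p -> height q ->
  ((i \in steps (hmax p q)) + (i \in steps (hmin p q)) =
   (i \in steps p) + (i \in steps q))%N.
Proof.
move=> /(_ i (ltn_ord i)) hp /(_ i (ltn_ord i)) hq.
by rewrite !in_steps /hmax /hmin; lia.
Qed.

Lemma sum_maxmin (V : zmodType) (z : 'I_n -> V) p q : height p -> height q ->
  \sum_(i in steps (hmax p q)) z i + \sum_(i in steps (hmin p q)) z i =
  \sum_(i in steps p) z i + \sum_(i in steps q) z i.
Proof.
move=> hp hq; rewrite !(big_mkcond (fun i => i \in steps _)) /= -!big_split /=.
apply: eq_bigr => i _; have := steps_maxmin i hp hq.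
by case: (_ \in _); case: (_ \in _); case: (_ \in _); case: (_ \in _);
  rewrite /= ?addr0 ?add0r.
Qed.

Lemma steps_bump a p (i : 'I_n) : height p -> height (bump_at a p) ->
  (i \in steps (bump_at a p)) =
  (i.+1 == a) || (val i != a) && (i \in steps p).
Proof.
move=> /(_ i (ltn_ord i)) hp /(_ i (ltn_ord i)); rewrite !in_steps /bump_at /=.
by case: (eqVneq i.+1 a); case: (eqVneq (val i) a) => /=; lia.
Qed.

Lemma hmin_comm p q : hmin p q =1 hmin q p.
Proof. by move=> k; rewrite /hmin minC. Qed.

Lemma hmax_comm p q : hmax p q =1 hmax q p.
Proof. by move=> k; rewrite /hmax maxC. Qed.

(* The witness minimises [2 r k - k] among the positions where [p - r] is
   largest: there [r] does not increase just before and does just after. *)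
Lemma bump_between r p : height r -> height p ->
  (forall k, (k <= n)%N -> r k <= p k) -> (exists2 k, (k <= n)%N & r k != p k) ->
  exists a, [/\ (a <= n)%N, height (bump_at a r) & r a < p a].
Proof.
move=> hr hp rp [k0 k0n rpk0].
pose m0 := [arg max_(k > (ord0 : 'I_n.+1)) (p k - r k)%R]%O.
have hm0 (k : nat) : (k <= n)%N -> p k - r k <= p m0 - r m0.
  rewrite /m0; case: arg_maxP => // i _ hi; rewrite -ltnS => kn.
  exact: (hi (Ordinal kn)).
pose a := [arg min_(k < m0 | p k - r k == p m0 - r m0) (2 * r k - k%:Z)%R]%O.
have [/eqP ha hamin] : p a - r a == p m0 - r m0 /\
    (forall k : nat, (k <= n)%N -> p k - r k = p m0 - r m0 ->
       2 * r a - a%:Z <= 2 * r k - k%:Z).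
  rewrite /a; case: arg_minP => // i hi hmin; split=> // k; rewrite -ltnS => kn hk.
  by apply: (hmin (Ordinal kn)); rewrite /= hk.
have an : (a <= n)%N by rewrite -ltnS.
exists a; split=> //; last by move: (hm0 k0 k0n) (rp k0 k0n); lia.
move=> k kn; have := hr k kn; have := hp k kn; rewrite /bump_at.
move: (nat_of_ord a) ha hamin an => b ha hamin an.
move: kn; have [->|kb] := eqVneq k b => kn.
  have -> : (b.+1 == b) = false by lia.
  have bn : (b.+1 <= n)%N by lia.
  have := hm0 b.+1 bn; have := hamin b.+1 bn.
  case: (eqVneq (p b.+1 - r b.+1) (p m0 - r m0)) => [e /(_ e)|]; lia.
have [e|_] := eqVneq k.+1 b; last by lia.
have := hm0 k (ltnW kn); have := hamin k (ltnW kn); rewrite -e in ha an *.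
case: (eqVneq (p k - r k) (p m0 - r m0)) => [e' /(_ e')|]; lia.
Qed.

End Heights.

(** * L-concavity of DCTP functions *)

Section Concavity.
Variables (R : realFieldType) (n : nat).
Implicit Types (f g : {set 'I_n} -> R) (X : {set 'I_n}) (p q r : nat -> int).
Implicit Types (d : ({set 'I_n} -> R) -> R).

Definition constraint : predArgType :=
  ({set 'I_n} * 'I_n * 'I_n + {set 'I_n} * 'I_n * 'I_n * 'I_n * bool)%type.

(* [inl] indexes the local submodular inequalities and [inr] the inequalities
   "the middle term of the Pluecker relation is at least another term"; the
   slack of an index that does not satisfy the side conditions is 0. *)
Definition slack f (c : constraint) : R :=
  match c with
  | inl (X, i, j) =>
      if [&& i != j, i \notin X & j \notin X] then
        f (X :|: [set i])%SET + f (X :|: [set j])%SET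
        - (f (X :|: [set i; j])%SET + f X)
      else 0
  | inr (X, i, j, k, b) =>
      if [&& (i < j)%N, (j < k)%N & X \subset (~: [set i; j; k])%SET] then
        f (X :|: [set i; k])%SET + f (X :|: [set j])%SET
        - (if b then f (X :|: [set i; j])%SET + f (X :|: [set k])%SET
           else f (X :|: [set j; k])%SET + f (X :|: [set i])%SET)
      else 0
  end.

Definition local_dctp f :=
  (forall c, 0 <= slack f c) /\
  forall X i j k, slack f (inr (X, i, j, k, true)) = 0 \/
                  slack f (inr (X, i, j, k, false)) = 0.

Definition Lconcave f := forall p q, height n p -> height n q ->
  f (steps n p) + f (steps n q) <= f (steps n (hmax p q)) + f (steps n (hmin p q)).

(* Closed under addition, so that a global inequality can be decomposed into
   constraints, together with its equality case, without listing them. *)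
Definition slacklike d :=
  (forall f, local_dctp f -> 0 <= d f) /\
  (forall f g, local_dctp f -> local_dctp g ->
     (forall c, slack f c = 0 -> slack g c = 0) -> d f = 0 -> d g = 0).

Lemma slacklike0 d : (forall f, d f = 0) -> slacklike d.
Proof. by move=> d0; split=> [f _|f g _ _ _ _]; rewrite d0. Qed.

Lemma slacklike_slack c : slacklike (slack^~ c).
Proof. by split=> [f []|f g _ _]; [exact|exact]. Qed.

Lemma slacklikeD d1 d2 d :
  (forall f, d f = d1 f + d2 f) -> slacklike d1 -> slacklike d2 -> slacklike d.
Proof.
move=> e [p1 t1] [p2 t2]; split=> [f hf|f g hf hg fg].
  by rewrite e addr_ge0 ?p1 ?p2.
rewrite !e => /eqP; rewrite paddr_eq0 ?p1 ?p2 // => /andP[/eqP e1 /eqP e2].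
by rewrite (t1 f g) // (t2 f g) // addr0.
Qed.

Lemma eq_slacklike d1 d2 : (forall f, d1 f = d2 f) -> slacklike d1 -> slacklike d2.
Proof.
by move=> e [p t]; split=> [f hf|f g hf hg fg]; rewrite -!e; [exact: p|exact: t].
Qed.

(** The second difference of [f] at [X] without its constant term. Subtracting
    [f(Xi) + f(Xj) + f(Xk)] from a three-term relation turns it into: the value at the pair [ik] is
    the maximum of those at [ij] and [jk]. *)
Definition curv f X (i j : 'I_n) : R :=
  f (X :|: [set i; j])%SET - f (X :|: [set i])%SET - f (X :|: [set j])%SET.

Lemma slack_curv f X (i j k : 'I_n) b :
  (i < j)%N -> (j < k)%N -> X \subset (~: [set i; j; k])%SET ->
  slack f (inr (X, i, j, k, b)) =
  curv f X i k - (if b then curv f X i j else curv f X j k).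
Proof. by move=> ij jk hX; rewrite /slack ij jk hX /curv; case: b => /=; ring. Qed.

Lemma curv_max f X (i j k : 'I_n) : local_dctp f ->
  (i < j)%N -> (j < k)%N -> X \subset (~: [set i; j; k])%SET ->
  curv f X i k = Num.max (curv f X i j) (curv f X j k).
Proof.
move=> [p t] ij jk hX; move: (p (inr (X, i, j, k, true))) (p (inr (X, i, j, k, false))).
case: (t X i j k); rewrite !slack_curv //= => /eqP; rewrite subr_eq0 => /eqP <-;
  rewrite !subr_ge0 => h1 h2.
- by rewrite max_l.
- by rewrite max_r.
Qed.

Lemma four_term_max (a b c : R) :
  let d := Num.max a b + Num.max b c - (Num.max a (Num.max b c) + b) in
  0 <= d /\ (d == 0) = (a <= b) || (c <= b).
Proof.
have [ab|ab] := leP a b; have [bc|bc] := leP b c => /=.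
- by rewrite (max_r (le_trans ab bc)) [c + b]addrC subrr; split; rewrite ?lexx ?eqxx.
- by rewrite (max_r ab) subrr; split; rewrite ?lexx ?eqxx.
- have [ac|ac] := leP a c.
    split; first by lra.
    have -> : a + c - (c + b) = a - b by ring.
    by rewrite subr_eq0 (gt_eqF ab); apply/esym/negbTE; rewrite -ltNge (lt_le_trans ab).
  split; first by lra.
  have -> : a + c - (a + b) = c - b by ring.
  by rewrite subr_eq0 eq_le bc andbT.
- by rewrite (max_l (ltW ab)) subrr (ltW bc); split; rewrite ?lexx ?eqxx.
Qed.

(** Put [a], [b], [c] for the curvatures of [ij], [jk], [kl]; those of [ik], [jl], [il] are then
    maxima of these, and the excess is [max(0, min(a, c) - b)]. It vanishes exactly when [a <= b] or
    [c <= b], that is, when one of two three-term slacks does. *)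
Lemma slacklike_four X (i j k l : 'I_n) : (i < j)%N -> (j < k)%N -> (k < l)%N ->
  X \subset (~: [set i; j; k; l])%SET ->
  slacklike (fun f => f (X :|: [set i; k])%SET + f (X :|: [set j; l])%SET
              - (f (X :|: [set i; l])%SET + f (X :|: [set j; k])%SET)).
Proof.
move=> ij jk kl hX.
have sub (A : {set 'I_n}) : A \subset [set i; j; k; l]%SET -> X \subset (~: A)%SET.
  by move=> h; apply: fintype.subset_trans hX _; rewrite finset.setCS.
have hijk : X \subset (~: [set i; j; k])%SET.
  by apply: sub; apply/fintype.subsetP => x; rewrite !inE => ->.
have hijl : X \subset (~: [set i; j; l])%SET.
  by apply: sub; apply/fintype.subsetP => x; rewrite !inE => /orP[->|->]; rewrite ?orbT.
have hjkl : X \subset (~: [set j; k; l])%SET.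
  by apply: sub; apply/fintype.subsetP => x; rewrite !inE => /orP[/orP[]|] ->; rewrite ?orbT.
have jl := ltn_trans jk kl.
have key f : local_dctp f ->
    let d := f (X :|: [set i; k])%SET + f (X :|: [set j; l])%SET
             - (f (X :|: [set i; l])%SET + f (X :|: [set j; k])%SET) in
    0 <= d /\ (d == 0) = (slack f (inr (X, i, j, k, false)) == 0)
                         || (slack f (inr (X, j, k, l, true)) == 0).
  move=> hf d; have -> : d = curv f X i k + curv f X j l - (curv f X i l + curv f X j k).
    by rewrite /d /curv; ring.
  rewrite !slack_curv //= (curv_max hf ij jl hijl) (curv_max hf ij jk hijk).
  rewrite (curv_max hf jk kl hjkl).
  have maxrE (a b : R) : (Num.max a b - b == 0) = (a <= b) by rewrite subr_eq0 eq_maxr.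
  have maxlE (a b : R) : (Num.max a b - a == 0) = (b <= a) by rewrite subr_eq0 eq_maxl.
  by rewrite maxrE maxlE; exact: four_term_max.
split=> [f hf|f g hf hg fg]; first by have [] := key f hf.
move=> /eqP; rewrite (key f hf).2 => h; apply/eqP; rewrite (key g hg).2.
by case/orP: h => /eqP /fg ->; rewrite eqxx ?orbT.
Qed.

Definition defect p q f :=
  f (steps n (hmax p q)) + f (steps n (hmin p q)) - (f (steps n p) + f (steps n q)).

Lemma height_bump2 a b r : height n r -> height n (bump_at a r) -> height n (bump_at b r) ->
  a != b -> height n (bump_at a (bump_at b r)).
Proof.
move=> hr ha hb ab k kn; move: (hr k kn) (ha k kn) (hb k kn); rewrite /bump_at.
case: (eqVneq k a); case: (eqVneq k b); case: (eqVneq k.+1 a); case: (eqVneq k.+1 b) => /=; lia.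
Qed.

End Concavity.

Section Diamonds.
Variables (R : realFieldType) (n : nat).
Implicit Types (f g : {set 'I_n} -> R) (X : {set 'I_n}) (p q r : nat -> int).
(** Each bump involves the elements just before and just after its position, one of which is missing
    at [0] and at [n]. Two boundary positions leave two elements and local submodularity, one leaves
    three elements and a three-term relation, none leaves four elements and a four-term relation. *)
Lemma slacklike_diamond a b r : (a < b <= n)%N ->
  height n r -> height n (bump_at a r) -> height n (bump_at b r) ->
  slacklike (fun f => f (steps n (bump_at a (bump_at b r))) + f (steps n r)
                - (f (steps n (bump_at a r)) + f (steps n (bump_at b r)))).
Proof.
move=> /andP[ab bn] hr ha hb.
(* A bump at [a] needs the element [a] to be a step and a bump at [a + 1] needs it not to be one;
   hence the elements involved are distinct. *)
have nadj : b != a.+1.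
  apply/eqP => e; subst b; move: (hr a bn) (ha a bn) (hb a bn).
  by rewrite /bump_at; case: (eqVneq a.+1 a); case: (eqVneq a a.+1); rewrite ?eqxx /=; lia.
have ab' : a != b by rewrite neq_ltn ab.
have hab := height_bump2 hr ha hb ab'.
have mem c (hc : height n (bump_at c r)) (x : 'I_n) :
    (val x = c -> x \in steps n r) /\ (x.+1 = c -> x \notin steps n r).
  have := hc x (ltn_ord x); have := hr x (ltn_ord x); rewrite in_steps /bump_at /=.
  by case: (eqVneq (val x) c); case: (eqVneq x.+1 c) => /= e1 e2 ? ?; split=> ?; lia.
have memab (x : 'I_n) := steps_bump x hb hab.
have mema (x : 'I_n) := steps_bump x hr ha.
have memb (x : 'I_n) := steps_bump x hr hb.
pose X := [set x in steps n r | [&& val x != a, x.+1 != a, val x != b & x.+1 != b]]%SET.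
have setE (A B : {set 'I_n}) : (forall x : 'I_n,
    (val x = a -> x \in steps n r) -> (x.+1 = a -> x \notin steps n r) ->
    (val x = b -> x \in steps n r) -> (x.+1 = b -> x \notin steps n r) ->
    (x \in A) = (x \in B)) -> A = B.
  by move=> h; apply/setP => x; have [? ?] := mem a ha x; have [? ?] := mem b hb x; apply: h.
case: a ab nadj ab' ha hab @X mema memab {mem} setE => [|a] ab nadj ab' ha hab X mema memab setE.
  have b1 : (b.-1 < n)%N by lia.
  have n0 : (0 < n)%N by lia.
  pose i : 'I_n := Ordinal n0.
  pose j : 'I_n := Ordinal b1.
  move: bn; rewrite leq_eqVlt => /orP[/eqP e|bn].
    have Xij : [&& i != j, i \notin X & j \notin X].
      by rewrite !inE -?val_eqE /=; lia.
    apply: (eq_slacklike _ (slacklike_slack R (inl (X, i, j)))) => f; rewrite /= Xij.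
    have -> : steps n r = (X :|: [set i])%SET.
      by apply: setE => x; have := ltn_ord x; rewrite !inE -?val_eqE /=; lia.
    have -> : steps n (bump_at 0 r) = X.
      by apply: setE => x; have := ltn_ord x; rewrite mema !inE -?val_eqE /=; lia.
    have -> : steps n (bump_at b r) = (X :|: [set i; j])%SET.
      by apply: setE => x; have := ltn_ord x; rewrite memb !inE -?val_eqE /=; lia.
    have -> : steps n (bump_at 0 (bump_at b r)) = (X :|: [set j])%SET.
      by apply: setE => x; have := ltn_ord x; rewrite memab memb !inE -?val_eqE /=; lia.
    ring.
  pose k : 'I_n := Ordinal bn.
  have Xijk : [&& (i < j)%N, (j < k)%N & X \subset (~: [set i; j; k])%SET].
    rewrite /=; apply/and3P; split; [lia|lia|].
    by apply/fintype.subsetP => x; rewrite !inE -?val_eqE /=; lia.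
  apply: (eq_slacklike _ (slacklike_slack R (inr (X, i, j, k, true)))) => f; rewrite /slack Xijk.
  have -> : steps n r = (X :|: [set i; k])%SET.
    by apply: setE => x; rewrite !inE -?val_eqE /=; lia.
  have -> : steps n (bump_at 0 r) = (X :|: [set k])%SET.
    by apply: setE => x; rewrite mema !inE -?val_eqE /=; lia.
  have -> : steps n (bump_at b r) = (X :|: [set i; j])%SET.
    by apply: setE => x; rewrite memb !inE -?val_eqE /=; lia.
  have -> : steps n (bump_at 0 (bump_at b r)) = (X :|: [set j])%SET.
    by apply: setE => x; rewrite memab memb !inE -?val_eqE /=; lia.
  ring.
have an : (a < n)%N by lia.
have a1n : (a.+1 < n)%N by lia.
have b1 : (b.-1 < n)%N by lia.
pose i : 'I_n := Ordinal an.
pose j : 'I_n := Ordinal a1n.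
pose k : 'I_n := Ordinal b1.
move: bn; rewrite leq_eqVlt => /orP[/eqP e|bn].
  have Xijk : [&& (i < j)%N, (j < k)%N & X \subset (~: [set i; j; k])%SET].
    rewrite /=; apply/and3P; split; [lia|lia|].
    by apply/fintype.subsetP => x; rewrite !inE -?val_eqE /=; lia.
  apply: (eq_slacklike _ (slacklike_slack R (inr (X, i, j, k, false)))) => f; rewrite /slack Xijk.
  have -> : steps n r = (X :|: [set j])%SET.
    by apply: setE => x; have := ltn_ord x; rewrite !inE -?val_eqE /=; lia.
  have -> : steps n (bump_at a.+1 r) = (X :|: [set i])%SET.
    by apply: setE => x; have := ltn_ord x; rewrite mema !inE -?val_eqE /=; lia.
  have -> : steps n (bump_at b r) = (X :|: [set j; k])%SET.
    by apply: setE => x; have := ltn_ord x; rewrite memb !inE -?val_eqE /=; lia.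
  have -> : steps n (bump_at a.+1 (bump_at b r)) = (X :|: [set i; k])%SET.
    by apply: setE => x; have := ltn_ord x; rewrite memab memb !inE -?val_eqE /=; lia.
  ring.
pose l : 'I_n := Ordinal bn.
have ij : (i < j)%N by rewrite /=.
have jk : (j < k)%N by rewrite /=; lia.
have kl : (k < l)%N by rewrite /=; lia.
have XC : X \subset (~: [set i; j; k; l])%SET.
  by apply/fintype.subsetP => x; rewrite !inE -?val_eqE /=; lia.
apply: (eq_slacklike _ (slacklike_four R ij jk kl XC)) => f.
have -> : steps n r = (X :|: [set j; l])%SET.
  by apply: setE => x; rewrite !inE -?val_eqE /=; lia.
have -> : steps n (bump_at a.+1 r) = (X :|: [set i; l])%SET.
  by apply: setE => x; rewrite mema !inE -?val_eqE /=; lia.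
have -> : steps n (bump_at b r) = (X :|: [set j; k])%SET.
  by apply: setE => x; rewrite memb !inE -?val_eqE /=; lia.
have -> : steps n (bump_at a.+1 (bump_at b r)) = (X :|: [set i; k])%SET.
  by apply: setE => x; rewrite memab memb !inE -?val_eqE /=; lia.
ring.
Qed.

(* If [p] and [q] are incomparable, [defect p q] splits as a sum of two defects
   of closer pairs unless both cover [hmin p q]. *)
Lemma slacklike_defect p q : height n p -> height n q -> slacklike (@defect R n p q).
Proof.
pose dist p q : int := \sum_(k < n.+1) `|p k - q k|.
have [m hm] : exists m : nat, dist p q < m%:Z.
  by exists (`|dist p q|.+1)%N; lia.
have ltdist p' q' p1 q1 : (forall k, (k <= n)%N -> `|p' k - q' k| <= `|p1 k - q1 k|) ->
    (exists2 k, (k <= n)%N & `|p' k - q' k| < `|p1 k - q1 k|) -> dist p' q' < dist p1 q1.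
  move=> le [k]; rewrite -ltnS => kn lt.
  rewrite /dist (bigD1 (Ordinal kn)) //= [ltRHS](bigD1 (Ordinal kn)) //=.
  by apply: ltr_leD => //; apply: ler_sum => i _; apply: le; rewrite -ltnS.
have defectC p' q' : slacklike (@defect R n q' p') -> slacklike (@defect R n p' q').
  apply: eq_slacklike => f; rewrite /defect [f _ + f (steps n q')]addrC.
  congr (f _ + f _ - _); apply: eq_steps => k _; [exact: hmax_comm|exact: hmin_comm].
elim: m p q hm => [|m IH] p q.
  have d0 : 0 <= dist p q by apply: sumr_ge0 => i _; exact: normr_ge0.
  by move=> ?; lia.
move=> hm hp hq.
have step p' q' a c : dist p' q' <= m%:Z -> height n p' -> height n q' -> (a <= n)%N ->
    height n (bump_at a (hmin p' q')) -> hmin p' q' a < p' a ->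
    (c <= n)%N -> p' c != bump_at a (hmin p' q') c -> slacklike (@defect R n p' q').
  move=> {p q hm hp hq} hm hp hq an; set r1 := bump_at a _ => hr1 rpa cn hc.
  have r1E k : r1 k = Num.min (p' k) (q' k) + (k == a)%:Z by [].
  move: rpa; rewrite /hmin => rpa; clearbody r1.
  have r1p k : r1 k <= p' k by rewrite r1E; case: (eqVneq k a) => [->|_] /=; lia.
  (* The rectangle spanned by [p'] and [q'] is cut along [r1] and [s]: the defects of [(r1, q')] and
     [(p', s)] add up to that of [(p', q')]. The first pair is strictly closer at [c], where [r1]
     differs from [p'], and the second at [a]. *)
  pose s := hmax r1 q'; have hs : height n s := height_max hr1 hq.
  apply: (@slacklikeD _ _ (@defect R n r1 q') (@defect R n p' s)).
  - move=> f; rewrite /defect.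
    have -> : steps n (hmin r1 q') = steps n (hmin p' q').
      apply: eq_steps => k _; rewrite /hmin r1E.
      by case: (eqVneq k a) => [->|_] /=; lia.
    have -> : steps n (hmax p' s) = steps n (hmax p' q').
      by apply: eq_steps => k _; rewrite /hmax /s /hmax; move: (r1p k); lia.
    have -> : steps n (hmin p' s) = steps n r1.
      apply: eq_steps => k _; rewrite /hmin /s /hmax r1E.
      by case: (eqVneq k a) => [->|_] /=; lia.
    by rewrite -/s; ring.
  - apply: IH => //; apply: lt_le_trans hm; apply: ltdist => [k kn|].
      by rewrite r1E; case: (eqVneq k a) => [->|_] /=; lia.
    exists c => //; move: hc; rewrite r1E.
    by case: (eqVneq c a) => [->|_] /=; lia.
  - apply: IH => //; apply: lt_le_trans hm; apply: ltdist => [k kn|].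
      by rewrite /s /hmax r1E; case: (eqVneq k a) => [->|_] /=; lia.
    by exists a => //; rewrite /s /hmax r1E eqxx /=; lia.
have {}hm : dist p q <= m%:Z by move: hm; lia.
pose r := hmin p q; have hr : height n r := height_min hp hq.
have [pq|] := boolP [forall k : 'I_n.+1, p k <= q k].
  have {}pq (k : nat) : (k <= n)%N -> p k <= q k.
    by rewrite -ltnS => kn; exact: (forallP pq (Ordinal kn)).
  apply: slacklike0 => f; rewrite /defect.
  rewrite (@eq_steps n (hmax p q) q); last by move=> k /pq; rewrite /hmax; lia.
  rewrite (@eq_steps n (hmin p q) p); last by move=> k /pq; rewrite /hmin; lia.
  ring.
rewrite negb_forall => /existsP[kp hkp].
have [qp|] := boolP [forall k : 'I_n.+1, q k <= p k].
  have {}qp (k : nat) : (k <= n)%N -> q k <= p k.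
    by rewrite -ltnS => kn; exact: (forallP qp (Ordinal kn)).
  apply: slacklike0 => f; rewrite /defect.
  rewrite (@eq_steps n (hmax p q) p); last by move=> k /qp; rewrite /hmax; lia.
  rewrite (@eq_steps n (hmin p q) q); last by move=> k /qp; rewrite /hmin; lia.
  ring.
rewrite negb_forall => /existsP[kq hkq].
have [||a [an hra rpa]] := @bump_between n r p hr hp.
- by move=> k _; rewrite /r /hmin; lia.
- by exists kp; [rewrite -ltnS|rewrite /r /hmin; lia].
have [||b [bn hrb rqb]] := @bump_between n r q hr hq.
- by move=> k _; rewrite /r /hmin; lia.
- by exists kq; [rewrite -ltnS|rewrite /r /hmin; lia].
have [pa|] := boolP [forall k : 'I_n.+1, p k == bump_at a r k]; last first.
  by rewrite negb_forall => /existsP[c hc]; apply: (step p q a c) => //; rewrite -ltnS.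
have [qb|] := boolP [forall k : 'I_n.+1, q k == bump_at b r k]; last first.
  rewrite negb_forall => /existsP[c hc]; apply: defectC.
  have rE : bump_at b (hmin q p) =1 bump_at b r.
    by move=> k; rewrite /bump_at /r hmin_comm.
  have cn : (c <= n)%N by rewrite -ltnS.
  apply: (step q p b c) => //.
  - by apply: le_trans hm; apply: ler_sum => i _; rewrite distrC.
  - by move=> k kn; rewrite !rE; exact: hrb.
  - by rewrite hmin_comm.
  - by rewrite rE.
have {}pa (k : nat) : (k <= n)%N -> p k = bump_at a r k.
  by rewrite -ltnS => kn; exact/eqP/(forallP pa (Ordinal kn)).
have {}qb (k : nat) : (k <= n)%N -> q k = bump_at b r k.
  by rewrite -ltnS => kn; exact/eqP/(forallP qb (Ordinal kn)).
have ab : a != b.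
  by apply/eqP => e; subst b; move: rpa rqb; rewrite /r /hmin; lia.
have eqp : steps n p = steps n (bump_at a r) by exact: eq_steps.
have eqq : steps n q = steps n (bump_at b r) by exact: eq_steps.
have eqm : steps n (hmax p q) = steps n (bump_at a (bump_at b r)).
  apply: eq_steps => k kn; rewrite /hmax (pa k kn) (qb k kn) /bump_at.
  by case: (eqVneq k a) => [->|]; case: eqVneq => //= e; move: ab; rewrite ?e ?eqxx //; lia.
case: (ltngtP a b) => [lt_ab|lt_ba|e]; last by rewrite e eqxx in ab.
  apply: eq_slacklike (slacklike_diamond _ hr hra hrb) => [f|]; last by rewrite lt_ab.
  by rewrite /defect eqm eqp eqq.
apply: eq_slacklike (slacklike_diamond _ hr hrb hra) => [f|]; last by rewrite lt_ba.
rewrite /defect eqm eqp eqq [f _ + f (steps n (bump_at b r))]addrC; congr (f _ + _ - _).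
by apply: eq_steps => k _; rewrite /bump_at addrAC.
Qed.

Lemma local_dctp_Lconcave (f : {set 'I_n} -> R) : local_dctp f -> Lconcave f.
Proof.
by move=> hf p q hp hq; have [/(_ f hf)] := slacklike_defect hp hq; rewrite subr_ge0.
Qed.

End Diamonds.

(** * Cells *)

Lemma small_perturbation (R : realFieldType) (I : finType) (P : pred I) (a b : I -> R) :
  (forall i, P i -> a i < 0) ->
  exists2 e, 0 < e & forall i, P i -> a i + e * b i < 0.
Proof.
move=> ha; pose S := \sum_(i | P i) `|b i| / - a i.
have t0 i : P i -> 0 <= `|b i| / - a i.
  by move=> /ha Pi; rewrite divr_ge0 // oppr_ge0 ltW.
have S0 : 0 <= S by apply: sumr_ge0.
have e0 : 0 < (1 + S)^-1 by rewrite invr_gt0 ltr_pwDl.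
exists (1 + S)^-1 => // i Pi; have ai := ha i Pi.
have le : `|b i| <= S * - a i.
  rewrite -ler_pdivrMr ?oppr_gt0 // /S (bigD1 i) //= lerDl.
  by apply: sumr_ge0 => j /andP[Pj _]; exact: t0.
rewrite -ltrBrDl sub0r mulrC ltr_pdivrMr ?ltr_pwDl //.
apply: le_lt_trans (ler_norm _) (le_lt_trans le _).
by rewrite mulrC mulrDr mulr1 ltrDr oppr_gt0.
Qed.

(** The indicator vectors of a chain of nonempty sets are linearly independent: the largest set has
    an element lying in no other member, and the value there is chosen last to correct the sum over
    that set. *)
Lemma nested_sums (R : realFieldType) (T : finType) (F : {set {set T}}) (v : {set T} -> R) :
  (forall A B : {set T}, A \in F -> B \in F -> (A \subset B) || (B \subset A)) ->
  (forall A, A \in F -> exists x, x \in A) ->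
  exists y : T -> R, forall A, A \in F -> \sum_(a in A) y a = v A.
Proof.
have [m hm] := ubnP #|F|; elim: m F hm => // m IH F hm nest ne.
have [A0 FA0|F0] := pickP (fun B => B \in F); last first.
  by exists (fun=> 0) => A; rewrite F0.
pose A := [arg max_(B > A0 in F) #|B|]%N.
have [FA Amax] : A \in F /\ forall B, B \in F -> (#|B| <= #|A|)%N.
  by rewrite /A; case: arg_maxnP => // B FB h; split=> // C; apply: h.
have sA B : B \in F -> B \subset A.
  move=> FB; case/orP: (nest _ _ FB FA) => // AB.
  have /eqP -> // : A == B by rewrite eqEcard AB Amax.
pose F' := (F :\ A)%SET.
have inF' B : B \in F' -> B \in F /\ B != A by rewrite !inE => /andP[].
have [||y hy] := IH F' _ _ (fun B hB => ne B (inF' B hB).1).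
- by move: hm; rewrite (cardsD1 A) FA.
- by move=> B C /inF'[? _] /inF'[? _]; exact: nest.
have [a aA aF'] : exists2 a, a \in A & forall B, B \in F' -> a \notin B.
  have [B0 FB0|F0] := pickP (fun B => B \in F'); last first.
    by have [a aA] := ne A FA; exists a => // B; rewrite F0.
  pose B := [arg max_(B > B0 in F') #|B|]%N.
  have [FB Bmax] : B \in F' /\ forall C, C \in F' -> (#|C| <= #|B|)%N.
    by rewrite /B; case: arg_maxnP => // C FC h; split=> // D; apply: h.
  have [FB1 BA] := inF' B FB.
  have /fintype.properP[_ [a aA aB]] : B \proper A by rewrite finset.properEneq BA sA.
  exists a => // C FC; apply: contra aB => aC; have [FC1 _] := inF' C FC.
  case/orP: (nest _ _ FC1 FB1) => [/fintype.subsetP -> //|BC].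
  by have /eqP -> : B == C by rewrite eqEcard BC Bmax.
exists (fun x => if x == a then v A - \sum_(x in A | x != a) y x else y x) => B FB.
have [->|BA] := eqVneq B A.
  rewrite (bigD1 a) //= eqxx -[RHS](subrK (\sum_(x in A | x != a) y x)); congr (_ + _).
  by apply: eq_bigr => x /andP[_ /negbTE ->].
have FB' : B \in F' by rewrite !inE BA.
rewrite -(hy B FB'); apply: eq_bigr => x xB; case: eqVneq => // e.
by move: (aF' B FB'); rewrite -e xB.
Qed.

Section Cells.
Variables (R : realFieldType) (n : nat).
Implicit Types (f g phi : {set 'I_n} -> R) (z : 'I_n -> R) (J K : {set 'I_n}).
Implicit Types (M S : {set {set 'I_n}}) (p q r : nat -> int).

Definition tilt f z J : R := f J + \sum_(i in J) z i.

Definition cell f z : {set {set 'I_n}} :=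
  [set J | [forall K, tilt f z K <= tilt f z J]]%SET.

Lemma cellP f z J : reflect (forall K, tilt f z K <= tilt f z J) (J \in cell f z).
Proof. by rewrite inE; exact: forallP. Qed.

Lemma cell_neq0 f z : exists J, J \in cell f z.
Proof.
pose J := [arg max_(J > finset.set0) tilt f z J]%O.
by exists J; apply/cellP => K; rewrite /J; case: arg_maxP => // J0 _; apply.
Qed.

Lemma cell_eq f z J K : J \in cell f z -> K \in cell f z -> tilt f z J = tilt f z K.
Proof. by move=> /cellP hJ /cellP hK; apply/eqP; rewrite eq_le hJ hK. Qed.

Lemma cell_lt f z J K : J \in cell f z -> K \notin cell f z -> tilt f z K < tilt f z J.
Proof.
move=> hJ hK; rewrite lt_neqAle (cellP _ _ _ hJ) andbT; apply: contra hK => /eqP e.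
by apply/cellP => L; rewrite e; exact: (cellP _ _ _ hJ).
Qed.

Lemma cell_of_eq f z J K : J \in cell f z -> tilt f z K = tilt f z J -> K \in cell f z.
Proof. by move=> /cellP hJ e; apply/cellP => L; rewrite e. Qed.

Lemma tiltD f z1 z2 J : tilt f (fun i => z1 i + z2 i) J = tilt f z1 J + \sum_(i in J) z2 i.
Proof. by rewrite /tilt big_split /= addrA. Qed.

(** A small tilt refines the maximisation lexicographically: [e] is so small that sets outside the
    cell stay below a member [J1] that is best for [d], and inside the cell only [d] decides. *)
Lemma cell_perturb f z (d : 'I_n -> R) : exists2 e, 0 < e &
  cell f (fun i => z i + e * d i) =
  [set J in cell f z | [forall K in cell f z, \sum_(i in K) d i <= \sum_(i in J) d i]]%SET.
Proof.
have [J0 hJ0] := cell_neq0 f z.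
pose D J := \sum_(i in J) d i.
pose J1 := [arg max_(J > J0 in cell f z) D J]%O.
have [hJ1 max1] : J1 \in cell f z /\ forall K, K \in cell f z -> D K <= D J1.
  by rewrite /J1; case: arg_maxP => // J hJ h; split.
have [J|e e0 he] := @small_perturbation R _ (fun J => J \notin cell f z)
   (fun J => tilt f z J - tilt f z J1) (fun J => D J - D J1).
  by move=> hJ; rewrite subr_lt0 cell_lt.
have tE J : tilt f (fun i => z i + e * d i) J = tilt f z J + e * D J.
  by rewrite tiltD -mulr_sumr.
exists e => //.
have h1 : J1 \in cell f (fun i => z i + e * d i).
  apply/cellP => K; rewrite !tE; have [hK|hK] := boolP (K \in cell f z).
    by rewrite (cell_eq hK hJ1) lerD2l ler_pM2l // max1.
  by have := he K hK; lra.
apply/setP => J; rewrite inE; apply/idP/andP => [hJ|[hJ /forallP mx]].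
  have e1 := cell_eq hJ h1; rewrite !tE in e1.
  have hJz : J \in cell f z.
    by apply/negPn/negP => hJz; have := he J hJz; lra.
  split=> //; apply/forallP => K; apply/implyP => hK.
  move: e1; rewrite (cell_eq hJz hJ1) => /addrI /(mulfI (lt0r_neq0 e0)).
  by rewrite /D => ->; exact: max1.
apply: (cell_of_eq h1); rewrite !tE (cell_eq hJ hJ1); congr (_ + _ * _).
by apply/eqP; rewrite eq_le max1 //=; exact: (implyP (mx J1)).
Qed.

Definition Lclosed M := forall p q, height n p -> height n q ->
  steps n p \in M -> steps n q \in M ->
  steps n (hmax p q) \in M /\ steps n (hmin p q) \in M.

Lemma tilt_maxmin f z p q : height n p -> height n q ->
  defect p q (tilt f z) = defect p q f.
Proof.
move=> hp hq; rewrite /defect /tilt; have := sum_maxmin z hp hq.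
by lra.
Qed.

(** The maximum and the minimum have tilts at most the common value on the cell, while L-concavity
    bounds their sum below by twice that value; all these inequalities are therefore equalities. *)
Lemma cell_defect f z p q : Lconcave f -> height n p -> height n q ->
  steps n p \in cell f z -> steps n q \in cell f z ->
  [/\ steps n (hmax p q) \in cell f z, steps n (hmin p q) \in cell f z &
      defect p q f = 0].
Proof.
move=> hf hp hq cp cq; have eqpq := cell_eq cp cq.
have := hf p q hp hq; have := tilt_maxmin f z hp hq.
have := cellP _ _ _ cp (steps n (hmax p q)); have := cellP _ _ _ cp (steps n (hmin p q)).
rewrite {1 2}/defect => h1 h2 h3 h4.
have e1 : tilt f z (steps n (hmax p q)) = tilt f z (steps n p) by lra.
have e2 : tilt f z (steps n (hmin p q)) = tilt f z (steps n p) by lra.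
split; [exact: cell_of_eq e1|exact: cell_of_eq e2|].
by rewrite /defect; lra.
Qed.

Lemma Lclosed_cell f z : Lconcave f -> Lclosed (cell f z).
Proof. by move=> hf p q hp hq cp cq; have [] := cell_defect hf hp hq cp cq. Qed.

(* For each [b], the meet over [a] of translates touching [ht K] at [b] lies
   below [ht K] and touches it at [b]; the join of these meets is [ht K]. *)
Lemma Lclosed_mem M K : Lclosed M ->
  (forall a b, (a <= n)%N -> (b <= n)%N -> exists p,
     [/\ height n p, steps n p \in M & ht K b - ht K a <= p b - p a]) -> K \in M.
Proof.
move=> LM hK; pose k := ht K.
have tr p b : height n p -> steps n p \in M ->
    exists q, [/\ height n q, steps n q \in M & forall a, q a = p a - p b + k b].
  move=> hp Mp; exists (shift (k b - p b) p); split; rewrite ?steps_shift //.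
    exact: height_shift.
  by move=> a; rewrite /shift; lia.
have meet b : (b <= n)%N -> forall m, (m <= n.+1)%N -> exists r,
    [/\ height n r, steps n r \in M, r b = k b & forall a, (a < m)%N -> r a <= k a].
  move=> bn; elim=> [|m IH] mn.
    have [p [hp Mp _]] := hK b b bn bn; have [q [hq Mq qE]] := tr p b hp Mp.
    by exists q; split=> //; rewrite qE; lia.
  have [r [hr Mr rb ra]] := IH (ltnW mn).
  have [p [hp Mp pm]] := hK m b mn bn; have [q [hq Mq qE]] := tr p b hp Mp.
  exists (hmin r q); split; first exact: height_min.
  - by have [] := LM r q hr hq Mr Mq.
  - by rewrite /hmin rb qE; lia.
  move=> a; rewrite ltnS leq_eqVlt => /orP[/eqP ->|/ra]; rewrite /hmin ?qE; last by lia.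
  by move: pm; rewrite /k; lia.
have join : forall m, (m <= n.+1)%N -> exists r,
    [/\ height n r, steps n r \in M, forall a, (a <= n)%N -> r a <= k a &
        forall a, (a < m)%N -> r a = k a].
  elim=> [|m IH] mn.
    have [r [hr Mr _ ra]] := meet 0%N (leq0n _) n.+1 (leqnn _).
    by exists r; split=> // a an; exact: ra.
  have [r [hr Mr rle ra]] := IH (ltnW mn).
  have [q [hq Mq qm qa]] := meet m mn n.+1 (leqnn _).
  exists (hmax r q); split; first exact: height_max.
  - by have [] := LM r q hr hq Mr Mq.
  - by move=> a an; rewrite /hmax; move: (rle a an) (qa a an); lia.
  move=> a; rewrite ltnS leq_eqVlt => /orP[/eqP ->|am].
    by rewrite /hmax; move: (rle m mn); rewrite qm; lia.
  have an : (a <= n)%N by lia.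
  by rewrite /hmax (ra a am); move: (qa a an); lia.
have [r [hr Mr _ ra]] := join n.+1 (leqnn _).
have <- // : steps n r = K.
by rewrite -[RHS]steps_ht; apply: eq_steps => a an; exact: ra.
Qed.

End Cells.

(** * Chains of height functions *)

Section Cliques.
Variables (R : realFieldType) (n : nat).
Implicit Types (f g phi : {set 'I_n} -> R) (z : 'I_n -> R) (J K : {set 'I_n}).
Implicit Types (M S : {set {set 'I_n}}) (p q r : nat -> int).

(* Equivalently: any two translates of [ht J] and [ht K] are comparable. *)
Definition interleaved J K :=
  [forall a : 'I_n.+1, forall b : 'I_n.+1, (ht J a - ht K a) - (ht J b - ht K b) <= 1].

Definition clique S := [forall J in S, forall K in S, interleaved J K].

Lemma interleavedP J K :
  reflect (forall a b, (a <= n)%N -> (b <= n)%N ->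
             (ht J a - ht K a) - (ht J b - ht K b) <= 1) (interleaved J K).
Proof.
apply: (iffP idP) => [h a b|h]; last first.
  by apply/forallP => a; apply/forallP => b; apply: h; rewrite -ltnS.
move=> an bn.
by have /forallP/(_ (Ordinal (bn : (b < n.+1)%N))) := forallP h (Ordinal (an : (a < n.+1)%N)).
Qed.

Lemma cliqueP S : reflect {in S &, forall J K, interleaved J K} (clique S).
Proof.
apply: (iffP idP) => [/forallP h J K hJ hK|h].
  by have /implyP/(_ hJ)/forallP/(_ K)/implyP/(_ hK) := h J.
by apply/forallP => J; apply/implyP => hJ; apply/forallP => K; apply/implyP => hK; exact: h.
Qed.

Lemma interleaved_heights p q a b : interleaved (steps n p) (steps n q) ->
  height n p -> height n q -> (a <= n)%N -> (b <= n)%N -> (p a - q a) - (p b - q b) <= 1.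
Proof.
move=> /interleavedP h hp hq an bn.
rewrite (height_eq hp an) (height_eq hp bn) (height_eq hq an) (height_eq hq bn).
by have := h a b an bn; lia.
Qed.

Lemma interleavedC J K : interleaved J K = interleaved K J.
Proof. by apply/interleavedP/interleavedP => h a b an bn; have := h b a bn an; lia. Qed.

(** The largest constant by which [ht J] can be raised while staying below [q] on the positions
    [0, ..., n]. *)
Definition touch J q : int :=
  q [arg min_(i < (ord0 : 'I_n.+1)) (q i - ht J i)]%O
  - ht J [arg min_(i < (ord0 : 'I_n.+1)) (q i - ht J i)]%O.

Lemma touchP J q : (forall a, (a <= n)%N -> ht J a + touch J q <= q a) /\
  exists2 k, (k <= n)%N & ht J k + touch J q = q k.
Proof.
rewrite /touch; case: arg_minP => // k _ h; split; last by exists k; [rewrite -ltnS|lia].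
by move=> a; rewrite -ltnS => an; have := h (Ordinal an) isT; rewrite /=; lia.
Qed.

Lemma sum_ht (y : 'I_n.+1 -> R) J : \sum_a y a * (ht J a)%:~R =
  \sum_(i in J) \sum_(a : 'I_n.+1 | (i < a)%N) y a.
Proof.
rewrite (exchange_big_dep predT) //=; apply: eq_bigr => a _.
rewrite /ht rmorph_sum /= mulr_sumr; apply: eq_bigr => i _.
by rewrite mulr1.
Qed.

(** Suitable translates of the members lie between [q0] and [q0 + 1], where they are [q0] plus
    indicators of nested sets of positions. Weights on positions with prescribed sums over these
    sets interpolate [f]; with total 0 they do not see translations, and exchanging sums turns them
    into weights [z] on elements. *)
Lemma clique_tilt f S : clique S ->
  exists z c, forall J, J \in S -> tilt f z J = c.
Proof.
move=> /cliqueP hS; have [J0 hJ0|S0] := pickP (fun J => J \in S); last first.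
  by exists (fun=> 0), 0 => J; rewrite S0.
pose q0 := ht J0.
(* translate of [ht J] lying between [q0] and [q0 + 1] *)
pose up J : int := - touch J0 (ht J).
have upP J : J \in S -> (forall a, (a <= n)%N -> 0 <= ht J a + up J - q0 a <= 1) /\
    exists2 k, (k <= n)%N & ht J k + up J = q0 k.
  move=> hJ; have [h1 [k kn h2]] := touchP J0 (ht J).
  split; last by exists k => //; rewrite /up /q0; lia.
  move=> a an; have := h1 a an; have /interleavedP/(_ a k an kn) := hS _ _ hJ hJ0.
  by rewrite /up /q0; lia.
pose A J := [set a : 'I_n.+1 | ht J a + up J != q0 a]%SET.
have upE J a : J \in S -> ht J (a : 'I_n.+1) + up J = q0 a + (a \in A J)%:Z.
  move=> hJ; have an : (a <= n)%N by rewrite -ltnS.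
  by have := (upP J hJ).1 a an; rewrite inE; case: eqVneq => /=; lia.
pose level (B : {set 'I_n.+1}) (k : nat) : int := q0 k + (inord k \in B)%:Z.
have levelA J : J \in S -> steps n (level (A J)) = J.
  move=> hJ; rewrite -[RHS]steps_ht -[RHS](steps_shift n (up J)); apply: eq_steps => k kn.
  by have := upE J (inord k) hJ; rewrite inordK // /level /shift => ->.
(* The full set of positions stands for [q0 + 1], another height of [J0]; the sum prescribed on it
   is 0, whence [y0]. The empty set arises only from [J0]. *)
pose F := ([set: 'I_n.+1] |: [set A J | J in S & A J != finset.set0])%SET.
have [||y hy] := @nested_sums R _ F (fun B => f (steps n (level B)) - f J0).
- have sub J K : J \in S -> K \in S -> (A J \subset A K) || (A K \subset A J).
    move=> hJ hK; case: (boolP (A J \subset A K)) => // /fintype.subsetPn[a aJ aK] /=.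
    apply/fintype.subsetP => b bK; apply/negPn/negP => bJ.
    have an : (a <= n)%N by rewrite -ltnS.
    have bn : (b <= n)%N by rewrite -ltnS.
    have /interleavedP/(_ a b an bn) := hS _ _ hJ hK.
    move: (upE J a hJ) (upE J b hJ) (upE K a hK) (upE K b hK).
    by rewrite aJ bK (negbTE aK) (negbTE bJ) /=; clear; lia.
  move=> B C; rewrite !inE => /orP[/eqP ->|/imsetP[J]].
    by rewrite finset.subsetT orbT.
  rewrite inE => /andP[hJ _ ->] /orP[/eqP ->|/imsetP[K]]; first by rewrite finset.subsetT.
  by rewrite inE => /andP[hK _ ->]; exact: sub.
- move=> B; rewrite !inE => /orP[/eqP ->|/imsetP[J]]; first by exists ord0; rewrite inE.
  by rewrite inE => /andP[_ /finset.set0Pn[x hx] ->]; exists x.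
have y0 : \sum_a y a = 0.
  have := hy [set: 'I_n.+1]%SET; rewrite !inE eqxx => /(_ isT).
  rewrite (eq_steps (q := shift 1 q0)); last by move=> k kn; rewrite /level inE.
  rewrite steps_shift steps_ht subrr => e; rewrite -[RHS]e.
  by apply: eq_bigl => a; rewrite inE.
have yA J : J \in S -> \sum_(a in A J) y a = f J - f J0.
  move=> hJ; have [e|ne] := eqVneq (A J) finset.set0; last first.
    rewrite -{2}(levelA J hJ); apply: hy; rewrite !inE; apply/orP; right.
    by apply/imsetP; exists J => //; rewrite inE hJ.
  rewrite -{2}(levelA J hJ) e big_set0.
  rewrite (eq_steps (q := q0)) ?steps_ht ?subrr //.
  by move=> k kn; rewrite /level inE addr0.
exists (fun i => - \sum_(a : 'I_n.+1 | (i < a)%N) y a).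
exists (f J0 - \sum_a y a * (q0 a)%:~R) => J hJ.
rewrite /tilt sumrN -sum_ht -[f J](subrK (f J0)) -(yA J hJ).
have -> : \sum_(a in A J) y a = \sum_a y a * ((ht J a)%:~R - (q0 a)%:~R).
  transitivity (\sum_a y a * ((ht J a)%:~R + (up J)%:~R - (q0 a)%:~R)).
    rewrite big_mkcond; apply: eq_bigr => a _.
    rewrite -intrD upE // intrD addrAC subrr add0r.
    by case: (_ \in _); rewrite ?mulr1 ?mulr0.
  have e0 : \sum_a y a * (up J)%:~R = 0 by rewrite -mulr_suml y0 mul0r.
  rewrite -[RHS]addr0 -[X in _ = _ + X]e0 -big_split /=.
  by apply: eq_bigr => a _; ring.
under eq_bigr do rewrite mulrBr.
by rewrite sumrB; ring.
Qed.

(** A form of the principle that local maxima are global. A height [q] below [u] is replaced by its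
    maximum with a translate of a member of [S]; the corresponding minimum lies in [S], where [phi]
    vanishes, so [phi] does not decrease. The climb ends at a height of a member of [S], at the
    latest [u]. *)
Lemma Lconcave_le0 M S phi : Lclosed M -> S \subset M -> clique S ->
  (exists J, J \in S) ->
  (forall J, J \in M -> (forall K, K \in S -> interleaved J K) -> J \in S) ->
  (forall p q, height n p -> height n q -> steps n p \in M -> steps n q \in M ->
     0 <= defect p q phi) ->
  (forall J, J \in S -> phi J = 0) -> forall J, J \in M -> phi J <= 0.
Proof.
move=> LM SM /cliqueP cS [J0 hJ0] maxS phi_conc phi0 J hJ.
have SMi K : K \in S -> K \in M by apply/fintype.subsetP.
pose u := shift (- touch J (ht J0)) (ht J0).
have hu : height n u by apply/height_shift/ht_height.
have uS : steps n u \in S by rewrite steps_shift steps_ht.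
have Ju a : (a <= n)%N -> ht J a <= u a.
  by move=> an; have [/(_ a an)] := touchP J (ht J0); rewrite /u /shift; lia.
suff gen q : height n q -> steps n q \in M -> (forall a, (a <= n)%N -> q a <= u a) ->
    phi (steps n q) <= 0.
  by rewrite -[J]steps_ht; apply: gen => //; [exact: ht_height|rewrite steps_ht].
clearbody u; move=> {J hJ Ju}.
pose dist q : int := \sum_(k < n.+1) (u k - q k).
have [m hm] : exists m : nat, dist q < m%:Z by exists (`|dist q|.+1)%N; lia.
elim: m q hm => [|m IH] q hm hq Mq qu.
  have d0 : 0 <= dist q by apply: sumr_ge0 => k _; rewrite subr_ge0 qu // -ltnS.
  by move: d0 hm; clear; lia.
have [Sq|Sq] := boolP (steps n q \in S); first by rewrite phi0.
(* The highest translate of [K] below [q]. By interleaving these translates form a chain, whose top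
   and bottom are [P K1] and [P K2]. *)
pose P K := shift (touch K q) (ht K).
have hP K : height n (P K) by apply/height_shift/ht_height.
have sP K : steps n (P K) = K by rewrite steps_shift steps_ht.
have Pq K a : (a <= n)%N -> P K a <= q a by move=> an; exact: (touchP K q).1.
have Pt K : exists2 k, (k <= n)%N & P K k = q k := (touchP K q).2.
pose w K : int := \sum_(k < n.+1) P K k.
have PP K L : K \in S -> L \in S -> w K <= w L -> forall a, (a <= n)%N -> P K a <= P L a.
  move=> hK hL wKL a an; rewrite leNgt; apply/negP => lt.
  suff : w L < w K by move: wKL; clear; lia.
  have an1 : (a < n.+1)%N by [].
  rewrite /w (bigD1 (Ordinal an1)) //= [ltRHS](bigD1 (Ordinal an1)) //=.
  apply: ltr_leD => //; apply: ler_sum => k _.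
  have kn : (k <= n)%N by rewrite -ltnS.
  have := @interleaved_heights (P K) (P L) a k;
    rewrite !sP => /(_ (cS _ _ hK hL) (hP _) (hP _) an kn).
  by move: lt; clear; lia.
have [K1 S1 max1] : exists2 K1, K1 \in S & forall K, K \in S -> w K <= w K1.
  by exists [arg max_(K > J0 in S) w K]%O; case: arg_maxP.
have [K2 S2 min2] : exists2 K2, K2 \in S & forall K, K \in S -> w K2 <= w K.
  by exists [arg min_(K < J0 in S) w K]%O; case: arg_minP.
have PE K a : P K a = ht K a + touch K q by [].
clearbody w P.
have [k2 k2n k2q] := Pt K2.
(* The lowest translate of a member of [S] that is not below [q]. *)
pose p' := shift 1 (P K2); have hp' : height n p' by apply: height_shift.
have sp' : steps n p' = K2 by rewrite steps_shift sP.
have P1p' a : (a <= n)%N -> P K1 a <= p' a.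
  move=> an; have := @interleaved_heights (P K1) (P K2) a k2.
  rewrite !sP => /(_ (cS _ _ S1 S2) (hP _) (hP _) an k2n); rewrite k2q.
  by move: (Pq K1 k2 k2n); rewrite /p' /shift; clear; lia.
have Mp' : steps n p' \in M by rewrite sp' SMi.
have [Mmax Mmin] := LM _ _ hq hp' Mq Mp'.
pose r := hmin q p'; have hr : height n r by apply: height_min.
(* For every [K] in [S], [P K <= P K1 <= r <= P K2 + 1 <= P K + 1]; so [r] is interleaved with all
   of [S] and maximality applies. *)
have Sr : steps n r \in S.
  apply: maxS => // K hK.
  have bnd a : (a <= n)%N -> 0 <= r a - P K a <= 1.
    move=> an; move: (PP _ _ hK S1 (max1 _ hK) a an) (PP _ _ S2 hK (min2 _ hK) a an).
    by move: (Pq K1 a an) (P1p' a an); rewrite /r /hmin /p' /shift; clear; lia.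
  apply/interleavedP => a b an bn; move: (bnd a an) (bnd b bn); rewrite !PE.
  by rewrite (height_eq hr an) (height_eq hr bn); clear; lia.
have := phi_conc q p' hq hp' Mq Mp'; rewrite /defect sp' (phi0 _ Sr) (phi0 _ S2).
rewrite !addr0 subr_ge0 => le; apply: le_trans le _; apply: IH => //.
- have k2n1 : (k2 < n.+1)%N by [].
  suff : dist (hmax q p') < dist q by move: hm; clear; lia.
  rewrite /dist (bigD1 (Ordinal k2n1)) //= [ltRHS](bigD1 (Ordinal k2n1)) //=.
  apply: ltr_leD; first by rewrite /hmax /p' /shift k2q; clear; lia.
  by apply: ler_sum => k _; rewrite /hmax; clear; lia.
- exact: height_max.
move=> a an; have ua := qu a an; rewrite /hmax.
suff : p' a <= u a by move: ua; clear; lia.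
have := PP _ _ S2 uS (min2 _ uS) a an.
have uE k : (k <= n)%N -> u k = P (steps n u) k + (u 0%N - touch (steps n u) q).
  by move=> kn; rewrite {1}(height_eq hu kn) PE; clear; lia.
(* [u] is a translate of [P (steps n u)]. Unless it is a higher one, [q] is squeezed between the two
   and has the steps of [u]. *)
have [c0|] := leP (u 0%N - touch (steps n u) q) 0; last first.
  by move: (uE a an); rewrite /p' /shift; clear; lia.
case/negP: Sq; rewrite (_ : steps n q = steps n u) //; apply: eq_steps => k kn.
by move: (qu k kn) (Pq (steps n u) k kn) c0; rewrite (uE k kn); clear; lia.
Qed.

Lemma max_clique M S : S \subset M -> clique S -> exists T : {set {set 'I_n}},
  [/\ S \subset T, T \subset M, clique T &
      forall J, J \in M -> (forall K, K \in T -> interleaved J K) -> J \in T].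
Proof.
move=> SM cS.
have [|T /maxsetP[/andP[TM cT] mx] ST] :=
  @maxset_exists _ (fun T : {set {set 'I_n}} => (T \subset M) && clique T) S.
  by rewrite SM.
exists T; split=> // J hJ hT; rewrite -(mx (J |: T)%SET) ?setU11 ?finset.subsetUr //.
rewrite finset.subUset finset.sub1set hJ TM /=; apply/cliqueP => K L.
rewrite !inE => /orP[/eqP ->|hK] /orP[/eqP ->|hL].
- by apply/interleavedP => a b _ _; lia.
- exact: hT.
- by rewrite interleavedC hT.
- by have /cliqueP := cT; apply.
Qed.

(** Some tilt of [f] is constant on a maximal clique; minus that constant it vanishes there and is
    L-concave, hence nonpositive everywhere. *)
Lemma clique_cell f S : Lconcave f -> clique S -> exists z, S \subset cell f z.
Proof.
move=> hf cS; have [T [ST _ cT mxT]] := max_clique (finset.subsetT S) cS.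
have [J0 hJ0|S0] := pickP (fun J => J \in T); last first.
  exists (fun=> 0); apply/fintype.subsetP => J /(fintype.subsetP ST).
  by rewrite S0.
have [z [c hz]] := clique_tilt f cT.
exists z; apply: fintype.subset_trans ST _; apply/fintype.subsetP => J hJ.
apply/cellP => K; rewrite (hz J hJ) -subr_le0.
apply: (@Lconcave_le0 [set: {set 'I_n}]%SET T (fun K => tilt f z K - c)) => //.
- by move=> p q; rewrite !inE.
- by exists J0.
- move=> p q hp hq _ _; rewrite /defect.
  have := tilt_maxmin f z hp hq; have := hf p q hp hq; rewrite /defect; lra.
- by move=> L /hz ->; rewrite subrr.
- by rewrite inE.
Qed.

(** [T] is maximal only within the cell of [f], on which [g] has defect 0. There the negative of a
    tilt of [g] is L-concave too, so comparison with [T] bounds the tilt from below and forces the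
    whole cell to the maximum. *)
Lemma cell_sub_cell f g z : Lconcave f -> Lconcave g ->
  (forall p q, height n p -> height n q -> defect p q f = 0 -> defect p q g = 0) ->
  exists z', cell f z \subset cell g z'.
Proof.
move=> hf hg fg; have [J0 hJ0] := cell_neq0 f z.
have [||T [ST TM cT mxT]] := @max_clique (cell f z) [set J0]%SET.
- by rewrite finset.sub1set.
- apply/cliqueP => J K; rewrite !inE => /eqP -> /eqP ->.
  by apply/interleavedP => a b _ _; lia.
have hJT : J0 \in T by move: ST; rewrite finset.sub1set.
have [z' /fintype.subsetP Tz'] := clique_cell hg cT.
exists z'; apply/fintype.subsetP => J hJ; apply/cellP => K.
apply: le_trans (cellP _ _ _ (Tz' _ hJT) K) _; rewrite -subr_le0.
apply: (@Lconcave_le0 (cell f z) T (fun J => tilt g z' J0 - tilt g z' J)) => //.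
- exact: Lclosed_cell.
- by exists J0.
- move=> p q hp hq cp cq; have [_ _ d0] := cell_defect hf hp hq cp cq.
  have := tilt_maxmin g z' hp hq; rewrite (fg p q hp hq d0) /defect; lra.
- by move=> L hL; rewrite (cell_eq (Tz' _ hJT) (Tz' _ hL)) subrr.
Qed.

(** Passing back and forth enlarges cells until a cell of [f] containing the given one is also a
    cell of [g]. The given cell is its face where the linear form [z - z1] is largest, and
    [cell_perturb] realises this face as a cell of [g]. *)
Lemma cell_eq_cell f g z : Lconcave f -> Lconcave g ->
  (forall p q, height n p -> height n q -> defect p q f = 0 <-> defect p q g = 0) ->
  exists z', cell f z = cell g z'.
Proof.
move=> hf hg fg.
have fg1 p q hp hq := (fg p q hp hq).1; have gf1 p q hp hq := (fg p q hp hq).2.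
have [z1 [z2 [sub eq12]]] : exists z1 z2, cell f z \subset cell f z1 /\ cell f z1 = cell g z2.
  have [m] := ubnP (#|{: {set 'I_n}}| - #|cell f z|)%N.
  have := fintype.subxx (cell f z); move: {2 3}z => z1.
  elim: m z1 => // m IH z1 sub hm.
  have [z2 s12] := cell_sub_cell z1 hf hg fg1; have [z3 s23] := cell_sub_cell z2 hg hf gf1.
  have [le|lt] := leqP #|cell f z3| #|cell f z1|.
    exists z1, z2; split=> //; apply/eqP; rewrite eqEcard s12 /=.
    exact: leq_trans (subset_leq_card s23) le.
  apply: (IH z3); first exact: fintype.subset_trans sub (fintype.subset_trans s12 s23).
  have := subset_leq_card (finset.subsetT (cell f z3)); rewrite cardsT => le.
  by rewrite ltnS in hm; apply: leq_trans hm; apply: ltn_sub2l => //; exact: leq_trans lt le.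
have [e e0 he] := cell_perturb g z2 (fun i => z i - z1 i).
exists (fun i => z2 i + e * (z i - z1 i)); rewrite he -eq12.
have dE J : \sum_(i in J) (z i - z1 i) = tilt f z J - tilt f z1 J.
  by rewrite /tilt sumrB; ring.
have [J0 hJ0] := cell_neq0 f z; have J01 := fintype.subsetP sub _ hJ0.
apply/setP => J; rewrite inE; apply/idP/andP => [hJ|[hJ1 /forallP mx]].
  have hJ1 := fintype.subsetP sub _ hJ.
  split=> //; apply/forallP => K; apply/implyP => hK.
  by rewrite !dE (cell_eq hK hJ1) lerD2r; exact: (cellP _ _ _ hJ).
have /implyP/(_ J01) := mx J0; rewrite !dE (cell_eq J01 hJ1) lerD2r => le.
by apply/cellP => K; apply: le_trans le; exact: (cellP _ _ _ hJ0).
Qed.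
End Cliques.

(** * Exchange property of cells *)

Section Exchange.
Variables (R : realFieldType) (T : finType).
Implicit Types (F : {set T} -> R) (B C D Y : {set T}) (BB : {set {set T}}).

(** Required for all labellings of the four elements, this says that among the three sums over
    pairings the largest occurs at least twice. *)
Definition four_point F := forall Y a b c d, uniq [:: a; b; c; d] ->
  [disjoint Y & [set a; b; c; d]%SET] ->
  F (Y :|: [set a; b])%SET + F (Y :|: [set c; d])%SET <=
  Num.max (F (Y :|: [set a; c])%SET + F (Y :|: [set b; d])%SET)
          (F (Y :|: [set a; d])%SET + F (Y :|: [set b; c])%SET).

Definition swap B u v : {set T} := (v |: B :\ u)%SET.

(* Dress-Wenzel/Murota: in a counterexample with [B :\: B'] minimal, a suitable
   weight [p] makes all exchanges out of [B] neutral, and an exchange of [B']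
   along another element [u0] yields a smaller counterexample. *)
Lemma four_point_exchange F : four_point F ->
  forall B B' u, #|B| = #|B'| -> u \in B :\: B' ->
  exists2 v, v \in B' :\: B & F B + F B' <= F (swap B u v) + F (swap B' v u).
Proof.
move=> hF B B'; have [m hm] := ubnP #|B :\: B'|.
elim: m B' hm => // m IH B' hm u cBB' hu.
have cD : #|B :\: B'| = #|B' :\: B|.
  have := cardsID B' B; have := cardsID B B'; rewrite (finset.setIC B' B); lia.
have [uB uB'] : u \in B /\ u \notin B' by move: hu; rewrite inE => /andP[].
have [/existsP[v /andP[hv le]]|] :=
  boolP [exists v, (v \in B' :\: B) && (F B + F B' <= F (swap B u v) + F (swap B' v u))].
  by exists v.
rewrite negb_exists => /forallP bad; exfalso.
have {}bad v : v \in B' :\: B -> F (swap B u v) + F (swap B' v u) < F B + F B'.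
  by move=> hv; have := bad v; rewrite hv /= -ltNge.
have [v1 hv1] : exists v1, v1 \in B' :\: B.
  by apply/finset.set0Pn; rewrite -card_gt0 -cD card_gt0; apply/finset.set0Pn; exists u.
(* If [u] is the only element of [B :\: B'], exchanging it with [v1] merely interchanges [B] and
   [B'], so the inequality holds with equality. *)
have [u0 hu0 u0u] : exists2 u0, u0 \in B :\: B' & u0 != u.
  have [/existsP[u0 /andP[h1 h2]]|] := boolP [exists u0, (u0 \in B :\: B') && (u0 != u)].
    by exists u0.
  rewrite negb_exists => /forallP only.
  have e1 : (B :\: B')%SET = [set u]%SET.
    apply/setP => x; rewrite [RHS]inE; apply/idP/eqP => [hx|->//].
    by have := only x; rewrite hx /= negbK => /eqP.
  have e2 : (B' :\: B)%SET = [set v1]%SET.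
    apply/eqP; rewrite eq_sym eqEcard finset.sub1set hv1 /= -cD e1 !cards1 //.
  have mB x : (x \in B) && (x \notin B') = (x == u).
    by move/setP: e1 => /(_ x); rewrite !inE andbC.
  have mB' x : (x \in B') && (x \notin B) = (x == v1).
    by move/setP: e2 => /(_ x); rewrite !inE andbC.
  have E1 : swap B u v1 = B'.
    apply/setP => x; move: (mB x) (mB' x); rewrite !inE.
    by case: (x == v1); case: (x == u); case: (x \in B); case: (x \in B').
  have E2 : swap B' v1 u = B.
    apply/setP => x; move: (mB x) (mB' x); rewrite !inE.
    by case: (x == v1); case: (x == u); case: (x \in B); case: (x \in B').
  by have := bad v1 hv1; rewrite E1 E2 addrC ltxx.
have [u0B u0B'] : u0 \in B /\ u0 \notin B' by move: hu0; rewrite inE => /andP[].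
pose p v := F B - F (swap B u v).
pose v0 := [arg max_(v > v1 in B' :\: B) (F (swap B' v u0) - p v)]%O.
have [hv0 max0] : v0 \in B' :\: B /\ forall v, v \in B' :\: B ->
    F (swap B' v u0) - p v <= F (swap B' v0 u0) - p v0.
  by rewrite /v0; case: arg_maxP.
clearbody v0.
have [v0B v0B'] : v0 \notin B /\ v0 \in B' by move: hv0; rewrite inE => /andP[].
have neq x y (D : {set T}) : x \in D -> y \notin D -> x != y.
  by move=> xD yD; apply: contraNneq yD => <-.
pose B2 := swap B' v0 u0.
have cB2 : #|B2| = #|B'|.
  by rewrite /B2 /swap cardsU1 !inE (negbTE u0B') andbF (cardsD1 v0 B') v0B'.
have D2 : (B :\: B2)%SET = ((B :\: B') :\ u0)%SET.
  apply/setP => x; rewrite !inE negb_or.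
  have [->|xu0] := eqVneq x u0; first by [].
  by have [->|_] := eqVneq x v0; rewrite ?(negbTE v0B) ?andbF.
have hu2 : u \in (B :\: B2)%SET by rewrite D2 in_setD1 eq_sym u0u.
have hm2 : (#|B :\: B2| < m)%N.
  by rewrite D2; move: hm; rewrite (cardsD1 u0) hu0.
have [v hv le] := IH B2 hm2 u (etrans cBB' (esym cB2)) hu2.
have [vB vB' vv0] : [/\ v \notin B, v \in B' & v != v0].
  move: hv; rewrite !inE => /andP[vB /orP[/eqP e|/andP[]]] //.
  by rewrite e u0B in vB.
have hv' : v \in (B' :\: B)%SET by rewrite inE vB vB'.
pose Y := (B' :\ v0 :\ v)%SET.
have nu : [/\ v0 != u, v != u, v0 != u0 & v != u0].
  by split; [exact: neq v0B' uB'|exact: neq vB' uB'|exact: neq v0B' u0B'|exact: neq vB' u0B'].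
case: nu => v0u vu v0u0 vu0.
have un : uniq [:: u0; u; v0; v].
  by rewrite /= !inE !negb_or u0u ![_ == v0]eq_sym ![_ == v]eq_sym v0u0 vu0 v0u vu vv0.
(* Both alternatives are absurd. Combined with the exchange between [B] and [B2], the one through
   [B2] contradicts [bad v]; the other contradicts [bad v0] by the choice of [v0]. *)
have := hF Y u0 u v0 v un.
have -> : [disjoint Y & [set u0; u; v0; v]%SET].
  rewrite disjoint_subset; apply/fintype.subsetP => x; rewrite !inE.
  move=> /andP[xv /andP[xv0 xB']]; rewrite (negbTE xv) (negbTE xv0) !orbF negb_or.
  by rewrite (neq _ _ _ xB' u0B') (neq _ _ _ xB' uB').
move=> /(_ isT).
have eqY a b C : (forall x, (x \in C) = [|| x == a, x == b | [&& x != v, x != v0 & x \in B']]) ->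
    (Y :|: [set a; b])%SET = C.
  by move=> h; apply/setP => x; rewrite h !inE orbC -orbA.
have -> : (Y :|: [set u0; u])%SET = swap B2 v u.
  apply: eqY => x; rewrite !inE.
  by have [->|] := eqVneq x u0; rewrite ?orbT ?(eq_sym u0 v) ?vu0 ?orbT //= => _.
have -> : (Y :|: [set v0; v])%SET = B'.
  apply: eqY => x; have [->|] := eqVneq x v0; rewrite ?v0B' //=.
  by have [->|] := eqVneq x v; rewrite ?vB'.
have -> : (Y :|: [set u0; v0])%SET = swap B' v u0.
  apply: eqY => x; rewrite !inE; have [//|] := eqVneq x u0.
  by have [->|] := eqVneq x v0; rewrite ?v0B' ?(eq_sym v0) ?vv0.
have -> : (Y :|: [set u; v])%SET = swap B' v0 u.
  apply: eqY => x; rewrite !inE; have [//|] := eqVneq x u.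
  by have [->|] := eqVneq x v; rewrite ?vB' ?vv0.
have -> : (Y :|: [set u0; v])%SET = B2.
  apply: eqY => x; rewrite !inE; have [//|] := eqVneq x u0.
  by have [->|] := eqVneq x v; rewrite ?vB' ?vv0.
have -> : (Y :|: [set u; v0])%SET = swap B' v u.
  apply: eqY => x; rewrite !inE; have [//|] := eqVneq x u.
  by have [->|] := eqVneq x v0; rewrite ?v0B' ?(eq_sym v0) ?vv0.
have := max0 v hv'; have := bad v hv'; have := bad v0 hv0; rewrite -/B2 /p.
move: le; rewrite le_max => le b0 b1 mx /orP[] h; move: le b0 b1 mx h; clear; lra.
Qed.

Definition exchange BB := forall B B' u, B \in BB -> B' \in BB -> u \in B :\: B' ->
  exists2 v, v \in B' :\: B & (swap B u v \in BB) && (swap B' v u \in BB).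

(** Greedy principle: among the members best for [D], one that is best for [C] is best for [C] among
    all. If some [K] met [C] in more elements, an exchange at [u] in [C] but not in [B] would move
    [K] closer to [B] (when [v] lies in [C]) or improve [B] on [C] without loss on [D]. *)
Lemma exchange_nested_max BB C D : exchange BB -> (exists B, B \in BB) -> C \subset D ->
  exists2 B, B \in BB &
    forall K, K \in BB -> (#|K :&: C| <= #|B :&: C|)%N /\ (#|K :&: D| <= #|B :&: D|)%N.
Proof.
move=> ex [B0 hB0] CD.
pose B1 := [arg max_(B > B0 in BB) #|B :&: D|]%N.
have [h1 max1] : B1 \in BB /\ forall K, K \in BB -> (#|K :&: D| <= #|B1 :&: D|)%N.
  by rewrite /B1; case: arg_maxnP.
pose P B := (B \in BB) && (#|B :&: D| == #|B1 :&: D|).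
have PB1 : P B1 by rewrite /P h1 eqxx.
pose B := [arg max_(B > B1 | P B) #|B :&: C|]%N.
have [/andP[hB /eqP eD] maxC] : P B /\ forall K, P K -> (#|K :&: C| <= #|B :&: C|)%N.
  by rewrite /B; case: arg_maxnP.
clearbody B; exists B => // K hK; split; last by rewrite eD max1.
rewrite leqNgt; apply/negP.
have [m hm] := ubnP #|K :\: B|; elim: m K hm hK => // m IH K hm hK lt.
have [u /setIP[uK uC] uB] : exists2 u, u \in (K :&: C)%SET & u \notin B.
  apply/fintype.subsetPn; apply: contraL lt => sub; rewrite -leqNgt.
  by apply: subset_leq_card; rewrite finset.subsetI sub finset.subsetIr.
have hu : u \in (K :\: B)%SET by rewrite inE uB.
have [v hv /andP[hK' hB']] := ex K B u hK hB hu.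
have [vK vB] : v \notin K /\ v \in B by move: hv; rewrite inE => /andP[].
have uD : u \in D by exact: (fintype.subsetP CD).
have cardS (A E : {set T}) a b : a \in A -> b \notin A ->
    (#|swap A a b :&: E| + (a \in E) = #|A :&: E| + (b \in E))%N.
  move=> aA bA; have ab : b != a by apply: contraNneq bA => ->.
  rewrite /swap finset.setIUl.
  have -> : ([set b] :&: E)%SET = if b \in E then [set b]%SET else finset.set0.
    by apply/setP => x; case: ifP => bE; rewrite !inE; have [->|//] := eqVneq x b; rewrite ?bE.
  have -> : ((A :\ a) :&: E)%SET = ((A :&: E) :\ a)%SET.
    by apply/setP => x; rewrite !inE andbA.
  rewrite (cardsD1 a (A :&: E)) inE aA /=.
  case: (b \in E); last by rewrite finset.set0U addn0 addnC.
  by rewrite cardsU1 !inE (negbTE bA) andbF /=; clear; lia.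
have cC := cardS K C u v uK vK; have cC' := cardS B C v u vB uB.
have cD' := cardS B D v u vB uB; rewrite uC in cC cC'; rewrite uD in cD'.
have [vC|vC] := boolP (v \in C).
  rewrite vC in cC; apply: (IH (swap K u v)) => //; last by move: cC lt; clear; lia.
  have : (swap K u v :\: B \subset (K :\: B) :\ u)%SET.
    apply/fintype.subsetP => x; rewrite !inE => /andP[xB /orP[/eqP e|/andP[-> ->]]].
      by rewrite e vB in xB.
    by rewrite xB.
  move=> /subset_leq_card; move: hm; rewrite (cardsD1 u (K :\: B)) hu; clear; lia.
rewrite (negbTE vC) in cC'.
have := max1 _ hB'; have := maxC (swap B v u).
rewrite /P hB' -eD /=; case: (v \in D) cD' => cD'.
  have -> : #|swap B v u :&: D| == #|B :&: D| by move: cD'; clear; lia.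
  by move=> /(_ isT); move: cC'; clear; lia.
by move=> _; move: cD'; clear; lia.
Qed.

End Exchange.

(** * Matroid exchange for cells and members extremal on two sets at once *)

Section StrongPair.
Variables (R : realFieldType) (n : nat).
Implicit Types (f : {set 'I_n} -> R) (z : 'I_n -> R) (X J K A : {set 'I_n}).

Lemma sum_setU1 z X i : i \notin X ->
  \sum_(a in (X :|: [set i])%SET) z a = \sum_(a in X) z a + z i.
Proof. by move=> iX; rewrite finset.setUC big_setU1 //= addrC. Qed.

Lemma sum_setU2 z X i j : i != j -> i \notin X -> j \notin X ->
  \sum_(a in (X :|: [set i; j])%SET) z a = \sum_(a in X) z a + z i + z j.
Proof.
move=> ij iX jX; rewrite finset.setUA sum_setU1 ?sum_setU1 //.
by rewrite !inE negb_or jX eq_sym.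
Qed.

Lemma triple_notin X (i j k : 'I_n) : X \subset (~: [set i; j; k])%SET ->
  [/\ i \notin X, j \notin X & k \notin X].
Proof.
by move=> /fintype.subsetP h; split; apply/negP => /h; rewrite !inE eqxx ?orbT.
Qed.

Lemma slack_tilt f z c : slack (tilt f z) c = slack f c.
Proof.
case: c => [[[X i] j]|[[[[X i] j] k] b]] /=.
  case: ifP => // /and3P[ij iX jX].
  by rewrite /tilt sum_setU2 // !sum_setU1 //; ring.
case: ifP => // /and3P[ij jk /triple_notin[iX jX kX]].
have neq (a b' : 'I_n) : (a < b')%N -> a != b' by rewrite -val_eqE ltn_neqAle => /andP[].
have ij' := neq _ _ ij; have jk' := neq _ _ jk; have ik' := neq _ _ (ltn_trans ij jk).
by case: b; rewrite /tilt !sum_setU2 // !sum_setU1 //; ring.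
Qed.

Lemma local_dctp_tilt f z : local_dctp f -> local_dctp (tilt f z).
Proof. by move=> [p t]; split=> [c|X i j k]; rewrite !slack_tilt. Qed.

Lemma curvC f X i j : curv f X i j = curv f X j i.
Proof. by rewrite /curv finset.setUC [[set i; j]%SET]finset.setUC finset.setUC addrAC. Qed.

Lemma curv_le f X i j : local_dctp f -> i != j -> i \notin X -> j \notin X ->
  curv f X i j <= - f X.
Proof. by move=> [/(_ (inl (X, i, j))) + _] ij iX jX; rewrite /= ij iX jX /= /curv; lra. Qed.

(** By the Pluecker relation the largest of the three curvatures occurs twice, a consequence that no
    longer refers to the order of the indices. *)
Lemma curv_ultrametric f X i j k : local_dctp f -> i != j -> j != k -> i != k ->
  i \notin X -> j \notin X -> k \notin X ->
  curv f X i j <= Num.max (curv f X i k) (curv f X j k).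
Proof.
move=> hf ij jk ik iX jX kX.
have sub (a b c : 'I_n) : a \notin X -> b \notin X -> c \notin X ->
    X \subset (~: [set a; b; c])%SET.
  move=> aX bX cX; apply/fintype.subsetP => x xX; rewrite !inE.
  by apply/negP => /orP[/orP[]|] /eqP e; move: aX bX cX; rewrite -e xX.
have mx (a b c : 'I_n) : (a < b)%N -> (b < c)%N -> a \notin X -> b \notin X -> c \notin X ->
    curv f X a c = Num.max (curv f X a b) (curv f X b c).
  by move=> ab bc aX bX cX; apply: curv_max => //; exact: sub.
wlog lij : i j ij jk ik iX jX / (i < j)%N.
  move=> W; case: (ltngtP i j) => [l|l|/val_inj e]; first exact: W.
    by rewrite curvC maxC; apply: W => //; rewrite eq_sym.
  by rewrite e eqxx in ij.
rewrite le_max.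
case: (ltngtP j k) => [ljk|lkj|/val_inj e]; last by rewrite e eqxx in jk.
  by rewrite (mx i j k) // le_max lexx.
case: (ltngtP i k) => [lik|lki|/val_inj e]; last by rewrite e eqxx in ik.
  by rewrite (mx i k j) // [curv f X k j]curvC -le_max.
by rewrite [curv f X j k]curvC (mx k i j) // le_max lexx !orbT.
Qed.

Let E := ('I_n + 'I_n)%type.

(* [f] is viewed as a function of the subsets of [E], the second copy of ['I_n]
   consisting of dummy elements; sets of cardinality [n] of [E] then replace
   sets of arbitrary cardinality. *)
Definition real_part (B : {set E}) : {set 'I_n} := [set i | inl i \in B]%SET.

(** A pair containing a dummy has curvature [- f X], the largest possible value by submodularity, so
    the ultrametric inequality extends to dummies. Its instances at the triples [abc], [abd], [cda],
    [cdb] give the four-point inequality. *)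
Lemma four_point_ext f : local_dctp f -> four_point (fun B : {set E} => f (real_part B)).
Proof.
move=> hf Y a b c d un dis; pose F B := f (real_part B).
pose w x y := F (Y :|: [set x; y])%SET - F (Y :|: [set x])%SET - F (Y :|: [set y])%SET.
have nY x : x \in [:: a; b; c; d] -> x \notin Y.
  move=> hx; move: dis; rewrite disjoint_sym disjoint_subset => /fintype.subsetP/(_ x); apply.
  by move: hx; rewrite !inE -!orbA.
pose X := real_part Y.
have Xl i : inl i \in [:: a; b; c; d] -> i \notin X by move=> /nY; rewrite inE.
have rl i : real_part (Y :|: [set inl i])%SET = (X :|: [set i])%SET.
  by apply/setP => x; rewrite !inE.
have rr i : real_part (Y :|: [set inr i])%SET = X.
  by apply/setP => x; rewrite !inE orbF.
have rll i j : real_part (Y :|: [set inl i; inl j])%SET = (X :|: [set i; j])%SET.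
  by apply/setP => x; rewrite !inE.
have rlr i j : real_part (Y :|: [set inl i; inr j])%SET = (X :|: [set i])%SET.
  by apply/setP => x; rewrite !inE orbF.
have rrl i j : real_part (Y :|: [set inr i; inl j])%SET = (X :|: [set j])%SET.
  by apply/setP => x; rewrite !inE.
have rrr i j : real_part (Y :|: [set inr i; inr j])%SET = X.
  by apply/setP => x; rewrite !inE orbF.
have wll i j : w (inl i) (inl j) = curv f X i j by rewrite /w /F rll !rl.
have wlr i j : w (inl i) (inr j) = - f X by rewrite /w /F rlr rl rr; ring.
have wrl i j : w (inr i) (inl j) = - f X by rewrite /w /F rrl rl rr; ring.
have wrr i j : w (inr i) (inr j) = - f X by rewrite /w /F rrr !rr; ring.
have wC x y : w x y = w y x.
  by rewrite /w [[set x; y]%SET]finset.setUC addrAC.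
have um x y t : uniq [:: x; y; t] -> {subset [:: x; y; t] <= [:: a; b; c; d]} ->
    w x y <= Num.max (w x t) (w y t).
  rewrite /= !inE negb_or andbT => /andP[/andP[n1 n2] n3] sub.
  have hx : x \in [:: a; b; c; d] by apply: sub; rewrite !inE eqxx.
  have hy : y \in [:: a; b; c; d] by apply: sub; rewrite !inE eqxx orbT.
  have ht : t \in [:: a; b; c; d] by apply: sub; rewrite !inE eqxx !orbT.
  have inj (i j : 'I_n) : inl i != inl j :> E -> i != j by apply: contraNneq => ->.
  case: x y t hx hy ht n1 n2 n3 {sub} => [i|i] [j|j] [k|k] hx hy ht n1 n2 n3;
    rewrite ?wll ?wlr ?wrl ?wrr ?le_max ?lexx ?orbT //.
  - by rewrite -le_max; apply: curv_ultrametric; rewrite ?Xl //; exact: inj.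
  - by rewrite curv_le ?Xl //; exact: inj.
have U : [/\ a != b, c != d, a != c, a != d & b != c] /\ b != d.
  by move: un; rewrite /= !inE !negb_or => /and4P[/and3P[-> -> ->] /andP[-> ->] -> _].
have [[ab cd ac ad bc] bd] := U.
have t x y t : x != y -> x != t -> y != t -> {subset [:: x; y; t] <= [:: a; b; c; d]} ->
    w x y <= Num.max (w x t) (w y t).
  by move=> n1 n2 n3; apply: um; rewrite /= !inE negb_or n1 n2 n3.
have sub3 x y t' : x \in [:: a; b; c; d] -> y \in [:: a; b; c; d] -> t' \in [:: a; b; c; d] ->
    {subset [:: x; y; t'] <= [:: a; b; c; d]}.
  by move=> hx hy ht s /=; rewrite in_cons in_cons mem_seq1 => /or3P[] /eqP ->.
have ha : a \in [:: a; b; c; d] by rewrite !inE eqxx.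
have hb : b \in [:: a; b; c; d] by rewrite !inE eqxx orbT.
have hc : c \in [:: a; b; c; d] by rewrite !inE eqxx !orbT.
have hd : d \in [:: a; b; c; d] by rewrite !inE eqxx !orbT.
suff : w a b + w c d <= Num.max (w a c + w b d) (w a d + w b c).
  by rewrite !le_max /w -!/(F _) => /orP[] h; apply/orP; [left|right]; move: h; lra.
have sy (x y : E) : x != y -> y != x by rewrite eq_sym.
have := t a b c ab ac bc (sub3 _ _ _ ha hb hc); have := t a b d ab ad bd (sub3 _ _ _ ha hb hd).
have := t c d a cd (sy _ _ ac) (sy _ _ ad) (sub3 _ _ _ hc hd ha).
have := t c d b cd (sy _ _ bc) (sy _ _ bd) (sub3 _ _ _ hc hd hb).
rewrite ![_ <= Num.max (w _ _) (w _ _)]le_max (wC c a) (wC d a) (wC c b) (wC d b).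
move=> h1 h2 h3 h4; rewrite leNgt gt_max; apply/negP => /andP[g1 g2].
by case/orP: h1 => h1; case/orP: h2 => h2; case/orP: h3 => h3; case/orP: h4 => h4;
  move: h1 h2 h3 h4 g1 g2; clear; lra.
Qed.

Definition cell_ext f z : {set {set E}} :=
  [set B : {set E} | (#|B| == n) && (real_part B \in cell f z)]%SET.

Lemma in_cell_ext f z (B : {set E}) :
  (B \in cell_ext f z) = (#|B| == n) && (real_part B \in cell f z).
Proof. by rewrite finset.in_set. Qed.

Lemma exchange_ext f z : local_dctp f -> exchange (cell_ext f z).
Proof.
move=> hf B B' u; rewrite !in_cell_ext => /andP[/eqP cB hB] /andP[/eqP cB' hB'] hu.
have hext := four_point_ext (local_dctp_tilt z hf).
have [v hv le] := four_point_exchange hext (etrans cB (esym cB')) hu.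
have cS (C : {set E}) a b : a \in C -> b \notin C -> #|swap C a b| = #|C|.
  by move=> aC bC; rewrite /swap cardsU1 !inE (negbTE bC) andbF (cardsD1 a C) aC.
have [[vB' vB] [uB uB']] : (v \in B' /\ v \notin B) /\ (u \in B /\ u \notin B').
  by move: hv hu; rewrite !inE => /andP[-> ->] /andP[-> ->].
exists v => //; rewrite !in_cell_ext !cS // cB cB' eqxx /=.
have le1 := cellP _ _ _ hB (real_part (swap B u v)).
have le2 := cellP _ _ _ hB' (real_part (swap B' v u)).
have e1 : tilt f z (real_part (swap B u v)) = tilt f z (real_part B).
  by move: le le1 le2; clear; lra.
have e2 : tilt f z (real_part (swap B' v u)) = tilt f z (real_part B').
  by move: le le1 le2; clear; lra.
by rewrite (cell_of_eq hB e1) (cell_of_eq hB' e2).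
Qed.

Lemma cell_nested f z (C D : {set E}) : local_dctp f -> C \subset D ->
  exists2 B : {set E}, #|B| = n /\ real_part B \in cell f z &
  forall K, K \in cell f z -> exists2 B' : {set E}, #|B'| = n /\ real_part B' = K &
    (#|B' :&: C| <= #|B :&: C|)%N /\ (#|B' :&: D| <= #|B :&: D|)%N.
Proof.
move=> hf CD.
pose ext (K : {set 'I_n}) : {set E} :=
  [set x | match x with inl i => i \in K | inr i => i \notin K end]%SET.
have rext K : real_part (ext K) = K by apply/setP => x; rewrite !inE.
have cext K : #|ext K| = n.
  rewrite -sum1_card big_mkcond big_sumType /= -big_split /= -[RHS]card_ord -sum1_card.
  by apply: eq_bigr => i _; rewrite !inE; case: (i \in K).
have [J0 hJ0] := cell_neq0 f z.
have [|B + hB] := exchange_nested_max (@exchange_ext f z hf) _ CD.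
  by exists (ext J0); rewrite in_cell_ext cext eqxx rext.
rewrite in_cell_ext => /andP[/eqP cB rB]; exists B => // K hK; exists (ext K);
  first by rewrite cext rext.
by apply: hB; rewrite in_cell_ext cext eqxx rext.
Qed.

Lemma card_inl (B : {set E}) A :
  #|B :&: [set inl i | i in A]| = #|real_part B :&: A|.
Proof.
rewrite -(card_imset (mem (real_part B :&: A)) (@inl_inj 'I_n 'I_n)); apply: eq_card => -[i|i].
  rewrite inE !mem_imset ?inE //; exact: inl_inj.
by rewrite !inE; apply/andP/imsetP => [[_ /imsetP[]]|[]].
Qed.

Lemma card_inlC (B : {set E}) A :
  (#|B :&: ~: [set inl i | i in A]| + #|real_part B :&: A| = #|B|)%N.
Proof. by rewrite -card_inl addnC -(cardsID [set inl i | i in A] B) finset.setDE. Qed.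

Lemma cell_max_max f z A A' : local_dctp f -> A \subset A' ->
  exists2 J, J \in cell f z & forall K, K \in cell f z ->
    (#|K :&: A| <= #|J :&: A|)%N /\ (#|K :&: A'| <= #|J :&: A'|)%N.
Proof.
move=> hf AA'.
have [|B [cB hB] h] := @cell_nested f z [set inl i | i in A] [set inl i | i in A'] hf.
  exact: imsetS.
exists (real_part B) => // K /h[B' [cB' <-]]; by rewrite !card_inl.
Qed.

(** All sets of [cell_ext] have [n] elements, so few elements in [A] means many outside the copy of
    [A]; complementation reverses the inclusion and keeps the two sets nested. *)
Lemma cell_min_min f z A A' : local_dctp f -> A \subset A' ->
  exists2 J, J \in cell f z & forall K, K \in cell f z ->
    (#|J :&: A| <= #|K :&: A|)%N /\ (#|J :&: A'| <= #|K :&: A'|)%N.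
Proof.
move=> hf AA'.
have [|B [cB hB] h] := @cell_nested f z (~: [set inl i | i in A']) (~: [set inl i | i in A]) hf.
  by rewrite finset.setCS imsetS.
exists (real_part B) => // K /h[B' [cB' <-]].
move: (card_inlC B A) (card_inlC B A') (card_inlC B' A) (card_inlC B' A').
by rewrite cB cB'; clear; lia.
Qed.

Lemma cell_max_min f z A A' : local_dctp f -> [disjoint A & A'] ->
  exists2 J, J \in cell f z & forall K, K \in cell f z ->
    (#|K :&: A| <= #|J :&: A|)%N /\ (#|J :&: A'| <= #|K :&: A'|)%N.
Proof.
move=> hf AA'.
have [|B [cB hB] h] := @cell_nested f z [set inl i | i in A] (~: [set inl i | i in A']) hf.
  apply/fintype.subsetP => _ /imsetP[i iA ->]; rewrite inE mem_imset; last exact: inl_inj.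
  by rewrite (disjointFr AA').
exists (real_part B) => // K /h[B' [cB' <-]]; rewrite !card_inl.
move: (card_inlC B A') (card_inlC B' A'); rewrite cB cB'; clear; lia.
Qed.

End StrongPair.

(** * Domains of affinity *)

(** Layer-cake decomposition: the least positive value is subtracted on the support, which then
    shrinks. The sets that occur are superlevel sets, hence nested. *)
Lemma level_sets (R : realFieldType) (I : finType) (phi : I -> R) (B : R) :
  (forall k, 0 <= phi k <= B) -> 0 <= B ->
  exists v : {set I} -> R, [/\ forall A, 0 <= v A,
    forall k, \sum_(A : {set I} | k \in A) v A = phi k, \sum_A v A <= B &
    forall A, v A != 0 -> exists2 t, 0 < t & forall k, (k \in A) = (t <= phi k)].
Proof.
have [m hm] := ubnP #|[set k | 0 < phi k]%SET|.
elim: m phi B hm => // m IH phi B hm hphi B0.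
pose A := [set k | 0 < phi k]%SET.
have [k1 hk1|none] := pickP (fun k => 0 < phi k); last first.
  exists (fun=> 0); split => // [k||A']; rewrite ?big1 ?eqxx //.
  by apply/eqP; rewrite eq_le (andP (hphi k)).1 leNgt none.
pose k0 := [arg min_(k < k1 | 0 < phi k) phi k]%O.
have [pos0 min0] : 0 < phi k0 /\ forall k, 0 < phi k -> phi k0 <= phi k.
  by rewrite /k0; case: arg_minP.
clearbody k0; pose phi' k := if 0 < phi k then phi k - phi k0 else 0.
have le0B : phi k0 <= B := (andP (hphi k0)).2.
have phi'B k : 0 <= phi' k <= B - phi k0.
  rewrite /phi'; case: ifP => pk; last by rewrite lexx subr_ge0.
  by rewrite subr_ge0 min0 //= lerD2r (andP (hphi k)).2.
have [||v [v0 vphi vB vA]] := IH phi' (B - phi k0) _ phi'B.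
- rewrite (leq_trans _ (_ : #|A| <= m)%N) //; apply: proper_card.
  apply/fintype.properP; split.
    by apply/fintype.subsetP => k; rewrite !inE /phi'; case: ifP; rewrite ?ltxx.
  by exists k0; rewrite !inE // /phi' pos0 subrr ltxx.
- by rewrite subr_ge0.
have k0A : k0 \in A by rewrite inE.
have sumA (P : pred {set I}) : \sum_(C | P C) (v C + (if C == A then phi k0 else 0)) =
    \sum_(C | P C) v C + (if P A then phi k0 else 0).
  rewrite big_split /=; congr (_ + _); rewrite -big_mkcondr /=.
  case: ifP => PA; last by rewrite big1 // => C /andP[PC /eqP e]; rewrite -e PC in PA.
  by rewrite (bigD1 A) /= ?PA ?eqxx // big1 ?addr0 // => C /andP[/andP[_ ->]].
exists (fun C => v C + (if C == A then phi k0 else 0)); split.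
- by move=> C; rewrite addr_ge0 //; case: ifP => // _; exact: ltW.
- move=> k; rewrite sumA vphi inE /phi'; case: ifP => pk; first by rewrite subrK.
  by rewrite addr0; apply/eqP; rewrite eq_le (andP (hphi k)).1 leNgt pk.
- by rewrite (sumA predT) /=; move: vB; lra.
move=> C; have [-> _|_] := eqVneq C A.
  exists (phi k0) => // k; rewrite inE; apply/idP/idP => [/min0 //|].
  exact: lt_le_trans.
rewrite addr0 => /vA[t t0 ht]; exists (t + phi k0); first exact: addr_gt0.
move=> k; rewrite ht /phi'; case: ifP => pk; first by rewrite lerBrDr.
by apply/idP/idP => h; have := (andP (hphi k)).1; lra.
Qed.

Section Hulls.
Variables (R : realType) (n : nat).
Implicit Types (f : setfun R n) (z : 'I_n -> R) (x : 'rV[R]_n) (J K : {set 'I_n}).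
Implicit Types (M : {set {set 'I_n}}) (w : {set 'I_n} -> R).

Definition weights w x := [/\ forall J, 0 <= w J, \sum_J w J = 1 & \sum_J w J *: eset R J = x].

Definition hull M : set 'rV[R]_n :=
  [set x | exists2 w, weights w x & forall J, J \notin M -> w J = 0]%classic.

Definition dot z x := \sum_i z i * x 0 i.

Lemma eset_coord J i : eset R J 0 i = (i \in J)%:R.
Proof. by rewrite mxE. Qed.

Lemma weights_coord w x i : weights w x -> x 0 i = \sum_J w J * (i \in J)%:R.
Proof. by move=> [_ _ <-]; rewrite summxE; apply: eq_bigr => J _; rewrite !mxE. Qed.

Lemma weights_dot w x z : weights w x -> dot z x = \sum_J w J * \sum_(i in J) z i.
Proof.
move=> hw; rewrite /dot; under eq_bigr do rewrite (weights_coord _ hw) mulr_sumr.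
rewrite exchange_big /=; apply: eq_bigr => J _; rewrite [in RHS]big_mkcond [RHS]mulr_sumr.
by apply: eq_bigr => i _; case: (i \in J); rewrite ?mulr1 ?mulr0 ?mul0r // mulrC.
Qed.

Lemma weights_tilt w x f z : weights w x ->
  \sum_J w J * tilt f z J = \sum_J w J * f J + dot z x.
Proof.
move=> hw; rewrite (weights_dot _ hw) -big_split /=.
by apply: eq_bigr => J _; rewrite -mulrDr.
Qed.

Lemma weights_xsum w x (A : {set 'I_n}) : weights w x -> xsum x A = \sum_J w J * #|J :&: A|%:R.
Proof.
move=> hw; rewrite /xsum; under eq_bigr do rewrite (weights_coord _ hw).
rewrite exchange_big /=; apply: eq_bigr => J _; rewrite -mulr_sumr; congr (_ * _).
rewrite -sum1_card natr_sum big_mkcond [RHS]big_mkcond; apply: eq_bigr => i _.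
by rewrite inE; case: (i \in A); case: (i \in J).
Qed.

Lemma weights_cube w x : weights w x -> cube x.
Proof.
move=> hw i; rewrite (weights_coord i hw); case: hw => w0 w1 _; apply/andP; split.
  by apply: sumr_ge0 => J _; rewrite mulr_ge0.
rewrite -[leRHS]w1; apply: ler_sum => J _.
by case: (i \in J); rewrite ?mulr1 ?mulr0.
Qed.

Lemma weights_le w x g (c : R) : weights w x -> (forall J, w J != 0 -> g J <= c) ->
  \sum_J w J * g J <= c.
Proof.
move=> [w0 w1 _] gc; rewrite -[c]mul1r -w1 mulr_suml; apply: ler_sum => J _.
by have [->|wJ] := eqVneq (w J) 0; rewrite ?mul0r // ler_wpM2l // gc.
Qed.

Lemma weights_eq w x g (c : R) : weights w x -> (forall J, w J != 0 -> g J = c) ->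
  \sum_J w J * g J = c.
Proof.
move=> [w0 w1 _] gc; rewrite -[c in RHS]mul1r -w1 mulr_suml; apply: eq_bigr => J _.
by have [->|wJ] := eqVneq (w J) 0; rewrite ?mul0r // gc.
Qed.

Lemma weights_max w x g (c : R) : weights w x -> (forall J, g J <= c) ->
  c <= \sum_J w J * g J -> forall J, w J != 0 -> g J = c.
Proof.
move=> [w0 w1 _] gc le J wJ; apply/eqP; rewrite eq_le gc leNgt; apply/negP => lt.
suff : \sum_J w J * g J < c by rewrite ltNge le.
rewrite -[c]mul1r -w1 mulr_suml (bigD1 J) //= [ltRHS](bigD1 J) //=; apply: ltr_leD.
  by rewrite ltr_pM2l // lt0r wJ w0.
by apply: ler_sum => K _; rewrite ler_wpM2l.
Qed.

Lemma weights_delta J : weights (fun K => (K == J)%:R) (eset R J).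
Proof.
split=> [K|| ]; first exact: ler0n.
  by rewrite (bigD1 J) //= eqxx big1 ?addr0 // => K /negbTE ->.
rewrite (bigD1 J) //= eqxx scale1r big1 ?addr0 // => K /negbTE ->.
by rewrite scale0r.
Qed.

Lemma weights_eset w J : weights w (eset R J) -> forall K, w K != 0 -> K = J.
Proof.
move=> hw K wK; apply/setP => i.
have := weights_coord i hw; rewrite eset_coord => e.
have [iJ|iJ] := boolP (i \in J); rewrite ?iJ ?(negbTE iJ) in e.
  have h (L : {set 'I_n}) : (i \in L)%:R <= 1 :> R by case: (i \in L).
  have := weights_max hw h; rewrite -e lexx => /(_ isT K wK).
  by case: (i \in K) => // /eqP; rewrite eq_sym oner_eq0.
have h (L : {set 'I_n}) : - (i \in L)%:R <= 0 :> R by case: (i \in L); rewrite ?oppr0 // oppr_le0.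
have := @weights_max _ _ (fun L : {set 'I_n} => - (i \in L)%:R) 0 hw h.
under eq_bigr do rewrite mulrN.
rewrite sumrN -e oppr0 lexx => /(_ isT K wK) /eqP.
by case: (i \in K) => //; rewrite oppr_eq0 oner_eq0.
Qed.

Lemma hull_eset M J : hull M (eset R J) <-> J \in M.
Proof.
split=> [[w hw hM]|hJ]; last first.
  exists (fun K => (K == J)%:R); first exact: weights_delta.
  by move=> K; have [->|//] := eqVneq K J; rewrite hJ.
have [_ w1 _] := hw; apply/negPn/negP => JM.
suff : \sum_J w J = 0 by rewrite w1 => /eqP; rewrite oner_eq0.
apply: big1 => K _; apply/eqP/negPn/negP => wK.
by have eK := weights_eset hw wK; move: wK; rewrite eK hM ?eqxx.
Qed.

Lemma hull_inj M M' : hull M = hull M' -> M = M'.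
Proof.
by move=> e; apply/setP => J; apply/idP/idP => /hull_eset; rewrite (e, esym e) => /hull_eset.
Qed.

Lemma hull_xsum M x (A : {set 'I_n}) (c : R) : hull M x ->
  (forall J, J \in M -> #|J :&: A|%:R <= c) -> xsum x A <= c.
Proof.
move=> [w hw hM] h; rewrite (weights_xsum _ hw); apply: weights_le hw _ => J wJ.
by apply: h; apply: contraR wJ => /hM ->.
Qed.

Lemma hull_xsum_ge M x (A : {set 'I_n}) (c : R) : hull M x ->
  (forall J, J \in M -> c <= #|J :&: A|%:R) -> c <= xsum x A.
Proof.
move=> [w hw hM] h; rewrite (weights_xsum _ hw) -[c]opprK lerNl -sumrN.
under eq_bigr do rewrite -mulrN; apply: weights_le hw _ => J wJ.
by rewrite lerN2; apply: h; apply: contraR wJ => /hM ->.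
Qed.

Definition psum x (k : nat) : R := \sum_(i < n | (i < k)%N) x 0 i.

Lemma psumS x (i : 'I_n) : psum x i.+1 = psum x i + x 0 i.
Proof.
rewrite /psum (bigD1 i) ?ltnSn //= addrC; congr (_ + _); apply: eq_bigl => j.
by rewrite -val_eqE ltnS /=; lia.
Qed.

(* With [psum x k = floor + frac], the sets are read off the integer heights
   [floor + 1_A] for the level sets [A] of the fractional parts: rounding
   preserves every difference constraint with an integral bound. *)
Lemma cube_rounding x : cube x -> exists w, [/\ weights w x,
  clique [set J | w J != 0]%SET &
  forall J, w J != 0 -> forall a b (c : int), (a <= n)%N -> (b <= n)%N ->
    psum x b - psum x a <= c%:~R -> ht J b - ht J a <= c].
Proof.
move=> hx; pose s := psum x.
pose fl k : int := Num.floor (s k); pose phi (k : 'I_n.+1) := s k - (fl k)%:~R.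
have sfl k : (fl k)%:~R <= s k < (fl k)%:~R + 1.
  by have /andP[h1 h2] := Num.Theory.floor_itv (s k); rewrite h1 /= -[1]/(1%:~R) -intrD.
have phi01 k : 0 <= phi k <= 1 by rewrite /phi; move: (sfl k); lra.
have [v [v0 vphi v1 vA]] := level_sets phi01 ler01.
(* The missing weight goes to the empty level set, that is, to the rounded-down heights: the total
   becomes 1 and the sums [phi] are unchanged. *)
pose v' A := v A + (if A == finset.set0 then 1 - \sum_C v C else 0).
have v'0 A : 0 <= v' A by rewrite addr_ge0 //; case: ifP => // _; rewrite subr_ge0.
have v'1 : \sum_A v' A = 1.
  by rewrite big_split /= -big_mkcond /= big_pred1_eq addrC subrK.
have v'phi k : \sum_(A : {set 'I_n.+1} | k \in A) v' A = phi k.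
  rewrite big_split /= vphi big1 ?addr0 // => A kA; case: eqP kA => // ->.
  by rewrite inE.
have v'A A : v' A != 0 -> exists2 t, 0 < t & forall k, (k \in A) = (t <= phi k).
  rewrite /v'; have [-> _|_] := eqVneq A finset.set0; last by rewrite addr0; exact: vA.
  by exists 1 => // k; rewrite inE /phi; move: (sfl k); lra.
pose p (A : {set 'I_n.+1}) (k : nat) : int := fl k + (inord k \in A)%:Z.
have phiE k : (k <= n)%N -> phi (inord k) = s k - (fl k)%:~R.
  by move=> kn; rewrite /phi inordK.
have pbound A a b (c : int) : v' A != 0 -> (a <= n)%N -> (b <= n)%N ->
    s b - s a <= c%:~R -> p A b - p A a <= c.
  move=> /v'A[t t0 hA] an bn sab; rewrite /p !hA !phiE //.
  have lt1 : fl b - fl a < c + 1.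
    by rewrite -(ltr_int R) intrB intrD; move: (sfl a) (sfl b) sab; clear; lra.
  have [eqc|neqc] := eqVneq (fl b - fl a) c; last first.
    by case: (t <= _); case: (t <= _) => /=; move: lt1 neqc; clear; lia.
  (* The integer parts differ by exactly [c] here, so the constraint bounds the fractional part at
     [b] by the one at [a]: a level set containing [b] contains [a]. *)
  suff : (t <= s b - (fl b)%:~R) ==> (t <= s a - (fl a)%:~R).
    by move: eqc; case: (t <= _); case: (t <= _) => //=; clear; lia.
  apply/implyP => tb; apply: le_trans tb _.
  by move: sab; rewrite -eqc intrB; clear; lra.
have sS (k : 'I_n) : s k.+1 - s k = x 0 k by rewrite /s psumS addrC addKr.
(* Being a height function is a system of difference constraints with bounds 1 and 0; points of the
   cube satisfy it, so rounding preserves it too. *)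
have hp A : v' A != 0 -> height n (p A).
  move=> vA0 k kn; have kn' := ltnW kn; pose i := Ordinal kn.
  have /andP[x0 x1] := hx i; have := sS i; rewrite /= => e.
  have h1 : p A k.+1 - p A k <= 1 by apply: pbound => //; rewrite e.
  have h2 : p A k - p A k.+1 <= 0 by apply: pbound => //; rewrite -opprB e oppr_le0.
  by move: h1 h2; clear; lia.
pose w J := \sum_(A | steps n (p A) == J) v' A.
have wA J : w J != 0 -> exists2 A, v' A != 0 & J = steps n (p A).
  move=> wJ; have [/existsP[A /andP[/eqP e vA0]]|] :=
    boolP [exists A, (steps n (p A) == J) && (v' A != 0)]; first by exists A.
  rewrite negb_exists => /forallP none; move: wJ; rewrite /w big1 ?eqxx // => A e.
  by have := none A; rewrite e /= negbK => /eqP.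
have wsum (V : lmodType R) (h : {set 'I_n} -> V) :
    \sum_J w J *: h J = \sum_A v' A *: h (steps n (p A)).
  rewrite (partition_big (fun A => steps n (p A)) predT) //=.
  apply: eq_bigr => J _; rewrite /w scaler_suml; apply: eq_bigr => A /eqP e.
  by rewrite e.
exists w; split.
- split.
  + by move=> J; apply: sumr_ge0.
  + have := wsum R^o (fun=> 1); rewrite /GRing.scale /=.
    by under eq_bigr do rewrite mulr1; under [X in _ = X]eq_bigr do rewrite mulr1; rewrite v'1.
  rewrite wsum; apply/rowP => i; rewrite summxE.
  transitivity (\sum_A v' A * (p A i.+1 - p A i)%:~R).
    apply: eq_bigr => A _; rewrite !mxE; have [->|vA0] := eqVneq (v' A) 0;
      first by rewrite !mul0r.
    by rewrite (height_step i (hp A vA0)) addrC addKr; case: (_ \in _).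
  rewrite -sS; transitivity (\sum_A (v' A * (fl i.+1 - fl i)%:~R
      + ((if inord i.+1 \in A then v' A else 0) - (if inord i \in A then v' A else 0)))).
    apply: eq_bigr => A _; rewrite /p.
    case: (inord i.+1 \in A); case: (inord i \in A);
      rewrite /= ?subr0 ?sub0r ?subrr ?addr0 ?intrB ?intrD //; ring.
  have in1 : (i <= n)%N by rewrite ltnW.
  have in2 : (i.+1 <= n)%N by [].
  rewrite big_split /= -mulr_suml v'1 mul1r sumrB -!big_mkcond /= !v'phi !phiE // intrB.
  ring.
- apply/cliqueP => J K; rewrite !inE => /wA[A vA0 ->] /wA[B vB0 ->].
  have [t1 _ hA] := v'A _ vA0; have [t2 _ hB] := v'A _ vB0.
  apply/interleavedP => a b an bn.
  have := height_eq (hp A vA0) an; have := height_eq (hp A vA0) bn.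
  have := height_eq (hp B vB0) an; have := height_eq (hp B vB0) bn.
  rewrite /p !hA !hB.
  have [t12|t21] := leP t1 t2.
    have im k : (t2 <= phi k) ==> (t1 <= phi k) by apply/implyP; exact: le_trans.
    move: (im (inord a)) (im (inord b)).
    by do 4 case: (_ <= phi _) => //=; clear; lia.
  have im k : (t1 <= phi k) ==> (t2 <= phi k) by apply/implyP; apply: le_trans; exact: ltW.
  move: (im (inord a)) (im (inord b)).
  by do 4 case: (_ <= phi _) => //=; clear; lia.
move=> J /wA[A vA0 ->] a b c an bn sab.
have := pbound A a b c vA0 an bn sab.
by rewrite (height_eq (hp A vA0) an) (height_eq (hp A vA0) bn); clear; lia.
Qed.

End Hulls.

(** * Optimal weights for the concave extension *)

Section Extension.
Variables (R : realType) (n : nat).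
Implicit Types (f : setfun R n) (z : 'I_n -> R) (x : 'rV[R]_n) (J K : {set 'I_n}).
Implicit Types (M : {set {set 'I_n}}) (w : {set 'I_n} -> R).

Lemma continuous_sum (T : topologicalType) (I : finType) (g : I -> T -> R) :
  (forall i, continuous (g i)) -> continuous (fun t => \sum_i g i t).
Proof.
move=> cg; apply: (@continuous_big R I +%R 0 predT) => [|i _]; last exact: cg.
exact: add_continuous.
Qed.

Lemma optimal_weights f x : cube x -> exists2 w, weights w x &
  forall w', weights w' x -> \sum_J w' J * f J <= \sum_J w J * f J.
Proof.
move=> hx; pose T := 'rV[R]_#|{set 'I_n}|.
pose wt (u : T) J := u 0 (enum_rank J).
pose uw w : T := \row_i w (enum_val i).
have wtK w J : wt (uw w) J = w J by rewrite /wt mxE enum_rankK.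
pose lin (c : {set 'I_n} -> R) (u : T) := \sum_J wt u J * c J.
have lin_cont c : continuous (lin c).
  apply: continuous_sum => J u; apply: continuousM;
    [exact: coord_continuous|exact: cst_continuous].
pose box := [set u : T | forall i, `[0, 1]%classic (u ord0 i)]%classic.
have cbox : compact box.
  exact: (@rV_compact R _ (fun=> `[0 : R, 1]%classic) (fun=> @segment_compact R 0 1)).
pose W := (box `&` ([set u | lin (fun=> 1) u = 1] `&`
   \bigcap_(i in [set: 'I_n]) [set u | lin (fun J => (i \in J)%:R) u = x 0 i]))%classic.
have clin c (a : R) : closed [set u | lin c u = a]%classic.
  apply: (@preimage_closed _ _ (lin c) [set a]%classic); last exact: closed_eq.
  by move=> u _; exact: lin_cont.
have cW : compact W.
  apply: compact_closedI => //; apply: closedI; first exact: clin.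
  by apply: closed_bigI => i _; exact: clin.
have inW w : weights w x -> W (uw w).
  move=> hw; have [w0 w1 _] := hw; split; last split.
  - move=> i; rewrite /= in_itv /= mxE w0 /= -w1 (bigD1 (enum_val i)) //= lerDl.
    exact: sumr_ge0.
  - by rewrite /= /lin -[RHS]w1; apply: eq_bigr => J _; rewrite wtK mulr1.
  - move=> i _; rewrite /= (weights_coord i hw); apply: eq_bigr => J _.
    by rewrite wtK.
have outW u : W u -> weights (wt u) x.
  move=> [ub [u1 ux]]; split=> [J||].
  - by have := ub (enum_rank J); rewrite /= in_itv /= => /andP[].
  - by rewrite -[RHS]u1; apply: eq_bigr => J _; rewrite mulr1.
  - apply/rowP => i; rewrite -(ux i I) summxE /lin; apply: eq_bigr => J _.
    by rewrite !mxE.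
have [w0 [hw0 _ _]] := cube_rounding hx.
have [||c cW' cmax] := @compact_EVT_max _ R (lin f) W _ cW.
- by exists (uw w0); exact: inW.
- exact/continuous_subspaceT/lin_cont.
exists (wt c); first by apply: outW; rewrite inE in cW'.
move=> w' hw'; have := cmax (uw w'); rewrite inE => /(_ (inW _ hw')).
by rewrite /lin; under eq_bigr do rewrite wtK.
Qed.

Lemma fhat_max f x w : weights w x ->
  (forall w', weights w' x -> \sum_J w' J * f J <= \sum_J w J * f J) ->
  fhat f x = \sum_J w J * f J.
Proof.
move=> hw mx; rewrite /fhat; set S := (X in sup X).
have Sw : S (\sum_J w J * f J) by exists w; case: hw.
have ubS : ubound S (\sum_J w J * f J).
  by move=> _ [w' [h1 h2 h3 ->]]; apply: mx.
apply/eqP; rewrite eq_le; apply/andP; split.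
  by apply: ge_sup => //; exists (\sum_J w J * f J).
by apply: ub_le_sup => //; exists (\sum_J w J * f J).
Qed.

Lemma fhat_attained f x : cube x -> exists2 w, weights w x & fhat f x = \sum_J w J * f J.
Proof. by move=> /(optimal_weights f)[w hw mx]; exists w => //; exact: fhat_max. Qed.

Lemma fhat_ge f x w : weights w x -> \sum_J w J * f J <= fhat f x.
Proof.
move=> hw; have [w1 hw1 mx] := optimal_weights f (weights_cube hw).
by rewrite (fhat_max hw1 mx) mx.
Qed.

Lemma fhat_tilt_le f z x J : cube x -> J \in cell f z -> fhat f x + dot z x <= tilt f z J.
Proof.
move=> hx /cellP hJ; have [w hw ->] := fhat_attained f hx.
by rewrite -(weights_tilt _ _ hw); apply: weights_le hw _ => K _.
Qed.

(** Complementary slackness: optimal weights reach the bound given by the maximal tilt exactly when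
    they charge only sets attaining it. *)
Lemma hull_cellP f z x J : J \in cell f z ->
  hull (cell f z) x <-> cube x /\ fhat f x + dot z x = tilt f z J.
Proof.
move=> hJ; split=> [[w hw hM]|[hx e]].
  split; first exact: weights_cube hw.
  apply/eqP; rewrite eq_le fhat_tilt_le //=; last exact: weights_cube hw.
  rewrite -(@weights_eq _ _ w x (tilt f z) (tilt f z J) hw); last first.
    by move=> K wK; apply: cell_eq => //; apply: contraR wK => /hM ->.
  by rewrite (weights_tilt _ _ hw) lerD2r; exact: fhat_ge.
have [w hw ef] := fhat_attained f hx; exists w => // K.
apply: contraNeq => wK; apply: (cell_of_eq hJ).
apply: (weights_max hw) wK; first exact/cellP.
by rewrite (weights_tilt _ _ hw) -ef e.
Qed.

End Extension.

Section Domains.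
Variables (R : realType) (n : nat).
Implicit Types (f : setfun R n) (z d : 'I_n -> R) (x y : 'rV[R]_n) (J K : {set 'I_n}).
Implicit Types (M : {set {set 'I_n}}) (w : {set 'I_n} -> R).

Lemma scalarE (g : 'rV[R]_n -> R) :
  (forall a x y, g (a *: x + y) = a * g x + g y) ->
  forall x, g x = dot (fun i => g (delta_mx 0 i)) x.
Proof.
move=> hg; have g0 : g 0 = 0.
  by have := hg 1 0 0; rewrite scaler0 addr0 mul1r => /eqP;
    rewrite -subr_eq0 opprD addNKr oppr_eq0 => /eqP.
move=> x; rewrite {1}[x]row_sum_delta /dot.
elim/big_rec2: _ => [//|i a b _ <-]; by rewrite hg mulrC.
Qed.

Lemma dotD z a x y : dot z (a *: x + y) = a * dot z x + dot z y.
Proof.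
by rewrite /dot mulr_sumr -big_split /=; apply: eq_bigr => i _; rewrite !mxE; ring.
Qed.

Lemma dot_eset z J : dot z (eset R J) = \sum_(i in J) z i.
Proof.
rewrite /dot [RHS]big_mkcond; apply: eq_bigr => i _; rewrite mxE.
by case: (i \in J); rewrite ?mulr1 ?mulr0.
Qed.

Lemma face_hypograph f z (c : R) (l : 'rV[R]_n * R^o -> R) : 0 < c ->
  (forall p, l p = c * (dot z p.1 + p.2)) ->
  let F := [set p | hypograph f p /\ forall q, hypograph f q -> l q <= l p]%classic in
  [/\ (F !=set0)%classic, (F `<=` upper_envelope f)%classic &
      (fst @` F)%classic = hull (cell f z)].
Proof.
move=> c0 lE F; have [J hJ] := cell_neq0 f z; pose m := tilt f z J.
have le p : hypograph f p -> dot z p.1 + p.2 <= m.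
  move=> [hp1 hp2]; apply: le_trans (fhat_tilt_le hp1 hJ).
  by rewrite addrC lerD2r.
have [hJc hJe] : cube (eset R J) /\ fhat f (eset R J) + dot z (eset R J) = m.
  by apply/(hull_cellP (eset R J) hJ)/hull_eset.
have inF x : cube x -> fhat f x + dot z x = m -> F (x, fhat f x).
  move=> hx e; split; first by split.
  by move=> q hq; rewrite !lE ler_pM2l //= [leRHS]addrC e le.
have Fin p : F p -> cube p.1 /\ dot z p.1 + p.2 = m.
  move=> [hp mx]; split; first by case: hp.
  apply/eqP; rewrite eq_le le //=; have := mx (eset R J, fhat f (eset R J)).
  by rewrite !lE ler_pM2l //= [X in X <= _]addrC hJe; apply; split.
split.
- by exists (eset R J, fhat f (eset R J)); exact: inF.
- move=> p Fp; have [hp1 e] := Fin p Fp; split=> //; have [[_ le1] _] := Fp.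
  by have := fhat_tilt_le hp1 hJ; move: e le1; rewrite -/m; lra.
- apply/seteqP; split=> [_ [p Fp <-]|x /(hull_cellP _ hJ)[hx e]].
    have [hp1 e] := Fin p Fp; apply/(hull_cellP _ hJ); split=> //.
    have [[_ le1] _] := Fp; have := fhat_tilt_le hp1 hJ; rewrite -/m; move: e le1; lra.
  by exists (x, fhat f x) => //; exact: inF.
Qed.

Definition lift_form z (p : 'rV[R]_n * R^o) : R := dot z p.1 + p.2.

Lemma lift_form_linear z : linear_for *%R (lift_form z).
Proof. by move=> a p q; rewrite /lift_form /= dotD /GRing.scale /=; ring. Qed.

HB.instance Definition _ z := GRing.isLinear.Build R ('rV[R]_n * R^o)%type R *%R
  (lift_form z) (lift_form_linear z).

Lemma dot_linear z : linear_for *%R (dot z).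
Proof. by move=> a x y; rewrite dotD. Qed.

HB.instance Definition _ z := GRing.isLinear.Build R 'rV[R]_n R *%R (dot z) (dot_linear z).

Lemma domain_cell f D : domain_of_affinity f D <-> exists z, D = hull (cell f z).
Proof.
split=> [[F [[[p0 Fp0] [l FE]] Fup ->]]|[z ->]]; last first.
  have [|h1 h2 h3] := @face_hypograph f z 1 (lift_form z) ltr01.
    by move=> p; rewrite mul1r.
  eexists; split; [split; [exact: h1|by exists (lift_form z)]|exact: h2|by rewrite -h3].
pose c := l (0, 1).
pose g x := l (x, 0).
have gl a x y : g (a *: x + y) = a * g x + g y.
  by rewrite /g -linearP /=; congr (l (_, _)); rewrite /= scaler0 addr0.
have lE p : l p = dot (fun i => g (delta_mx 0 i)) p.1 + c * p.2.
  case: p => x t /=; rewrite -(scalarE gl) /g /c mulrC -[t * _]/(t *: l (0, 1)).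
  have -> : (x, t) = (t *: (0, 1) + (x, 0)) :> 'rV[R]_n * R^o.
    by congr (_, _); rewrite /= ?scaler0 ?add0r // addr0 /GRing.scale /= mulr1.
  by rewrite linearP addrC.
have [hp0 e0] := Fup _ Fp0.
have [_ mx0] : hypograph f p0 /\ forall q, hypograph f q -> l q <= l p0 by rewrite FE in Fp0.
(* The point one unit below [p0] is in the hypograph, so [c] is nonnegative; were it 0, that point
   would maximise [l] too and lie in [F], off the graph. *)
pose p1 : 'rV[R]_n * R^o := (p0.1, p0.2 - 1).
have hp1 : hypograph f p1 by split=> //=; rewrite e0 gerBl.
have c_gt0 : 0 < c.
  have := mx0 p1 hp1; rewrite !lE /= lerD2l mulrBr mulr1 gerBl le0r => /orP[/eqP c0|//].
  suff /Fup[_ /=] : F p1 by move: e0; lra.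
  by rewrite FE; split=> // q /mx0; rewrite !lE c0 !mul0r.
have [|h1 h2 h3] := @face_hypograph f (fun i => g (delta_mx 0 i) / c) c l c_gt0.
  move=> p; rewrite lE mulrDr; congr (_ + _); rewrite /dot mulr_sumr.
  by apply: eq_bigr => i _; rewrite mulrA [c * _]mulrC divfK // gt_eqF.
by exists (fun i => g (delta_mx 0 i) / c); rewrite -h3 FE.
Qed.
End Domains.

(** * The polyhedral subdivision induced by [f] *)

Section Subdivisions.
Variables (R : realType) (n : nat).
Implicit Types (f : setfun R n) (z d : 'I_n -> R) (x y : 'rV[R]_n) (J K : {set 'I_n}).
Implicit Types (M : {set {set 'I_n}}) (w : {set 'I_n} -> R).

Lemma hull_face M d (c : R) : (exists2 J, J \in M & \sum_(i in J) d i = c) ->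
  (forall J, J \in M -> \sum_(i in J) d i <= c) ->
  hull [set J in M | \sum_(i in J) d i == c]%SET =
  [set x | hull M x /\ forall y, hull M y -> dot d y <= dot d x]%classic :> set 'rV[R]_n.
Proof.
move=> [J0 hJ0 eJ0] le.
have ub y : hull M y -> dot d y <= c.
  move=> [w hw hM]; rewrite (weights_dot _ hw); apply: weights_le hw _ => J wJ.
  by apply: le; apply: contraR wJ => /hM ->.
apply/seteqP; split=> x.
  move=> [w hw hM]; have hx : hull M x.
    by exists w => // J JM; apply: hM; rewrite inE (negbTE JM).
  split=> // y /ub /le_trans; apply.
  rewrite (weights_dot _ hw) (weights_eq (c := c) hw) // => J wJ.
  apply/eqP; apply: contraR wJ => h; apply/eqP; apply: hM.
  by rewrite inE negb_and h orbT.
move=> [[w hw hM] mx]; exists w => // J; rewrite inE negb_and => h.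
apply/eqP; apply: contraLR h => wJ; rewrite negb_or !negbK.
have JM : J \in M by apply: contraR wJ => /hM ->.
rewrite JM /=; apply/eqP.
pose g K := if K \in M then \sum_(i in K) d i else c.
have gc K : g K <= c by rewrite /g; case: ifP => // /le.
have := weights_max (g := g) hw gc; rewrite /g => /(_ _ J wJ); rewrite JM; apply.
rewrite -eJ0 -dot_eset; apply: le_trans (mx _ ((hull_eset R M J0).2 hJ0)) _.
rewrite (weights_dot _ hw); apply: ler_sum => K _; case: ifP => // /negbT /hM ->.
by rewrite !mul0r.
Qed.

Lemma face_hull_cell f z (F : set 'rV[R]_n) : face (hull (cell f z)) F ->
  exists z', F = hull (cell f z').
Proof.
move=> [_ [l ->]]; pose d i := l (delta_mx 0 i).
have lE x : l x = dot d x by rewrite -(scalarE (g := l)) // => a u v; rewrite linearP.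
have [e e0 he] := cell_perturb f z d; exists (fun i => z i + e * d i).
have [J0 hJ0] := cell_neq0 f z.
pose J1 := [arg max_(J > J0 in cell f z) \sum_(i in J) d i]%O.
have [h1 max1] : J1 \in cell f z /\
    forall K, K \in cell f z -> \sum_(i in K) d i <= \sum_(i in J1) d i.
  by rewrite /J1; case: arg_maxP.
rewrite he.
have -> : [set J in cell f z | [forall K in cell f z,
    \sum_(i in K) d i <= \sum_(i in J) d i]]%SET =
  [set J in cell f z | \sum_(i in J) d i == \sum_(i in J1) d i]%SET.
  apply/setP => J; rewrite !finset.in_set; apply: andb_id2l => /forallP cJ.
  have hJ : J \in cell f z by apply/cellP.
  apply/forallP/eqP => [mx|-> K]; last by apply/implyP; exact: max1.
  by apply/eqP; rewrite eq_le max1 //=; exact: (implyP (mx J1)).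
rewrite hull_face //; last by exists J1.
by apply/seteqP; split=> x [hx mx]; split=> // y hy; move: (mx y hy); rewrite !lE.
Qed.

Lemma hull_polytope M : polytope (hull M : set 'rV[R]_n).
Proof.
exists #|M|, (fun i => eset R (enum_val i)); apply/seteqP; split=> x.
  move=> [w [w0 w1 <-] hM]; exists (fun i => w (enum_val i)); split=> [//||].
  - rewrite -w1 [RHS](bigID (mem M)) /= [X in _ = _ + X]big1 ?addr0; last by move=> J /hM.
    by rewrite (big_enum_val w).
  rewrite (bigID (mem M)) /= [X in _ + X = _]big1 ?addr0; last by move=> J /hM ->;
    rewrite scale0r.
  by rewrite (big_enum_val (fun J => w J *: eset R J)).
move=> [w [w0 w1 ->]]; exists (fun J => \sum_(i | enum_val i == J) w i).
  split=> [J||]; first exact: sumr_ge0.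
  - by rewrite -w1 [RHS](partition_big (@enum_val _ (mem M)) predT).
  rewrite [RHS](partition_big (@enum_val _ (mem M)) predT) //=.
  by apply: eq_bigr => J _; rewrite scaler_suml; apply: eq_bigr => i /eqP ->.
move=> J hJ; apply: big1 => i /eqP e; by move: hJ; rewrite -e enum_valP.
Qed.

(** On [P] the form [z' - z] is at most the difference of the two maximal tilts, because [fhat]
    cancels; equality means lying in [P'] too. *)
Lemma hull_cell_face f z z' (P := hull (cell f z) : set 'rV[R]_n)
    (P' := hull (cell f z') : set 'rV[R]_n) :
  (P `&` P' !=set0)%classic -> face P (P `&` P')%classic.
Proof.
move=> ne; split=> //; have [J hJ] := cell_neq0 f z; have [J' hJ'] := cell_neq0 f z'.
exists (dot (fun i => z' i - z i)).
have dB x : dot (fun i => z' i - z i) x = dot z' x - dot z x.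
  by rewrite /dot -sumrB; apply: eq_bigr => i _; rewrite mulrBl.
have le y : hull (cell f z) y -> dot (fun i => z' i - z i) y <= tilt f z' J' - tilt f z J.
  move=> /(hull_cellP _ hJ)[hy <-]; have := fhat_tilt_le hy hJ'; rewrite dB; lra.
have eq y : hull (cell f z) y -> hull (cell f z') y <->
    dot (fun i => z' i - z i) y = tilt f z' J' - tilt f z J.
  move=> /(hull_cellP _ hJ)[hy e]; split=> [/(hull_cellP _ hJ')[_ e']|e'].
    by move: e e'; rewrite dB; lra.
  by apply/(hull_cellP _ hJ'); split=> //; move: e e'; rewrite dB; lra.
have [x0 [h0 h0']] := ne.
apply/seteqP; split=> x [hx h]; split=> //.
  by move=> y hy; apply: le_trans (le y hy) _; rewrite -((eq x hx).1 h); exact: lexx.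
apply/(eq x hx); apply/eqP; rewrite eq_le le //= -((eq x0 h0).1 h0').
exact: h.
Qed.

Lemma induced_cells f :
  induced_subdivision f = [set (hull (cell f z) : set 'rV[R]_n) | z in setT]%classic.
Proof.
apply/seteqP; split=> [D /domain_cell[z ->]|_ [z _ <-]]; first by exists z.
by apply/domain_cell; exists z.
Qed.

Lemma induced_polyhedral f : local_dctp f ->
  polyhedral_subdivision (@cube R n) (induced_subdivision f).
Proof.
move=> hf; rewrite induced_cells; split.
- apply: (@sub_finite_set _ _ (@hull R n @` [set: {set {set 'I_n}}])%classic).
    by move=> _ [z _ <-]; exists (cell f z).
  exact/finite_image/finite_finset.
- move=> _ [z _ <-]; split; first exact: hull_polytope.
  by have [J hJ] := cell_neq0 f z; exists (eset R J); apply/hull_eset.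
- apply/seteqP; split=> [x [_ [z _ <-]] [w hw _]|x hx]; first exact: weights_cube hw.
  have [w [hw cl _]] := cube_rounding hx.
  have [z /fintype.subsetP sub] := clique_cell (local_dctp_Lconcave hf) cl.
  exists (hull (cell f z)); first by exists z.
  exists w => // J hJ; apply/eqP; apply: contraR hJ => wJ; apply: sub.
  by rewrite inE.
- by move=> _ F [z _ <-] /face_hull_cell[z' ->]; exists z'.
move=> _ _ [z _ <-] [z' _ <-] ne; split; first exact: hull_cell_face.
by rewrite classical_sets.setIC; apply: hull_cell_face; rewrite classical_sets.setIC.
Qed.

End Subdivisions.

(** * Cells are g-positroids *)

Section GPPCells.
Variables (R : realType) (n : nat).
Implicit Types (f : setfun R n) (z : 'I_n -> R) (x : 'rV[R]_n) (A J K : {set 'I_n}).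
Implicit Types (M : {set {set 'I_n}}).

Lemma card_setU_setI (T : finType) (J A B : {set T}) :
  (#|J :&: (A :|: B)| + #|J :&: (A :&: B)| = #|J :&: A| + #|J :&: B|)%N.
Proof.
by rewrite finset.setIUr finset.setIIr cardsUI.
Qed.

Lemma ht_itv K (a b : 'I_n) : (a <= b)%N -> ht K b.+1 - ht K a = #|K :&: itvset a b|%:Z.
Proof.
move=> ab; transitivity (\sum_(i in K :&: itvset a b) (1 : int)); last first.
  by rewrite sumr_const natz.
rewrite /ht (bigID (fun i : 'I_n => (i < a)%N)) /=.
rewrite (eq_bigl (fun i => (i \in K) && (i < a)%N)); last first.
  by move=> i; rewrite ltnS; case: (i \in K) => //=; lia.
rewrite addrC addrK; apply: eq_bigl => i.
by rewrite !inE ltnS -leqNgt; case: (i \in K) => //=; lia.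
Qed.

Lemma psum_itv x (a b : 'I_n) : (a <= b)%N -> psum x b.+1 - psum x a = xsum x (itvset a b).
Proof.
move=> ab; rewrite /psum (bigID (fun i : 'I_n => (i < a)%N)) /=.
rewrite (eq_bigl (fun i : 'I_n => (i < a)%N)); last by move=> i; rewrite ltnS; lia.
rewrite addrC addrK; apply: eq_bigl => i.
by rewrite !inE ltnS -leqNgt andbC.
Qed.

(* Support functions of the hull of [M]; the default is reached only if [M] is
   empty. *)
Definition upper M : setfun R n :=
  fun A => (#|[arg max_(J > odflt finset.set0 [pick J in M] in M) #|J :&: A|]%N :&: A|)%:R.
Definition lower M : setfun R n :=
  fun A => (#|[arg min_(J < odflt finset.set0 [pick J in M] in M) #|J :&: A|]%N :&: A|)%:R.

Lemma upperP M A : M != finset.set0 -> (exists2 J, J \in M & upper M A = #|J :&: A|%:R) /\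
  forall J, J \in M -> #|J :&: A|%:R <= upper M A.
Proof.
move=> /finset.set0Pn[J0 hJ0]; rewrite /upper; case: pickP => [J1 hJ1|/(_ J0)];
  last by rewrite hJ0.
by case: arg_maxnP => //= J hJ mx; split; [exists J|move=> K /mx; rewrite ler_nat].
Qed.

Lemma lowerP M A : M != finset.set0 -> (exists2 J, J \in M & lower M A = #|J :&: A|%:R) /\
  forall J, J \in M -> lower M A <= #|J :&: A|%:R.
Proof.
move=> /finset.set0Pn[J0 hJ0]; rewrite /lower; case: pickP => [J1 hJ1|/(_ J0)];
  last by rewrite hJ0.
by case: arg_minnP => //= J hJ mx; split; [exists J|move=> K /mx; rewrite ler_nat].
Qed.

Lemma cell_set0n f z : cell f z != finset.set0.
Proof. by have [J hJ] := cell_neq0 f z; apply/finset.set0Pn; exists J. Qed.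

Lemma upper_eq M A J : J \in M -> (forall K, K \in M -> (#|K :&: A| <= #|J :&: A|)%N) ->
  upper M A = #|J :&: A|%:R.
Proof.
move=> hJ mx; have M0 : M != finset.set0 by apply/finset.set0Pn; exists J.
have [[K hK e] ub] := upperP A M0.
by apply/eqP; rewrite eq_le ub // e ler_nat mx.
Qed.

Lemma lower_eq M A J : J \in M -> (forall K, K \in M -> (#|J :&: A| <= #|K :&: A|)%N) ->
  lower M A = #|J :&: A|%:R.
Proof.
move=> hJ mn; have M0 : M != finset.set0 by apply/finset.set0Pn; exists J.
have [[K hK e] lb] := lowerP A M0.
by apply/eqP; rewrite eq_le lb // e ler_nat mn.
Qed.

(** Each inequality comes from one member [J] extremal for two sets at once: two of the terms are
    counted on [J], the other two are bounded by it, and cardinalities on [J] are modular. *)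
Lemma strong_pair_cell f z : local_dctp f -> strong_pair (upper (cell f z)) (lower (cell f z)).
Proof.
move=> hf; set M := cell f z; have M0 : M != finset.set0 := cell_set0n f z.
have U A := (upperP A M0).2; have L A := (lowerP A M0).2.
have [J0 hJ0] := finset.set0Pn _ M0.
have c0 J : #|J :&: finset.set0| = 0%N by rewrite finset.setI0 cards0.
split.
- split; first by rewrite (@upper_eq _ _ J0) // => [|K _]; rewrite ?c0.
  by rewrite (@lower_eq _ _ J0) // => [|K _]; rewrite ?c0.
- by move=> A; apply: le_trans (L A J0 hJ0) (U A J0 hJ0).
- move=> A B; have [|J hJ mx] := @cell_max_max _ _ f z (A :&: B)%SET (A :|: B)%SET hf.
    exact: fintype.subset_trans (finset.subsetIl A B) (finset.subsetUl A B).
  rewrite (upper_eq hJ (fun K hK => (mx K hK).2)) (upper_eq hJ (fun K hK => (mx K hK).1)).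
  by rewrite -natrD card_setU_setI natrD lerD ?U.
- move=> A B; have [|J hJ mn] := @cell_min_min _ _ f z (A :&: B)%SET (A :|: B)%SET hf.
    exact: fintype.subset_trans (finset.subsetIl A B) (finset.subsetUl A B).
  rewrite (lower_eq hJ (fun K hK => (mn K hK).2)) (lower_eq hJ (fun K hK => (mn K hK).1)).
  by rewrite -[leRHS]natrD card_setU_setI natrD lerD ?L.
move=> A B; have [|J hJ mm] := @cell_max_min _ _ f z (B :\: A)%SET (A :\: B)%SET hf.
  rewrite disjoint_subset; apply/fintype.subsetP => i; rewrite !inE.
  by case: (i \in A); rewrite //= andbF.
rewrite (upper_eq hJ (fun K hK => (mm K hK).1)) (lower_eq hJ (fun K hK => (mm K hK).2)).
have := U B J hJ; have := L A J hJ.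
have cD (C D : {set 'I_n}) : #|J :&: C|%:R = #|J :&: (C :&: D)|%:R + #|J :&: (C :\: D)|%:R :> R.
  by rewrite -natrD -(cardsID D (J :&: C)) finset.setIA finset.setIDA.
by rewrite (cD B A) (cD A B) (finset.setIC B A); lra.
Qed.

Lemma hull_Qpoly M : M != finset.set0 ->
  (hull M `<=` Qpoly (upper M) (lower M))%classic.
Proof.
move=> M0 x hx A; have U := (upperP A M0).2; have L := (lowerP A M0).2.
by rewrite (hull_xsum_ge hx L) (hull_xsum hx U).
Qed.

Lemma Qpoly_Qinterval (f g : setfun R n) : (Qpoly f g `<=` Qinterval f g)%classic.
Proof. by move=> x hx a b _; exact: hx. Qed.

(** The interval bounds are integral bounds on differences of partial sums, so every set used in
    rounding [x] satisfies them. A member of [M] attaining the bound is the witness for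
    [Lclosed_mem]: a maximiser for [a < b], a minimiser for [b < a]. *)
Lemma Qinterval_hull M : M != finset.set0 -> Lclosed M ->
  (Qinterval (upper M) (lower M) `<=` hull M)%classic.
Proof.
move=> M0 LM x hx.
have itv1 i : itvset i i = [set i]%SET.
  by apply/setP => j; rewrite !inE -val_eqE /=; lia.
have xcube : cube x.
  move=> i; have := hx i i (leqnn _).
  have [[J hJ eJ] _] := upperP (itvset i i) M0; have [[K hK eK] _] := lowerP (itvset i i) M0.
  rewrite eJ eK /xsum itv1 big_set1 => /andP[h1 h2].
  rewrite (le_trans _ h1) ?ler0n //= (le_trans h2) //.
  by rewrite -[leRHS]/(1%:R) ler_nat -(cards1 i) subset_leq_card // finset.subsetIr.
have [w [hw _ hJ]] := cube_rounding xcube.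
exists w => // J; apply: contraNeq => /hJ {}hJ; apply: Lclosed_mem LM _ => a b an bn.
have [ab|ba|e] := ltngtP a b.
- case: b bn ab => // b bn; rewrite ltnS => ab.
  pose i := Ordinal (leq_ltn_trans ab bn); pose j := Ordinal bn.
  have ij : (i <= j)%N by [].
  have [[K hK eK] _] := upperP (itvset i j) M0.
  exists (ht K); split; [exact: ht_height|by rewrite steps_ht|].
  apply: hJ => //; rewrite (@psum_itv x i j ij) (@ht_itv K i j ij).
  by have /andP[_] := hx i j ij; rewrite eK.
- case: a an ba => // a an; rewrite ltnS => ba.
  pose i := Ordinal (leq_ltn_trans ba an); pose j := Ordinal an.
  have ij : (i <= j)%N by [].
  have [[K hK eK] _] := lowerP (itvset i j) M0.
  exists (ht K); split; [exact: ht_height|by rewrite steps_ht|].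
  apply: hJ => //; rewrite -opprB (@psum_itv x i j ij) -[ht K b - _]opprB (@ht_itv K i j ij).
  by rewrite intrN lerN2; have /andP[] := hx i j ij; rewrite eK.
have [J0 hJ0] := finset.set0Pn _ M0; exists (ht J0); split.
- exact: ht_height.
- by rewrite steps_ht.
by rewrite e !subrr.
Qed.

Lemma GPP_cell f z : local_dctp f -> GPP (hull (cell f z) : set 'rV[R]_n).
Proof.
move=> hf; have M0 := cell_set0n f z; have LM := @Lclosed_cell _ _ f z (local_dctp_Lconcave hf).
have HQ := hull_Qpoly M0; have QI := @Qpoly_Qinterval (upper (cell f z)) (lower (cell f z)).
have IH := Qinterval_hull M0 LM.
exists (upper (cell f z)), (lower (cell f z)); split; first exact: strong_pair_cell.
- by apply/seteqP; split=> // x /QI /IH.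
- by apply/seteqP; split=> // x /IH /HQ.
Qed.

Lemma g_positroid_cell f z : local_dctp f -> g_positroid (hull (cell f z) : set 'rV[R]_n).
Proof.
move=> hf; have G := GPP_cell z hf; split=> //; split.
  by have [F [F' [h1 h2 h3]]] := G; exists F, F'.
move=> x /face_hull_cell[z' e] i.
have [J hJ] := cell_neq0 f z'.
have : [set x]%classic (eset R J) by rewrite e; apply/hull_eset.
by move=> /= <-; rewrite eset_coord; case: (_ \in _); [right|left].
Qed.

End GPPCells.

(** * Recognizing DCTP functions from their cells *)

Section BoxCells.
Variables (R : realFieldType) (n : nat).
Implicit Types (f : {set 'I_n} -> R) (z u : 'I_n -> R) (J K X Y : {set 'I_n}) (i j k : 'I_n).

(* Large weights of the right sign on [X] and off [Y] confine a cell to the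
   interval [X, Y]. *)
Lemma box_cell f X Y u : X \subset Y -> exists z, forall J,
  J \in cell f z <-> [/\ X \subset J, J \subset Y &
    forall K, X \subset K -> K \subset Y ->
      f K + \sum_(i in (K :\: X)%SET) u i <= f J + \sum_(i in (J :\: X)%SET) u i].
Proof.
move=> XY; pose N := 1 + 2 * \sum_K `|f K|.
have Nf J K : f J - f K < N.
  have b L : `|f L| <= \sum_K `|f K| by rewrite (bigD1 L) //= lerDl sumr_ge0.
  have := b J; have := b K; have := ler_norm (f J); have := ler_norm (- f K).
  by rewrite normrN /N; lra.
have N0 : 0 <= N by rewrite addr_ge0 // mulr_ge0 // sumr_ge0.
pose z i := if i \in X then N else if i \in Y then u i else - N.
pose cl J := (J :&: Y :|: X)%SET.
have Xcl J : X \subset cl J by exact: finset.subsetUr.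
have clY J : cl J \subset Y by rewrite finset.subUset XY finset.subsetIr.
have far J : J != cl J -> tilt f z J < tilt f z (cl J).
  move=> neJ; pose t i := (if i \in cl J then z i else 0) - (if i \in J then z i else 0).
  have t0 i : 0 <= t i.
    rewrite /t /z !inE; case: (boolP (i \in X)) => iX.
      by rewrite orbT; case: (i \in J); lra.
    by rewrite orbF; case: (i \in J); case: (i \in Y) => /=; lra.
  have [i0 ti0] : exists i0, t i0 = N.
    have [/existsP[i hi]|] := boolP [exists i, (i \in J) != (i \in cl J)].
      exists i; move: hi; rewrite /t /z !inE; case: (boolP (i \in X)) => iX.
        by rewrite orbT; case: (i \in J) => //= _; rewrite subr0.
      by rewrite orbF; case: (i \in J); case: (i \in Y) => //= _; rewrite sub0r opprK.
    rewrite negb_exists => /forallP same; case/eqP: neJ; apply/setP => i.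
    by have := same i; rewrite negbK => /eqP.
  have : N <= \sum_i t i by rewrite (bigD1 i0) //= ti0 lerDl sumr_ge0.
  rewrite /t sumrB -!big_mkcond /=; have := Nf J (cl J); rewrite /tilt; lra.
have tiltE J : X \subset J -> J \subset Y ->
    tilt f z J = f J + \sum_(i in (J :\: X)%SET) u i + \sum_(i in X) z i.
  move=> XJ JY; rewrite /tilt -addrA; congr (_ + _).
  rewrite (bigID (mem X)) /= addrC; congr (_ + _).
    apply: eq_big => [i|i /andP[iJ iX]]; first by rewrite !inE andbC.
    by rewrite /z (negbTE iX) (fintype.subsetP JY _ iJ).
  apply: eq_bigl => i; case iX: (i \in X); last by rewrite andbF.
  by rewrite (fintype.subsetP XJ _ iX).
exists z => J; split=> [hJ|[XJ JY mx]].
  have eJ : J = cl J.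
    apply/eqP; apply: contraT => /far; rewrite ltNge; case/negP.
    exact: (cellP _ _ _ hJ).
  have XJ : X \subset J by rewrite eJ.
  have JY : J \subset Y by rewrite eJ.
  split=> // K XK KY; have := cellP _ _ _ hJ K.
  by rewrite !tiltE // lerD2r.
apply/cellP => K; have [eK|/far /ltW le] := eqVneq K (cl K).
  by rewrite eK !tiltE // lerD2r mx.
by apply: le_trans le _; rewrite !tiltE // lerD2r mx.
Qed.

Lemma sum_setD_setU X (A : {set 'I_n}) u : [disjoint A & X] ->
  \sum_(i in ((X :|: A) :\: X)%SET) u i = \sum_(i in A) u i.
Proof.
move=> dis; apply: eq_bigl => i; rewrite !inE.
have [iA|iA] := boolP (i \in A); first by rewrite (disjointFr dis iA) orbT.
by rewrite orbF andNb.
Qed.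

Lemma box2P X i j K : X \subset K -> K \subset (X :|: [set i; j])%SET ->
  [\/ K = X, K = (X :|: [set i])%SET, K = (X :|: [set j])%SET |
      K = (X :|: [set i; j])%SET].
Proof.
move=> /fintype.subsetP XK /fintype.subsetP KX.
have E (A : {set 'I_n}) : A \subset K -> (forall x, x \in [set i; j]%SET -> x \in K -> x \in A) ->
    K = (X :|: A)%SET.
  move=> /fintype.subsetP AK h; apply/setP => x; apply/idP/idP.
    by move=> xK; have := KX x xK; rewrite !(finset.in_setU x X) => /orP[->//|/h/(_ xK) ->]; rewrite ?orbT.
  by rewrite inE => /orP[/XK|/AK].
have [iK|iK] := boolP (i \in K); have [jK|jK] := boolP (j \in K).
- by constructor 4; apply: E => //; rewrite finset.subUset !finset.sub1set iK.
- constructor 2; apply: E => [|x]; rewrite ?finset.sub1set //.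
  by rewrite !inE => /orP[//|/eqP ->]; rewrite (negbTE jK).
- constructor 3; apply: E => [|x]; rewrite ?finset.sub1set //.
  by rewrite !inE => /orP[/eqP ->|//]; rewrite (negbTE iK).
- constructor 1; rewrite [LHS](E finset.set0) ?finset.setU0 ?finset.sub0set //.
  by move=> x; rewrite !inE => /orP[] /eqP ->; rewrite ?(negbTE iK) ?(negbTE jK).
Qed.

Lemma box3P X i j k K : X \subset K -> K \subset (X :|: [set i; j; k])%SET ->
  [\/ [\/ K = X, K = (X :|: [set i])%SET, K = (X :|: [set j])%SET |
        K = (X :|: [set i; j])%SET] |
      [\/ K = (X :|: [set k])%SET, K = (X :|: [set i; k])%SET, K = (X :|: [set j; k])%SET |
        K = (X :|: [set i; j; k])%SET]].
Proof.
move=> XK KX; have [kK|kK] := boolP (k \in K); last first.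
  left; apply: box2P => //; apply/fintype.subsetP => x xK.
  have := fintype.subsetP KX x xK; rewrite !inE => /orP[->//|/orP[->|/eqP e]]; rewrite ?orbT //.
  by rewrite -e xK in kK.
have XkA (A : {set 'I_n}) : (X :|: [set k] :|: A)%SET = (X :|: (A :|: [set k]))%SET.
  by rewrite -finset.setUA [([set k] :|: A)%SET]finset.setUC.
have XkK : (X :|: [set k])%SET \subset K by rewrite finset.subUset XK finset.sub1set.
have KXk : K \subset (X :|: [set k] :|: [set i; j])%SET by rewrite XkA.
right; case: (box2P XkK KXk) => ->; rewrite ?XkA.
- by constructor 1.
- by constructor 2.
- by constructor 3.
- by constructor 4.
Qed.

Section Pair.
Variables (f : {set 'I_n} -> R) (X : {set 'I_n}) (i j : 'I_n).
Hypotheses (ij : i != j) (iX : i \notin X) (jX : j \notin X).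

Let fX := f X.
Let fi := f (X :|: [set i])%SET.
Let fj := f (X :|: [set j])%SET.
Let fij := f (X :|: [set i; j])%SET.

Lemma pair_cell : fi + fj <= fij + fX -> exists z,
  [/\ X \in cell f z, (X :|: [set i; j])%SET \in cell f z,
      forall J, J \in cell f z -> [\/ J = X, J = (X :|: [set i; j])%SET | fi + fj = fij + fX] &
      fi + fj = fij + fX ->
        (X :|: [set i])%SET \in cell f z /\ (X :|: [set j])%SET \in cell f z].
Proof.
(* The sum of [ui] and [uj] levels [X] with [Xij], and their difference levels [Xi] with [Xj]; the
   comparison of the two levels is then that of [fi + fj] with [fij + fX]. *)
move=> le; pose ui := (fX - fij + fj - fi) / 2; pose uj := (fX - fij - fj + fi) / 2.
pose u x := if x == i then ui else uj.
have [z hz] := @box_cell f X (X :|: [set i; j])%SET u (finset.subsetUl _ _).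
have dis (A : {set 'I_n}) : A \subset [set i; j]%SET -> [disjoint A & X].
  move=> /fintype.subsetP h; rewrite disjoint_subset; apply/fintype.subsetP => x /h.
  by rewrite !inE => /orP[] /eqP ->.
have s0 : \sum_(x in (X :\: X)%SET) u x = 0 by rewrite finset.setDv big_set0.
have s1 : \sum_(x in ((X :|: [set i]) :\: X)%SET) u x = ui.
  by rewrite sum_setD_setU ?big_set1 /u ?eqxx //; apply: dis; exact: finset.subsetUl.
have s2 : \sum_(x in ((X :|: [set j]) :\: X)%SET) u x = uj.
  rewrite sum_setD_setU ?big_set1 /u; last by apply: dis; exact: finset.subsetUr.
  by rewrite eq_sym (negbTE ij).
have s3 : \sum_(x in ((X :|: [set i; j]) :\: X)%SET) u x = ui + uj.
  rewrite sum_setD_setU ?dis // big_setU1 ?inE //= big_set1 /u eqxx.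
  by rewrite eq_sym (negbTE ij).
have sub1 : X \subset (X :|: [set i])%SET by exact: finset.subsetUl.
have sub2 : X \subset (X :|: [set j])%SET by exact: finset.subsetUl.
have sub3 : X \subset (X :|: [set i; j])%SET by exact: finset.subsetUl.
have sub4 : (X :|: [set i])%SET \subset (X :|: [set i; j])%SET.
  by rewrite finset.setUS // finset.subsetUl.
have sub5 : (X :|: [set j])%SET \subset (X :|: [set i; j])%SET.
  by rewrite finset.setUS // finset.subsetUr.
have ub J c : c = f J + \sum_(x in (J :\: X)%SET) u x -> fX <= c ->
    forall K, X \subset K -> K \subset (X :|: [set i; j])%SET ->
    f K + \sum_(x in (K :\: X)%SET) u x <= f J + \sum_(x in (J :\: X)%SET) u x.
  move=> <- lec K XK KX; case: (box2P XK KX) => ->;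
    rewrite ?s0 ?s1 ?s2 ?s3 -?/fX -?/fi -?/fj -?/fij; move: lec le; rewrite /ui /uj; lra.
exists z; split.
- by apply/hz; split=> //; apply: (ub X fX) => //; rewrite s0 addr0.
- by apply/hz; split=> //; apply: (ub _ fX) => //; rewrite s3 -/fij /ui /uj; lra.
- move=> J /hz[XJ JX mx]; have := mx X (fintype.subxx X) sub3; rewrite s0 -/fX.
  case: (box2P XJ JX) => ->; rewrite ?s1 ?s2 -?/fi -?/fj; [by constructor 1| | |by constructor 2].
    by rewrite /ui => h; constructor 3; move: le h; lra.
  by rewrite /uj => h; constructor 3; move: le h; lra.
move=> e; split; apply/hz; split=> //; apply: (ub _ fX) => //.
  by rewrite s1 -/fi /ui; move: e; lra.
by rewrite s2 -/fj /uj; move: e; lra.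
Qed.
End Pair.

Section Triple.
Variables (f : {set 'I_n} -> R) (X : {set 'I_n}) (i j k : 'I_n).
Hypotheses (ij : i != j) (jk : j != k) (ik : i != k).
Hypotheses (iX : i \notin X) (jX : j \notin X) (kX : k \notin X).

Let fi := f (X :|: [set i])%SET.
Let fj := f (X :|: [set j])%SET.
Let fk := f (X :|: [set k])%SET.
Let fij := f (X :|: [set i; j])%SET.
Let fik := f (X :|: [set i; k])%SET.
Let fjk := f (X :|: [set j; k])%SET.

Lemma triple_cell :
  fij + f X <= fi + fj -> f (X :|: [set i; j; k])%SET + fk <= fik + fjk ->
  fik + fj <= fij + fk -> fjk + fi <= fij + fk -> exists z,
  [/\ (X :|: [set i; j])%SET \in cell f z /\ (X :|: [set k])%SET \in cell f z,
      forall J, J \in cell f z ->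
        [\/ J = (X :|: [set i; j])%SET \/ J = (X :|: [set k])%SET,
            fik + fj = fij + fk /\ (J = (X :|: [set i; k])%SET \/ J = (X :|: [set j])%SET),
            fjk + fi = fij + fk /\ (J = (X :|: [set j; k])%SET \/ J = (X :|: [set i])%SET) |
            fik + fj = fij + fk /\ fjk + fi = fij + fk],
      fik + fj = fij + fk ->
        (X :|: [set i; k])%SET \in cell f z /\ (X :|: [set j])%SET \in cell f z &
      fjk + fi = fij + fk ->
        (X :|: [set j; k])%SET \in cell f z /\ (X :|: [set i])%SET \in cell f z].
Proof.
(* The weights solve the three equations that level the complementary pairs [i | jk], [j | ik],
   [k | ij]. The level of a pair then grows with the sum of its two values of [f], so the largest
   sum wins; submodularity keeps [X] and [Xijk] from rising above it. *)
move=> sub_bot sub_top leT1 leT2.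
pose a := fi - fjk; pose b := fj - fik; pose c := fk - fij.
pose ui := (c + b) / 2; pose uj := (c + a) / 2; pose uk := (b + a) / 2.
pose u x := if x == i then ui else if x == j then uj else uk.
have [z hz] := @box_cell f X (X :|: [set i; j; k])%SET u (finset.subsetUl _ _).
have ji : (j == i) = false by rewrite eq_sym (negbTE ij).
have ki : (k == i) = false by rewrite eq_sym (negbTE ik).
have kj : (k == j) = false by rewrite eq_sym (negbTE jk).
have inijk (A : {set 'I_n}) : A \subset [set i; j; k]%SET -> [disjoint A & X].
  move=> /fintype.subsetP h; rewrite disjoint_subset; apply/fintype.subsetP => x /h.
  by rewrite !inE -orbA => /or3P[] /eqP ->.
have s1 x : x \in [set i; j; k]%SET -> \sum_(y in ((X :|: [set x]) :\: X)%SET) u y = u x.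
  by move=> hx; rewrite sum_setD_setU ?big_set1 // inijk // finset.sub1set.
have s2 x y : x \in [set i; j; k]%SET -> y \in [set i; j; k]%SET -> x != y ->
    \sum_(t in ((X :|: [set x; y]) :\: X)%SET) u t = u x + u y.
  move=> hx hy xy; rewrite sum_setD_setU; last first.
    by apply: inijk; rewrite finset.subUset !finset.sub1set hx.
  by rewrite big_setU1 ?inE //= big_set1.
have hi : i \in [set i; j; k]%SET by rewrite !inE eqxx.
have hj : j \in [set i; j; k]%SET by rewrite !inE eqxx orbT.
have hk : k \in [set i; j; k]%SET by rewrite !inE eqxx orbT.
have s3 : \sum_(t in ((X :|: [set i; j; k]) :\: X)%SET) u t = ui + uj + uk.
  rewrite sum_setD_setU ?inijk // finset.setUC big_setU1 /=; last first.
    by rewrite !inE ki kj.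
  by rewrite big_setU1 ?inE //= big_set1 /u !eqxx ji ki kj addrC.
have s0 : \sum_(x in (X :\: X)%SET) u x = 0 by rewrite finset.setDv big_set0.
have ue : [/\ u i = ui, u j = uj & u k = uk] by rewrite /u !eqxx ji ki kj.
have [ue_i ue_j ue_k] := ue.
pose m := fk + uk.
have val K : X \subset K -> K \subset (X :|: [set i; j; k])%SET ->
    f K + \sum_(x in (K :\: X)%SET) u x <= m.
  move=> XK KX; case: (box3P XK KX) => -[] ->; rewrite ?s0 ?s1 ?s2 ?s3 ?ue_i ?ue_j ?ue_k //;
    rewrite -?/fi -?/fj -?/fk -?/fij -?/fik -?/fjk;
    move: sub_bot sub_top leT1 leT2; rewrite /m /ui /uj /uk /a /b /c; lra.
have inc J : X \subset J -> J \subset (X :|: [set i; j; k])%SET ->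
    f J + \sum_(x in (J :\: X)%SET) u x = m -> J \in cell f z.
  by move=> XJ JX e; apply/hz; split=> // K XK KX; rewrite e; exact: val.
have XU (A : {set 'I_n}) : X \subset (X :|: A)%SET by exact: finset.subsetUl.
have UX1 x : x \in [set i; j; k]%SET -> (X :|: [set x])%SET \subset (X :|: [set i; j; k])%SET.
  by move=> hx; rewrite finset.setUS // finset.sub1set.
have UX2 x y : x \in [set i; j; k]%SET -> y \in [set i; j; k]%SET ->
    (X :|: [set x; y])%SET \subset (X :|: [set i; j; k])%SET.
  by move=> hx hy; rewrite finset.setUS // finset.subUset !finset.sub1set hx.
have ck : (X :|: [set k])%SET \in cell f z by apply: inc; rewrite ?UX1 // s1 // ue_k.
exists z; split.
- split=> //; apply: inc; rewrite ?UX2 // s2 // ue_i ue_j -/fij.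
  by rewrite /m /ui /uj /uk /a /b /c; lra.
- move=> J /hz[XJ JX mx]; have := mx _ (XU _) (UX1 _ hk); rewrite s1 // ue_k -/fk -/m.
  case: (box3P XJ JX) => -[] ->; rewrite ?s0 ?s1 ?s2 ?s3 ?ue_i ?ue_j ?ue_k //;
    rewrite -?/fi -?/fj -?/fk -?/fij -?/fik -?/fjk => h.
  + constructor 4; move: h sub_bot sub_top leT1 leT2; rewrite /m /ui /uj /uk /a /b /c; move=> *.
    by split; lra.
  + constructor 3; split; last by right.
    by move: h sub_bot sub_top leT1 leT2; rewrite /m /ui /uj /uk /a /b /c; lra.
  + constructor 2; split; last by right.
    by move: h sub_bot sub_top leT1 leT2; rewrite /m /ui /uj /uk /a /b /c; lra.
  + by constructor 1; left.
  + by constructor 1; right.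
  + constructor 2; split; last by left.
    by move: h sub_bot sub_top leT1 leT2; rewrite /m /ui /uj /uk /a /b /c; lra.
  + constructor 3; split; last by left.
    by move: h sub_bot sub_top leT1 leT2; rewrite /m /ui /uj /uk /a /b /c; lra.
  + constructor 4; move: h sub_bot sub_top leT1 leT2; rewrite /m /ui /uj /uk /a /b /c; move=> *.
    by split; lra.
- move=> e; split; apply: inc; rewrite ?UX1 ?UX2 ?s1 ?s2 // ?ue_i ?ue_j ?ue_k -?/fj -?/fik;
    move: e; rewrite /m /ui /uj /uk /a /b /c; lra.
- move=> e; split; apply: inc; rewrite ?UX1 ?UX2 ?s1 ?s2 // ?ue_i ?ue_j ?ue_k -?/fi -?/fjk;
    move: e; rewrite /m /ui /uj /uk /a /b /c; lra.
Qed.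
End Triple.

End BoxCells.

(** * Segments and squares that are not g-positroids *)

Section Converse.
Variables (R : realType) (n : nat).
Implicit Types (f g : setfun R n) (z : 'I_n -> R) (x y : 'rV[R]_n) (A J K X : {set 'I_n}).
Implicit Types (M : {set {set 'I_n}}) (i j k : 'I_n).

Lemma xsumD x y A : xsum (x + y) A = xsum x A + xsum y A.
Proof. by rewrite /xsum -big_split; apply: eq_bigr => i _; rewrite mxE. Qed.

Lemma xsumZ (a : R) x A : xsum (a *: x) A = a * xsum x A.
Proof. by rewrite /xsum mulr_sumr; apply: eq_bigr => i _; rewrite mxE. Qed.

Lemma xsum_delta i A : xsum (delta_mx 0 i : 'rV[R]_n) A = (i \in A)%:R.
Proof.
rewrite /xsum; have [iA|iA] := boolP (i \in A).
  rewrite (bigD1 i) //= mxE !eqxx big1 ?addr0 // => j /andP[_ ji].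
  by rewrite mxE (negbTE ji) andbF.
by rewrite big1 // => j jA; rewrite mxE andTb; case: eqVneq jA iA => // -> ->.
Qed.

Lemma eset_setU1 X i : i \notin X -> eset R (X :|: [set i])%SET = eset R X + delta_mx 0 i.
Proof.
move=> iX; apply/rowP => j; rewrite !mxE !inE eqxx /=.
by have [->|ji] := eqVneq j i; rewrite ?(negbTE iX) ?add0r ?orbF ?addr0.
Qed.

Lemma eset_setU2 X i j : i != j -> i \notin X -> j \notin X ->
  eset R (X :|: [set i; j])%SET = eset R X + delta_mx 0 i + delta_mx 0 j.
Proof.
move=> ij iX jX; rewrite finset.setUA eset_setU1 ?eset_setU1 //.
by rewrite !inE negb_or jX eq_sym.
Qed.

Lemma hull_coord_eq M x i j (a b : R) :
  (forall J, J \in M -> a * (i \in J)%:R + b * (j \in J)%:R = 0) ->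
  hull M x -> a * x 0 i + b * x 0 j = 0.
Proof.
move=> h [w hw hM]; rewrite !(weights_coord _ hw) !mulr_sumr -big_split /= big1 // => J _.
have [/hM ->|/negPn/h e] := boolP (J \notin M); first by rewrite !mul0r !mulr0 addr0.
by rewrite mulrCA [b * _]mulrCA -mulrDr e mulr0.
Qed.

Lemma itvset_convex (a b i j k : 'I_n) : (i < j)%N -> (j < k)%N ->
  i \in itvset a b -> k \in itvset a b -> j \in itvset a b.
Proof. by rewrite !inE; lia. Qed.

(* [p], [q], [r] tell which of [i], [j], [k] belong to a set whose constraint
   cuts off a point slightly displaced from the midpoint of an edge of
   direction [e_i + e_j - e_k]. *)
Lemma edge_violation (s f g : R) (c p q r : bool) :
  g <= s + p%:R + q%:R <= f -> g <= s + r%:R <= f ->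
  ~~ (g <= s + (1 / 2 + (if c then 1 / 4 else 0)) * p%:R
         + (1 / 2 + (if c then 0 else 1 / 4)) * q%:R + 1 / 4 * r%:R <= f) ->
  [/\ p = ~~ c, q = c, r & s + 3 / 4 < g].
Proof.
move=> /andP[h1 h2] /andP[h3 h4]; rewrite negb_and -!ltNge.
by case: c; case: p h1 h2; case: q; case: r h3 h4 => /= h3 h4 h1 h2 /orP[] h;
  first [by exfalso; lra | by split=> //; lra].
Qed.

Section NotGPP.
Variables (X : {set 'I_n}) (M : {set {set 'I_n}}).

(** On each set the value of [X + e_i + e_j / 2] lies between those of the two endpoints, so it
    satisfies all constraints; but it is off the segment, as its coordinates [i] and [j] differ. *)
Lemma pair_not_g_polymatroid i j : i != j -> i \notin X -> j \notin X ->
  X \in M -> (X :|: [set i; j])%SET \in M ->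
  (forall J, J \in M -> J = X \/ J = (X :|: [set i; j])%SET) ->
  ~ g_polymatroid (hull M : set 'rV[R]_n).
Proof.
move=> ij iX jX MX MXij hM [f [g [_ e]]].
have QX := (hull_eset R M X).2 MX; have QXij := (hull_eset R M _).2 MXij.
rewrite e in QX QXij; rewrite eset_setU2 // in QXij.
pose y : 'rV[R]_n := eset R X + delta_mx 0 i + (1 / 2) *: delta_mx 0 j.
have : hull M y.
  rewrite e => A; move: (QX A) (QXij A); rewrite /y !xsumD xsumZ !xsum_delta.
  by case: (i \in A); case: (j \in A) => /=; lra.
have h J : J \in M -> 1 * (i \in J)%:R + -1 * (j \in J)%:R = 0 :> R.
  by move=> /hM[] ->; rewrite ?inE ?(negbTE iX) ?(negbTE jX) ?eqxx ?orbT; lra.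
move=> /(hull_coord_eq h); rewrite !mxE !eqxx (negbTE iX) (negbTE jX).
by rewrite (negbTE ij) eq_sym (negbTE ij) /=; lra.
Qed.

(** Two points off the segment violate lower bounds on a set [A] containing [j], [k] but not [i] and
    a set [B] containing [i], [k] but not [j]. Supermodularity then makes the sum of [g] at the
    union and the intersection exceed [s(A) + s(B) + 3/2], whereas the endpoints allow at most
    [s(A) + s(B) + 1]. *)
Lemma edge_not_g_polymatroid i j k : i != j -> j != k -> i != k ->
  i \notin X -> j \notin X -> k \notin X ->
  (X :|: [set i; j])%SET \in M -> (X :|: [set k])%SET \in M ->
  (forall J, J \in M -> J = (X :|: [set i; j])%SET \/ J = (X :|: [set k])%SET) ->
  ~ g_polymatroid (hull M : set 'rV[R]_n).
Proof.
move=> ij jk ik iX jX kX Mij Mk hM [f [g [[_ _ _ sup _] e]]].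
have Qij := (hull_eset R M _).2 Mij; have Qk := (hull_eset R M _).2 Mk.
rewrite e eset_setU2 // in Qij; rewrite e eset_setU1 // in Qk.
have ji : (j == i) = false by rewrite eq_sym (negbTE ij).
have ki : (k == i) = false by rewrite eq_sym (negbTE ik).
have kj : (k == j) = false by rewrite eq_sym (negbTE jk).
have xij y : hull M y -> 1 * y 0 i + -1 * y 0 j = 0.
  apply: hull_coord_eq => J /hM[] ->; rewrite !inE (negbTE iX) (negbTE jX) ?eqxx ?orbT /=;
    first by lra.
  by rewrite (negbTE ik) (negbTE jk); lra.
pose s A := xsum (eset R X) A.
have key (c : bool) : exists A,
    [/\ (i \in A) = ~~ c, (j \in A) = c, k \in A & s A + 3 / 4 < g A].
  pose a : R := if c then 1 / 4 else 0; pose b : R := if c then 0 else 1 / 4.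
  pose y : 'rV[R]_n := eset R X + (1 / 2 + a) *: delta_mx 0 i
    + (1 / 2 + b) *: delta_mx 0 j + (1 / 4) *: delta_mx 0 k.
  have ny : ~ hull M y.
    move=> /xij; rewrite !mxE !eqxx (negbTE iX) (negbTE jX) (negbTE ij) ji (negbTE ik) (negbTE jk) /=.
    by rewrite /a /b; case: c {a b y}; lra.
  rewrite e in ny; have [A /negP hA] : exists A, ~ (g A <= xsum y A <= f A) by exact/existsNP.
  exists A; move: (Qij A) (Qk A) hA; rewrite !xsumD !xsumZ !xsum_delta.
  exact: edge_violation.
have [A [Ai Aj Ak gA]] := key true; have [B [Bi Bj Bk gB]] := key false.
have := sup A B; move: (Qij (A :|: B)%SET) (Qk (A :|: B)%SET) (Qij (A :&: B)%SET) (Qk (A :&: B)%SET).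
rewrite !xsumD !xsum_delta !inE Ai Aj Ak Bi Bj Bk /= -!/(s _).
have : s (A :|: B)%SET + s (A :&: B)%SET = s A + s B.
  rewrite /s /xsum; under eq_bigr do rewrite eset_coord.
  rewrite !(big_mkcond (fun i => i \in _)) /= -!big_split; apply: eq_bigr => t _.
  rewrite !inE !mxE; case: (t \in A); case: (t \in B); rewrite /= ?addr0 ?add0r //.
move: gA gB; lra.
Qed.

(** The coordinates [i] and [k] sum to 1 at the four vertices, but not at [X + e_i + e_k]. The value
    of this point on a set equals that of some vertex unless the set meets [{i, j, k}] in [{i, k}],
    which no interval does. *)
Lemma square_not_GPP i j k : (i < j)%N -> (j < k)%N ->
  i \notin X -> j \notin X -> k \notin X ->
  (X :|: [set i; j])%SET \in M -> (X :|: [set k])%SET \in M ->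
  (X :|: [set j; k])%SET \in M -> (X :|: [set i])%SET \in M ->
  (forall J, J \in M -> (J = (X :|: [set i; j])%SET \/ J = (X :|: [set k])%SET) \/
                        (J = (X :|: [set j; k])%SET \/ J = (X :|: [set i])%SET)) ->
  ~ GPP (hull M : set 'rV[R]_n).
Proof.
move=> lij ljk iX jX kX Mij Mk Mjk Mi hM [f [g [_ e eI]]].
have neq (a b : 'I_n) : (a < b)%N -> (a == b) = false by rewrite -val_eqE /=; lia.
have ij := neq _ _ lij; have jk := neq _ _ ljk; have ik := neq _ _ (ltn_trans lij ljk).
have ki : (k == i) = false by rewrite eq_sym.
have Qij := (hull_eset R M _).2 Mij; have Qk := (hull_eset R M _).2 Mk.
have Qjk := (hull_eset R M _).2 Mjk; have Qi := (hull_eset R M _).2 Mi.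
rewrite e eset_setU2 ?ij // in Qij; rewrite e eset_setU1 // in Qk.
rewrite e eset_setU2 ?jk // in Qjk; rewrite e eset_setU1 // in Qi.
pose y : 'rV[R]_n := eset R X + delta_mx 0 i + delta_mx 0 k.
have : hull M y.
  rewrite e eI => a b ab; move: (Qij (itvset a b)) (Qk (itvset a b)).
  move: (Qjk (itvset a b)) (Qi (itvset a b)); rewrite !xsumD !xsum_delta.
  have : (i \in itvset a b) && (k \in itvset a b) ==> (j \in itvset a b).
    by apply/implyP => /andP[]; exact: itvset_convex.
  by case: (i \in itvset a b); case: (j \in itvset a b); case: (k \in itvset a b) => //= _; lra.
rewrite /y => -[w hw hMw].
have : y 0 i + y 0 k = 1.
  rewrite !(weights_coord _ hw) -big_split /=; have [_ w1 _] := hw.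
  rewrite -[RHS]w1; apply: eq_bigr => J _; have [/hMw ->|/negPn] := boolP (J \notin M).
    by rewrite !mul0r addr0.
  by case/hM => -[] ->; rewrite !inE (negbTE iX) (negbTE kX) ?eqxx ?ki ?ik ?jk ?ij /=
    ?(eq_sym k j) ?jk ?orbT ?orbF /= ?mulr1 ?mulr0 ?addr0 ?add0r.
by rewrite !mxE !eqxx (negbTE iX) (negbTE kX) ik ki /=; lra.
Qed.

End NotGPP.

End Converse.

(** Excluded are a tie of the outer sums above the middle one and a strict maximum at each of the
    three; what remains is a maximum attained at the middle sum and at another one. *)
Lemma middle_max (R : realFieldType) (tij tik tjk : R) :
  ~ (tik < tij /\ tij = tjk) -> ~ (tij < tik /\ tjk < tik) ->
  ~ (tik < tij /\ tjk < tij) -> ~ (tij < tjk /\ tik < tjk) ->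
  [/\ 0 <= tik - tij, 0 <= tik - tjk & tik - tij = 0 \/ tik - tjk = 0].
Proof.
move=> n1 n2 n3 n4; rewrite !subr_ge0.
case: (ltgtP tij tik) n1 n2 n3 n4 => h1 n1 n2 n3 n4.
- have e : tjk = tik.
    case: (ltgtP tjk tik) => // h; first by case: n2.
    by case: n4; split=> //; exact: lt_trans h1 h.
  by split; [|rewrite e|right; rewrite e subrr].
- case: (ltgtP tij tjk) n1 n3 n4 => h n1 n3 n4; first by case: n4; split=> //;
  exact: lt_trans h1 h.
    by case: n3.
  by case: n1.
- split; [by []| |by left; rewrite h1 subrr].
  by rewrite leNgt; apply/negP => h; case: n4; rewrite h1.
Qed.

(** * Local relations recovered from cells *)

Section Recognition.
Variables (R : realType) (n : nat).
Implicit Types (f g : setfun R n) (z : 'I_n -> R) (J K X : {set 'I_n}) (i j k : 'I_n).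

Lemma sub_bottom f X i j : (forall c, 0 <= slack f (inl c)) ->
  i != j -> i \notin X -> j \notin X ->
  f (X :|: [set i; j])%SET + f X <= f (X :|: [set i])%SET + f (X :|: [set j])%SET.
Proof. by move=> /(_ (X, i, j)) + ij iX jX; rewrite /= ij iX jX subr_ge0. Qed.

Lemma sub_top f X i j k : (forall c, 0 <= slack f (inl c)) ->
  i != j -> j != k -> i != k -> i \notin X -> j \notin X -> k \notin X ->
  f (X :|: [set i; j; k])%SET + f (X :|: [set k])%SET <=
  f (X :|: [set i; k])%SET + f (X :|: [set j; k])%SET.
Proof.
move=> s0 ij jk ik iX jX kX.
have XkA (A : {set 'I_n}) : (X :|: [set k] :|: A)%SET = (X :|: (A :|: [set k]))%SET.
  by rewrite -finset.setUA [([set k] :|: A)%SET]finset.setUC.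
have := @sub_bottom f (X :|: [set k])%SET i j s0 ij.
by rewrite !XkA; apply; rewrite !inE negb_or ?iX ?jX ?ik ?jk.
Qed.

Section TripleTerms.
Variables (f : setfun R n) (X : {set 'I_n}) (i j k : 'I_n).
Hypotheses (s0 : forall c, 0 <= slack f (inl c)).
Hypotheses (ij : i != j) (jk : j != k) (ik : i != k).
Hypotheses (iX : i \notin X) (jX : j \notin X) (kX : k \notin X).

Definition triple_cell_f := triple_cell ij jk ik iX jX kX
  (sub_bottom s0 ij iX jX) (sub_top s0 ij jk ik iX jX kX).

Lemma no_strict_max : (forall z, g_positroid (hull (cell f z) : set 'rV[R]_n)) ->
  ~ (term_ik_j f X i j k < term_ij_k f X i j k /\ term_jk_i f X i j k < term_ij_k f X i j k).
Proof.
move=> G; rewrite /term_ik_j /term_ij_k /term_jk_i => -[lt1 lt2].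
have [z [[cij ck] hc _ _]] := triple_cell_f (ltW lt1) (ltW lt2).
apply: (@edge_not_g_polymatroid R n X (cell f z) i j k) => // [J /hc[//|[e _]|[e _]|[e _]]|].
- by rewrite e ltxx in lt1.
- by rewrite e ltxx in lt2.
- by rewrite e ltxx in lt1.
by have [_ []] := G z.
Qed.
End TripleTerms.

Lemma g_positroid_local_dctp f :
  (forall z, g_positroid (hull (cell f z) : set 'rV[R]_n)) -> local_dctp f.
Proof.
move=> G.
have s0 c : 0 <= slack f (inl c).
  case: c => [[X i] j]; rewrite /=; case: ifP => // /and3P[ij iX jX].
  rewrite leNgt; apply/negP; rewrite subr_lt0 => lt.
  have [z [cX cij hc _]] := pair_cell ij iX jX (ltW lt).
  apply: (@pair_not_g_polymatroid R n X (cell f z) i j) => // [J /hc[->|->|e]|].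
  - by left.
  - by right.
  - by rewrite e ltxx in lt.
  by have [_ []] := G z.
have tri X i j k : (i < j)%N -> (j < k)%N -> X \subset (~: [set i; j; k])%SET ->
    [/\ 0 <= slack f (inr (X, i, j, k, true)), 0 <= slack f (inr (X, i, j, k, false)) &
     slack f (inr (X, i, j, k, true)) = 0 \/ slack f (inr (X, i, j, k, false)) = 0].
  move=> lij ljk hX; rewrite /slack lij ljk hX /=.
  have [iX jX kX] := triple_notin hX.
  have neq (a b : 'I_n) : (a < b)%N -> a != b by rewrite -val_eqE /=; lia.
  have ij := neq _ _ lij; have jk := neq _ _ ljk; have ik := neq _ _ (ltn_trans lij ljk).
  have kj : k != j by rewrite eq_sym.
  have ki : k != i by rewrite eq_sym.
  have ji : j != i by rewrite eq_sym.
  have C (a b : 'I_n) : [set a; b]%SET = [set b; a]%SET by rewrite finset.setUC.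
  (* Three labellings, one for each sum in the role of a strict maximum. *)
  have n3 := no_strict_max s0 ij jk ik iX jX kX G.
  have n4 := no_strict_max s0 jk ki ji jX kX iX G.
  have n2 := no_strict_max s0 ik kj ij iX kX jX G.
  rewrite /term_ik_j /term_ij_k /term_jk_i (C k i) (C j i) (C k j) in n2 n3 n4.
  apply: middle_max.
  - move=> [lt e]; have le : f (X :|: [set j; k])%SET + f (X :|: [set i])%SET <=
      f (X :|: [set i; j])%SET + f (X :|: [set k])%SET by rewrite e.
    have [z [[cij ck] hc _ hc2]] := triple_cell_f s0 ij jk ik iX jX kX (ltW lt) le.
    have [cjk ci] := hc2 (esym e).
    apply: (@square_not_GPP R n X (cell f z) i j k) => // [J /hc[hJ|[e' _]|[_ hJ]|[e' _]]|].
    + by left.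
    + by rewrite e' ltxx in lt.
    + by right.
    + by rewrite e' ltxx in lt.
    by have [] := G z.
  - by move=> [h1 h2]; apply: n2.
  - by move=> [h1 h2]; apply: n3.
  - by move=> [h1 h2]; apply: n4.
split=> [[c|[[[[X i] j] k] b]]|X i j k]; first exact: s0.
  rewrite [slack _ _]/slack; case: ifP => // /and3P[lij ljk hX].
  by have [+ + _] := tri X i j k lij ljk hX; rewrite /slack lij ljk hX; case: b.
case C: [&& (i < j)%N, (j < k)%N & X \subset (~: [set i; j; k])%SET]; last by left;
  rewrite /slack C.
by have /and3P[lij ljk hX] := C; have [] := tri X i j k lij ljk hX.
Qed.

(** When the sets of a relation lie in one cell of [g], a tilt of [g] is constant on them, and
    tilting does not change slacks. *)
Lemma tight_transfer f g c : local_dctp f ->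
  (forall z, exists z', cell f z = cell g z') -> slack f c = 0 -> slack g c = 0.
Proof.
move=> [p _] fg; case: c => [[[X i] j]|[[[[X i] j] k] b]].
  have := p (inl (X, i, j)); rewrite /slack; case: ifP => // /and3P[ij iX jX] le.
  move=> /eqP; rewrite subr_eq0 => /eqP e.
  have [z [cX cij _ /(_ e)[ci cj]]] := pair_cell ij iX jX (eq_ind _ (fun t => t <= _) (lexx _) _ (esym e)).
  have [z' ez] := fg z; rewrite ez in cX cij ci cj.
  have := slack_tilt g z' (inl (X, i, j)); rewrite /slack ij iX jX /= => <-.
  by rewrite (cell_eq ci cX) (cell_eq cj cX) (cell_eq cij cX); ring.
have s0 c : 0 <= slack f (inl c) by exact: p.
(* The other inequality of the triple shows that the tight term is a largest of the three sums, as
   [triple_cell] requires. *)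
have := p (inr (X, i, j, k, ~~ b)); rewrite /slack; case: ifP => // /and3P[lij ljk hX].
rewrite subr_ge0 => le /eqP; rewrite subr_eq0 => /eqP e.
have [iX jX kX] := triple_notin hX.
have neq (a b' : 'I_n) : (a < b')%N -> a != b' by rewrite -val_eqE /=; lia.
have ij := neq _ _ lij; have jk := neq _ _ ljk; have ik := neq _ _ (ltn_trans lij ljk).
have ki : k != i by rewrite eq_sym.
have ji : j != i by rewrite eq_sym.
have C (a b' : 'I_n) : [set a; b']%SET = [set b'; a]%SET by rewrite finset.setUC.
suff [z' [J0 [cik cj c1 c2]]] : exists z' J0, [/\ tilt g z' (X :|: [set i; k])%SET = tilt g z' J0,
   tilt g z' (X :|: [set j])%SET = tilt g z' J0,
   tilt g z' (if b then X :|: [set i; j] else X :|: [set j; k])%SET = tilt g z' J0 &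
   tilt g z' (if b then X :|: [set k] else X :|: [set i])%SET = tilt g z' J0].
  have := slack_tilt g z' (inr (X, i, j, k, b)); rewrite /slack lij ljk hX /= => <-.
  by rewrite cik cj; case: b {le e} c1 c2 => /= -> ->; ring.
case: b le e => /= le e.
  rewrite e in le.
  have [z [[cij ck] _ /(_ e)[cik cj] _]] :=
    triple_cell_f s0 ij jk ik iX jX kX (eq_ind _ (fun t => t <= _) (lexx _) _ (esym e)) le.
  have [z' ez] := fg z; rewrite ez in cij ck cik cj.
  by exists z', (X :|: [set k])%SET; split; exact: cell_eq.
rewrite e in le; rewrite (C i k) in e.
have [||z [[cjk ci] _ _ /(_ e)[cik cj]]] := @triple_cell_f f X j k i s0 jk ki ji jX kX iX.
- by rewrite (C j i); exact: le.
- by rewrite e.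
have [z' ez] := fg z; rewrite ez in cjk ci cik cj; rewrite (C k i) in cik.
by exists z', (X :|: [set i])%SET; split; exact: cell_eq.
Qed.

End Recognition.

(** * The fans *)

Section LocalSubmodularity.
Variables (R : realFieldType) (n : nat).
Implicit Types (f : {set 'I_n} -> R) (X Y A B : {set 'I_n}).

Lemma sub_bottom_bump f X (i j : 'I_n) : (forall c, 0 <= slack f (inl c)) ->
  i != j -> i \notin X -> j \notin X ->
  f (i |: (j |: X))%SET + f X <= f (i |: X)%SET + f (j |: X)%SET.
Proof.
move=> /(_ (X, i, j)) + ij iX jX; rewrite /= ij iX jX subr_ge0.
by rewrite ![(X :|: _)%SET]finset.setUC finset.setUA.
Qed.

Lemma local_submod f : (forall c, 0 <= slack f (inl c)) ->
  forall A B, f (A :|: B)%SET + f (A :&: B)%SET <= f A + f B.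
Proof.
move=> s0.
have marg X Y a : X \subset Y -> a \notin Y -> f (a |: Y)%SET + f X <= f (a |: X)%SET + f Y.
  have [m hm] := ubnP #|Y :\: X|; elim: m Y hm => // m IH Y hm XY aY.
  have [YX|/fintype.subsetPn[b bY bX]] := boolP (Y \subset X).
    have -> : Y = X by apply/eqP; rewrite finset.eqEsubset YX.
    by rewrite lexx.
  have ab : a != b by apply: contraNneq aY => ->.
  have aY' : a \notin (Y :\ b)%SET by rewrite !inE negb_and aY orbT.
  have bY' : b \notin (Y :\ b)%SET by rewrite !inE eqxx.
  have hm' : (#|(Y :\ b) :\: X| < m)%N.
    rewrite ltnS in hm; apply: leq_trans hm; rewrite finset.setDDl finset.setUC -finset.setDDl.
    by rewrite [ltnRHS](cardsD1 b) !inE bX bY.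
  have XY' : X \subset (Y :\ b)%SET by rewrite finset.subsetD1 XY bX.
  have := IH (Y :\ b)%SET hm' XY' aY'; have := @sub_bottom_bump f (Y :\ b)%SET a b s0 ab aY' bY'.
  by rewrite finset.setD1K //; lra.
move=> A B; have [m hm] := ubnP #|A :\: B|; elim: m A hm => // m IH A hm.
have [AB|/fintype.subsetPn[a aA aB]] := boolP (A \subset B).
  by rewrite (finset.setUidPr AB) (finset.setIidPl AB) addrC.
have := @marg (A :\ a)%SET ((A :\ a) :|: B)%SET a (finset.subsetUl _ _).
rewrite !inE eqxx (negbTE aB) /= finset.setUA finset.setD1K // => /(_ isT) le1.
have := IH (A :\ a)%SET; have -> : ((A :\ a) :&: B = A :&: B)%SET.
  by apply/setP => x; rewrite !inE; case: eqVneq => // ->; rewrite (negbTE aB) !andbF.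
suff -> : (#|(A :\ a) :\: B| < m)%N by move=> /(_ isT); move: le1; lra.
rewrite ltnS in hm; apply: leq_trans hm; rewrite finset.setDDl finset.setUC -finset.setDDl.
by rewrite [ltnRHS](cardsD1 a) !inE aA aB.
Qed.

End LocalSubmodularity.

Section DCTPCones.
Variables (R : realType) (n : nat).
Implicit Types (f g : setfun R n) (e : choice_fun n) (c : constraint n).

Lemma submodular_local f : submodular f <-> forall t, 0 <= slack f (inl t).
Proof.
split=> [sub [[X i] j]|s0 A B]; last exact: local_submod.
rewrite /=; case: ifP => // /and3P[ij iX jX]; rewrite subr_ge0.
have := sub (X :|: [set i])%SET (X :|: [set j])%SET.
have -> : ((X :|: [set i]) :|: (X :|: [set j]) = X :|: [set i; j])%SET.
  by apply/setP => x; rewrite !inE; case: (x \in X); case: (x == i); case: (x == j).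
have -> // : ((X :|: [set i]) :&: (X :|: [set j]) = X)%SET.
apply/setP => x; rewrite !inE; case: (x \in X) => //=.
by have [->|//] := eqVneq x i; rewrite (negbTE ij).
Qed.

Lemma slack_triple f X (i j k : 'I_n) b : triple X i j k ->
  slack f (inr (X, i, j, k, b)) =
  term_ik_j f X i j k - (if b then term_ij_k f X i j k else term_jk_i f X i j k).
Proof. by move=> [ij jk XC]; rewrite /slack ij jk XC. Qed.

Lemma slack_ntriple f X (i j k : 'I_n) b : ~ triple X i j k ->
  slack f (inr (X, i, j, k, b)) = 0.
Proof. by move=> ntr; rewrite /slack; case: ifP => // /and3P[? ? ?]; case: ntr. Qed.

Lemma DCTP_local f : DCTP f <-> local_dctp f.
Proof.
split=> [[/submodular_local sub pl]|[s0 t]].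
  have tri X i j k : triple X i j k ->
     [/\ 0 <= slack f (inr (X, i, j, k, true)), 0 <= slack f (inr (X, i, j, k, false)) &
      slack f (inr (X, i, j, k, true)) = 0 \/ slack f (inr (X, i, j, k, false)) = 0].
    move=> tr; rewrite !slack_triple //= (pl _ _ _ _ tr) !subr_ge0 !le_max !lexx orbT.
    split=> //; case: (leP (term_ij_k f X i j k) (term_jk_i f X i j k)) => _.
      by right; rewrite subrr.
    by left; rewrite subrr.
  split=> [[c|[[[[X i] j] k] b]]|X i j k]; first exact: sub.
    have [/tri[h1 h2 _]|/slack_ntriple ->//] := pselect (triple X i j k).
    by case: b.
  have [/tri[_ _ h]//|ntr] := pselect (triple X i j k).
  by left; exact: slack_ntriple.
split=> [|X i j k tr]; first by apply/submodular_local => c; exact: s0.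
move: (s0 (inr (X, i, j, k, true))) (s0 (inr (X, i, j, k, false))) (t X i j k).
rewrite !slack_triple // !subr_ge0 => h1 h2 h3.
apply/eqP; rewrite eq_le ge_max h1 h2 andbT le_max.
by case: h3 => /eqP; rewrite subr_eq0 => /eqP ->; rewrite lexx ?orbT.
Qed.

Lemma CconeP e f : Ccone e f <->
  (forall c, 0 <= slack f c) /\
  forall X i j k, slack f (inr (X, i, j, k, e X i j k)) = 0.
Proof.
split=> [[/submodular_local sub pl]|[s0 t]].
  split=> [[c|[[[[X i] j] k] b]]|X i j k]; first exact: sub.
    have [tr|/slack_ntriple ->//] := pselect (triple X i j k).
    rewrite slack_triple //; have [e1 e2] := pl _ _ _ _ tr.
    move: e1 e2; rewrite /chosen_term /other_term.
    by case: (e X i j k); case: b => // e1 e2; rewrite subr_ge0 // -?e1 ?e1.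
  have [tr|/slack_ntriple ->//] := pselect (triple X i j k).
  rewrite slack_triple //; have [+ _] := pl _ _ _ _ tr; rewrite /chosen_term.
  by case: (e X i j k) => <-; rewrite subrr.
split=> [|X i j k tr]; first by apply/submodular_local => c; exact: s0.
move: (s0 (inr (X, i, j, k, ~~ e X i j k))) (t X i j k).
rewrite !slack_triple // /chosen_term /other_term subr_ge0.
by case: (e X i j k) => /= h /eqP; rewrite subr_eq0 => /eqP eT; split.
Qed.

Lemma Ccone_local_dctp e f : Ccone e f -> local_dctp f.
Proof.
move=> /CconeP[s0 t]; split=> // X i j k.
by have := t X i j k; case: (e X i j k); [left|right].
Qed.

Lemma slackD (a : R) f g c : slack (a *: f + g : setfun R n) c = a * slack f c + slack g c.
Proof.
have E A : (a *: f + g : setfun R n) A = a * f A + g A by [].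
case: c => [[[X i] j]|[[[[X i] j] k] b]] /=; case: ifP => _; rewrite ?mulr0 ?addr0 //.
  by rewrite !E; ring.
by case: b; rewrite !E; ring.
Qed.

Lemma slack0 c : slack (0 : setfun R n) c = 0.
Proof.
by have := slackD 1 0 0 c; rewrite scaler0 addr0 mul1r; lra.
Qed.

(* The smallest face of a cone [Ccone e] that contains [f0]. *)
Definition face_at (f0 : setfun R n) : set (setfun R n) :=
  [set f | forall c, 0 <= slack f c /\ (slack f0 c = 0 -> slack f c = 0)]%classic.

Lemma induced_cell_eq f g : induced_subdivision f = induced_subdivision g ->
  forall z, exists z', cell f z = cell g z'.
Proof.
rewrite !induced_cells => e z.
have : [set (hull (cell g z) : set 'rV[R]_n) | z in setT]%classic (hull (cell f z)).
  by rewrite -e; exists z.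
by move=> [z' _ /hull_inj e']; exists z'.
Qed.

Lemma induced_eqP f0 f : local_dctp f0 ->
  induced_subdivision f = induced_subdivision f0 <->
  face_at f0 f /\ forall c, slack f c = 0 -> slack f0 c = 0.
Proof.
move=> hf0; split=> [e|[hf tf]].
  have c1 := induced_cell_eq e; have c2 := induced_cell_eq (esym e).
  (* The cells of [f] are cells of [f0], hence g-positroids, and this identifies [f] as a DCTP
     function. *)
  have hf : local_dctp f.
    apply: g_positroid_local_dctp => z; have [z' ->] := c1 z; exact: g_positroid_cell.
  split=> [c|c]; last exact: tight_transfer hf c1.
  by split; [case: hf => h _; exact: h|exact: tight_transfer hf0 c2].
have hf1 : local_dctp f.
  split=> [c|X i j k]; first by have [] := hf c.
  have [_ t] := hf0; case: (t X i j k) => h; [left|right].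
    by have [_ ->] := hf (inr (X, i, j, k, true)).
  by have [_ ->] := hf (inr (X, i, j, k, false)).
have L := local_dctp_Lconcave hf1; have L0 := local_dctp_Lconcave hf0.
have df p q : height n p -> height n q -> defect p q f = 0 <-> defect p q f0 = 0.
  move=> hp hq; have [_ tr] := @slacklike_defect R n p q hp hq.
  by split; [apply: tr|apply: tr => // c; have [] := hf c].
rewrite !induced_cells; apply/seteqP; split=> _ [z _ <-].
  by have [z' ->] := cell_eq_cell z L L0 df; exists z'.
have df' p q hp hq : defect p q f0 = 0 <-> defect p q f = 0 := iff_sym (df p q hp hq).
by have [z' ->] := cell_eq_cell z L0 L df'; exists z'.
Qed.

End DCTPCones.

(** * Faces of the cones and their images in the quotient *)

Section Faces.
Variables (R : realType) (n : nat).
Implicit Types (f g : setfun R n) (e : choice_fun n).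

Lemma Ccone_closed e (a : R) f g : 0 <= a -> Ccone e f -> Ccone e g -> Ccone e (a *: f + g).
Proof.
move=> a0 /CconeP[f0 f1] /CconeP[g0 g1]; apply/CconeP; split=> [c|X i j k].
  by rewrite slackD addr_ge0 // mulr_ge0.
by rewrite slackD f1 g1 mulr0 addr0.
Qed.

Lemma Ccone0 e : Ccone e (0 : setfun R n).
Proof. by apply/CconeP; split=> *; rewrite slack0. Qed.

Lemma face_at_sub_Ccone e f0 : Ccone e f0 -> (face_at f0 `<=` Ccone e)%classic.
Proof.
move=> /CconeP[_ t] f hf; apply/CconeP; split=> [c|X i j k]; first by have [] := hf c.
by have [_ ->] := hf (inr (X, i, j, k, e X i j k)).
Qed.

(* [f0] is a relative interior point: every constraint that is not tight on the
   whole face is strict at one of the summands. *)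
Lemma face_Ccone e (F : set (setfun R n)) : face (Ccone e) F ->
  exists2 f0, Ccone e f0 & F = face_at f0.
Proof.
move=> [[fs Ffs] [l FE]].
have [Cfs mx] : Ccone e fs /\ forall g, Ccone e g -> l g <= l fs by rewrite FE in Ffs.
have l0 : l fs = 0.
  (* A form whose maximum on a cone is attained at [fs] vanishes there: compare [fs] with 0 and with
     its double. *)
  have := mx 0 (Ccone0 e); have := mx (1 *: fs + fs) (Ccone_closed ler01 Cfs Cfs).
  by rewrite linearP linear0 /= mul1r; lra.
have {mx} le0 g : Ccone e g -> l g <= 0 by move=> /mx; rewrite l0.
have inF f : F f <-> Ccone e f /\ l f = 0.
  rewrite FE; split=> [[Cf mx]|[Cf e0]]; split=> //.
    by apply/eqP; rewrite eq_le le0 //= -l0 mx.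
  by rewrite e0.
(* A function of the face with nonzero slack at [c], if there is one; the default 0 also belongs to
   the face. *)
pose h c : setfun R n := xget 0 [set f | F f /\ slack f c != 0]%classic.
have F0 : F 0 by apply/inF; rewrite linear0; split=> //; exact: Ccone0.
have hF c : F (h c) by rewrite /h; case: xgetP => [f _ []|].
have hc c f : F f -> slack f c != 0 -> slack (h c) c != 0.
  by move=> Ff fc; rewrite /h; case: xgetP => [f' _ []//|/(_ f)]; case.
pose f0 : setfun R n := \sum_c h c.
have FD f g : F f -> F g -> F (f + g).
  move=> /inF[Cf ef] /inF[Cg eg]; apply/inF; rewrite linearD /= ef eg addr0; split=> //.
  by rewrite -[f]scale1r; apply: Ccone_closed.
have Ff0 : F f0 by rewrite /f0; elim/big_ind: _ => // c _.
have sum_slack (s : seq (constraint n)) c :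
    slack (\sum_(c' <- s) h c') c = \sum_(c' <- s) slack (h c') c.
  elim: s => [|c' s IH]; first by rewrite !big_nil slack0.
  by rewrite !big_cons -IH -[h c' + _]/(h c' + _) -[h c' in LHS]scale1r slackD mul1r.
have Cf0 : Ccone e f0 by have /inF[] := Ff0.
have ge0 f c : F f -> 0 <= slack f c by move=> /inF[/CconeP[+ _] _]; apply.
have tight c f : F f -> slack f0 c = 0 -> slack f c = 0.
  move=> Ff; rewrite /f0 sum_slack => /eqP; rewrite psumr_eq0; last by move=> c' _; exact: ge0.
  move=> /allP/(_ c); rewrite mem_index_enum => /(_ isT) /= /eqP hc0.
  by apply/eqP; apply: contraT => /(hc _ _ Ff); rewrite hc0 eqxx.
exists f0 => //; apply/seteqP; split=> f.
  by move=> Ff c; split; [exact: ge0|exact: tight].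
move=> hf; have Cf := face_at_sub_Ccone Cf0 hf; apply/inF; split=> //.
(* [f0 - eps f] stays in the cone because constraints tight at [f0] are tight at [f]. The form is at
   most 0 there and at [f], and it is 0 at [f0]; so it vanishes at [f]. *)
have [c|eps eps0 heps] := @small_perturbation R _ (fun c => slack f0 c != 0)
    (fun c => - slack f0 c) (fun c => slack f c).
  by move=> nz; rewrite oppr_lt0 lt0r nz ge0.
have C1 : Ccone e ((- eps) *: f + f0).
  have /CconeP[_ t0] := Cf0.
  apply/CconeP; split=> [c|X i j k]; rewrite slackD.
    have [s0|/heps] := eqVneq (slack f0 c) 0; last by lra.
    by have [_ ->] := hf c; rewrite // s0 mulr0 addr0.
  by rewrite t0; have [_ ->] := hf (inr (X, i, j, k, e X i j k)); rewrite ?mulr0 ?addr0.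
have := le0 _ C1; rewrite linearP /= (_ : l f0 = 0) ?addr0; last by have /inF[] := Ff0.
rewrite mulNr oppr_le0 pmulr_rge0 // => ge.
by apply/eqP; rewrite eq_le ge le0.
Qed.

(** The functional exposing [face_at f0]: on a cone it is at most 0, with equality exactly where all
    constraints tight at [f0] are tight. *)
Definition tight_form f0 f : R := - \sum_(c | slack f0 c == 0) slack f c.

Lemma tight_form_linear f0 : linear_for *%R (tight_form f0).
Proof.
move=> a f g; rewrite /tight_form; under eq_bigr do rewrite slackD.
by rewrite big_split /= -mulr_sumr opprD mulrN.
Qed.

HB.instance Definition _ f0 := GRing.isLinear.Build R (setfun R n) R *%R
  (tight_form f0) (tight_form_linear f0).

Lemma face_at_face e f0 : Ccone e f0 -> face (Ccone e) (face_at f0).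
Proof.
move=> Cf0; have inK : face_at f0 f0 by have /CconeP[+ _] := Cf0.
have K0 f : face_at f0 f -> tight_form f0 f = 0.
  by move=> hf; rewrite /tight_form big1 ?oppr0 // => c /eqP; have [_] := hf c.
have le0 f : Ccone e f -> tight_form f0 f <= 0.
  by move=> /CconeP[h _]; rewrite oppr_le0; apply: sumr_ge0.
split; first by exists f0.
exists (tight_form f0); apply/seteqP; split=> f.
  move=> hf; split; first exact: face_at_sub_Ccone hf.
  by move=> g /le0; rewrite -(K0 f hf).
move=> [Cf /(_ f0 Cf0)]; rewrite [X in X <= _](K0 f0 inK) => ge.
have /CconeP[s0 _] := Cf; have e0 : \sum_(c | slack f0 c == 0) slack f c = 0.
  by apply/eqP; rewrite eq_le sumr_ge0 // andbT -oppr_ge0.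
move=> c; split=> // /eqP tc; move/eqP: e0; rewrite psumr_eq0 // => /allP/(_ c).
by rewrite mem_index_enum => /(_ isT) /implyP/(_ tc) /eqP.
Qed.

Lemma local_dctp_Ccone f : local_dctp f -> exists e, Ccone e f.
Proof.
move=> [s0 t]; exists (fun X i j k => slack f (inr (X, i, j, k, true)) == 0).
apply/CconeP; split=> // X i j k.
by case: eqP => // nt; case: (t X i j k).
Qed.

Lemma slack_continuous c : continuous (fun f : setfun R n => slack f c).
Proof.
have ev A : continuous (fun f : setfun R n => (f A : R)).
  exact: (@proj_continuous {set 'I_n} (fun=> R) A).
have evD A B : continuous (fun f : setfun R n => (f A + f B : R)).
  by move=> f; exact: (@continuousD R R^o (setfun R n) (fun f => f A) (fun f => f B) f (ev A f) (ev B f)).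
have evB (u v : setfun R n -> R) : continuous u -> continuous v ->
  continuous (fun f => u f - v f).
  by move=> cu cv f; exact: (@continuousB R R^o (setfun R n) u v f (cu f) (cv f)).
case: c => [[[X i] j]|[[[[X i] j] k] b]] /=.
  case: [&& i != j, i \notin X & j \notin X]; last exact: cst_continuous.
  exact: (evB _ _ (evD _ _) (evD _ _)).
case: [&& (i < j)%N, (j < k)%N & X \subset _]; last exact: cst_continuous.
by case: b; exact: (evB _ _ (evD _ _) (evD _ _)).
Qed.

Lemma face_at_closed f0 : closed (face_at f0).
Proof.
have -> : face_at f0 = (\bigcap_(c in setT) ([set f : setfun R n | 0 <= slack f c] `&`
    (if slack f0 c == 0 then [set f : setfun R n | slack f c = 0] else setT)))%classic.
  apply/seteqP; split=> f h c.
    move=> _; have [h1 h2] := h c; split=> //.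
    by case: eqP => // /h2.
  by have [h1] := h c I; case: eqP => h2 h3; split.
apply: closed_bigI => c _; apply: closedI.
  apply: (@preimage_closed _ _ (fun f : setfun R n => slack f c) [set t : R | 0 <= t]%classic).
    by move=> f _; exact: slack_continuous.
  exact: closed_ge.
case: eqP => _; last exact: closedT.
apply: (@preimage_closed _ _ (fun f : setfun R n => slack f c) [set t : R | t = 0]%classic).
  by move=> f _; exact: slack_continuous.
exact: closed_eq.
Qed.

Lemma slack_lin_rel f g c : lin_rel f g -> slack f c = slack g c.
Proof.
move=> /asboolP[a [z h]].
have E S : f S = tilt g z S + a by rewrite /tilt -addrA [_ + a]addrC -h addrC subrK.
rewrite -(slack_tilt g z); case: c => [[[X i] j]|[[[[X i] j] k] b]] /=; case: ifP => _ //.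
  by rewrite !E; ring.
by case: b; rewrite !E; ring.
Qed.

Lemma proj_mod_eq f g : proj_mod f = proj_mod g -> lin_rel f g.
Proof. by move=> /eqmodP. Qed.

Local Open Scope classical_set_scope.
Local Open Scope ring_scope.

Lemma setfun_cvg (T : Type) (F : set_system T) (u : T -> setfun R n) f : Filter F ->
  (forall A, (fun t => (u t A : R)) @ F --> (f A : R)) -> u @ F --> f.
Proof.
move=> FF h; apply/cvg_sup => A U.
have -> := @nbhsE (initial_topology (fun f : setfun R n => f A)) f.
move=> [B [[C oC <-] fC]] /filterS; apply; apply: (h A).
exact: open_nbhs_nbhs.
Qed.

(** By [induced_eqP] the functions inducing the subdivision of [f0] form the relative interior of
    [face_at f0]; any other function [f] of the face is the limit of [t f0 + f] as [t] decreases to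
    0. *)
Lemma closure_proj_face f0 : local_dctp f0 ->
  closure (@proj_mod R n @` [set f | induced_subdivision f = induced_subdivision f0])%classic =
  (@proj_mod R n @` face_at f0)%classic.
Proof.
move=> hf0; apply/seteqP; split.
  have sub : (@proj_mod R n @` [set f | induced_subdivision f = induced_subdivision f0] `<=`
          @proj_mod R n @` face_at f0)%classic.
    by move=> _ [f hf <-]; exists f => //; have [] := (induced_eqP f hf0).1 hf.
  have cl : closed (@proj_mod R n @` face_at f0)%classic.
    (* Slacks are invariant under the quotient relation, so the face is saturated and its image is
       closed in the quotient topology. *)
    have pre : (@proj_mod R n @^-1` (@proj_mod R n @` face_at f0) = face_at f0)%classic.
      apply/seteqP; split=> f; last by move=> hf; exists f.
      by move=> [g hg /proj_mod_eq e] c; rewrite -(slack_lin_rel c e); exact: hg.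
    have op : open (@proj_mod R n @^-1` (~` (@proj_mod R n @` face_at f0))).
      have -> : @proj_mod R n @^-1` (~` (@proj_mod R n @` face_at f0)) = ~` face_at f0.
        by rewrite -[in RHS]pre.
      by rewrite openC; exact: face_at_closed.
    by rewrite -openC; exact: op.
  by apply: subset_trans (closureS sub) _; rewrite -((closure_id _).1 cl).
move=> _ [f hf <-] B nB.
have nf : nbhs f (@proj_mod R n @^-1` B)%classic by apply: pi_continuous.
have cv : (fun t : R => t *: f0 + f : setfun R n) @ (0 : R)^'+ --> f.
  apply: setfun_cvg => A; have -> : (f A : R) = 0 * f0 A + f A by rewrite mul0r add0r.
  apply: (@cvgD R R^o _ _ _ (fun t : R => t * f0 A) (cst (f A))); last exact: cvg_cst.
  by apply: cvgM; [apply: cvg_at_right_filter; exact: cvg_id|exact: cvg_cst].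
have near_t : (0 : R)^'+ (fun t : R => B (proj_mod (t *: f0 + f)) /\ 0 < t).
  by apply: filterI; [exact: (cv _ nf)|exact: nbhs_right_gt].
have [t [tB t0]] := filter_ex near_t.
exists (proj_mod (t *: f0 + f)); split; last exact: tB.
exists (t *: f0 + f) => //; apply/(induced_eqP _ hf0); have [s0 _] := hf0.
have pos c : 0 <= t * slack f0 c by rewrite mulr_ge0 // ltW.
split=> [c|c]; rewrite slackD; have [fc tc] := hf c.
  by split=> [|e]; [rewrite addr_ge0|rewrite tc // e mulr0 addr0].
move=> /eqP; rewrite paddr_eq0 // => /andP[/eqP/eqP + _].
by rewrite mulf_eq0 (gt_eqF t0) => /eqP.
Qed.

End Faces.

Theorem theorem1p5 (R : realType) (n : nat) :
  (forall f : setfun R n, DCTP f ->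
     forall D : set 'rV[R]_n, domain_of_affinity f D -> GPP D) /\
  MV R n = secondary_fan R n.
Proof.
split=> [f /DCTP_local hf D /domain_cell[z ->]|]; first exact: GPP_cell.
apply/seteqP; split=> C.
  move=> [e [F [/face_Ccone[f0 Cf0 ->] ->]]]; have hf0 := Ccone_local_dctp Cf0.
  exists (induced_subdivision f0); split; first by exists f0.
    split; first exact: induced_polyhedral.
    by move=> P /domain_cell[z ->]; exact: g_positroid_cell.
  by rewrite closure_proj_face.
move=> [_ [[f0 ->] [_ gpos] ->]].
have hf0 : local_dctp f0.
  by apply: g_positroid_local_dctp => z; apply: gpos; apply/domain_cell; exists z.
have [e Ce] := local_dctp_Ccone hf0.
exists e, (face_at f0); split; first exact: face_at_face.
by rewrite closure_proj_face.
Qed.
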